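(* Let $n\ge 3$ be an integer. For any real $\alpha\ge 0$ and any integer $p\in\{1,\dots,n-1\}$, the map $u_0(x)=\frac{x}{\|x\|}$ minimizes the energy $E_{p,r^\alpha}(u)=\int_{\mathbf{B}^n} r^{\alpha}\|\nabla u\|^p\,dx$ (with $r=\|x\|$): for every $u\in W^{1,p}(\mathbf{B}^n,\mathbb{S}^{n-1})$ with $u(x)=x$ on $\mathbb{S}^{n-1}$, one has $$\int_{\mathbf{B}^n} r^{\alpha}\|\nabla u_0\|^p\,dx\le\int_{\mathbf{B}^n} r^{\alpha}\|\nabla u\|^p\,dx .$$ Moreover, if $\alpha>0$, then $u_0$ is the unique minimizer of $E_{p,r^\alpha}$ in this class, that is, equality holds in the last inequality if and only if $u=u_0$.
   Context: $\mathbf{B}^n$ is the Euclidean unit ball of $\mathbb{R}^n$, $\mathbb{S}^{n-1}$ its boundary sphere, $\|\cdot\|$ the Euclidean norm. $W^{1,p}(\mathbf{B}^n,\mathbb{S}^{n-1})=\{u\in W^{1,p}(\mathbf{B}^n,\mathbb{R}^n): \|u\|=1 \text{ a.e.}\}$. The condition $u(x)=x$ on $\mathbb{S}^{n-1}$ is understood in the sense of traces, and equality of maps is almost everywhere. $\|\nabla u\|=\big(\sum_{i,j}|\partial u_i/\partial x_j|^2\big)^{1/2}$. *)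

(* Defs.v *)
From HB Require Import structures.
From mathcomp Require Import all_boot all_order all_algebra.
From mathcomp Require Import all_classical all_reals all_analysis.
From mathcomp Require Import measurable_realfun.

Set Implicit Arguments.
Unset Strict Implicit.
Unset Printing Implicit Defensive.

Import Order.TTheory GRing.Theory Num.Theory.
Import numFieldNormedType.Exports.

Local Open Scope classical_set_scope.
Local Open Scope ring_scope.

(* The sigma-algebra generated by the coordinates, i.e. the Borel sets. *)
Section measurable_rV.
Context (R : realType) (n : nat).

Let coors : 'I_n -> 'rV[R]_n -> R := fun i x => x 0 i.

Let rV_set0 : g_sigma_preimage coors set0.
Proof. exact: sigma_algebra0. Qed.

Let rV_setC A : g_sigma_preimage coors A -> g_sigma_preimage coors (~` A).
Proof. exact: sigma_algebraC. Qed.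

Let rV_bigcup (F : _^nat) : (forall i, g_sigma_preimage coors (F i)) ->
  g_sigma_preimage coors (\bigcup_i (F i)).
Proof. exact: sigma_algebra_bigcup. Qed.

HB.instance Definition _ := @isMeasurable.Build default_measure_display
  'rV[R]_n (g_sigma_preimage coors) rV_set0 rV_setC rV_bigcup.

End measurable_rV.

Lemma measurable_coord (R : realType) n (i : 'I_n) :
  measurable_fun [set: 'rV[R]_n] (fun x : 'rV[R]_n => x 0 i).
Proof.
move=> _ Y mY; rewrite setTI; apply: sub_sigma_algebra => /=.
rewrite -bigcup_seq/=; exists i => /=; first by rewrite mem_index_enum.
by exists Y => //; rewrite setTI.
Qed.

Lemma measurable_fun_rV d (T : measurableType d) (R : realType) n
    (f : T -> 'rV[R]_n) :
  (forall i, measurable_fun [set: T] (fun x => f x 0 i)) ->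
  measurable_fun [set: T] f.
Proof.
move=> mf.
suff H : g_sigma_preimage (fun (i : 'I_n) (x : 'rV[R]_n) => x 0 i) `<=`
    [set A | measurable (f @^-1` A)].
  by move=> _ A mA; rewrite setTI; exact: H.
apply: smallest_sub.
  split => /=; first by rewrite preimage_set0.
  - by move=> A mA; rewrite setTD preimage_setC; exact: measurableC.
  - by move=> F mF; rewrite preimage_bigcup; exact: bigcup_measurable.
rewrite -bigcup_seq/= => A [i _ [B mB <-]]/=.
rewrite setTI -comp_preimage -[X in measurable X]setTI.
exact: mf.
Qed.

Definition rV_cons (R : realType) n (p : 'rV[R]_n * R) : 'rV[R]_n.+1 :=
  row_mx p.2%:M p.1 : 'rV[R]_(1 + n).

Fixpoint lebesgue_rV (R : realType) n : set 'rV[R]_n -> \bar R :=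
  match n with
  | 0 => \d_(0 : 'rV[R]_0)
  | m.+1 => pushforward (@lebesgue_rV R m \x @lebesgue_measure R)%E (@rV_cons R m)
  end.
Arguments lebesgue_rV {R n}.

Lemma rV_cons0 (R : realType) n (p : 'rV[R]_n * R) : rV_cons p 0 ord0 = p.2.
Proof.
transitivity (@row_mx R 1 1 n p.2%:M p.1 0 (lshift n ord0)).
  by apply: (congr1 (@row_mx R 1 1 n p.2%:M p.1 0)); exact/val_inj.
by rewrite row_mxEl mxE eqxx.
Qed.

Lemma rV_consS (R : realType) n (p : 'rV[R]_n * R) (i : 'I_n) :
  rV_cons p 0 (lift ord0 i) = p.1 0 i.
Proof.
transitivity (@row_mx R 1 1 n p.2%:M p.1 0 (rshift 1 i)).
  by apply: (congr1 (@row_mx R 1 1 n p.2%:M p.1 0)); exact/val_inj.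
by rewrite row_mxEr.
Qed.

Lemma measurable_rV_cons (R : realType) n : measurable_fun setT (@rV_cons R n).
Proof.
apply: measurable_fun_rV => i; have [j ->|->] := unliftP ord0 i.
  under eq_fun do rewrite rV_consS.
  apply: (@measurableT_comp _ _ _ _ _ _ (fun x : 'rV[R]_n => x 0 j)) => //.
  exact: measurable_coord.
by under eq_fun do rewrite rV_cons0; exact: measurable_snd.
Qed.

Lemma lebesgue_rV_measure (R : realType) n :
  exists mu : {measure set 'rV[R]_n -> \bar R}, lebesgue_rV = mu.
Proof.
elim: n => [|n [mu IH]] /=; first by exists (\d_(0 : 'rV[R]_0)).
rewrite IH.
pose nu := product_measure1 mu (@lebesgue_measure R) : {measure set _ -> \bar R}.
by exists (measure_function_pushforward__canonical__measure_function_Measure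
  nu (@measurable_rV_cons R n)).
Qed.

Section lebesgue_rV_instance.
Context (R : realType) (n : nat).
Let mu := @lebesgue_rV R n.

Let lebesgue0 : mu set0 = 0%E.
Proof. by rewrite /mu; have [nu ->] := lebesgue_rV_measure R n. Qed.

Let lebesgue_ge0 A : (0 <= mu A)%E.
Proof. by rewrite /mu; have [nu ->] := lebesgue_rV_measure R n. Qed.

Let lebesgue_sigma_additive : semi_sigma_additive mu.
Proof.
rewrite /mu; have [nu ->] := lebesgue_rV_measure R n.
exact: measure_semi_sigma_additive.
Qed.

HB.instance Definition _ := isMeasure.Build _ _ _ (@lebesgue_rV R n)
  lebesgue0 lebesgue_ge0 lebesgue_sigma_additive.

End lebesgue_rV_instance.

Lemma lebesgue_rV_box (R : realType) n (a b : 'rV[R]_n) :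
  (forall i, a 0 i <= b 0 i) ->
  lebesgue_rV [set x : 'rV[R]_n | forall i, a 0 i <= x 0 i <= b 0 i] =
  (\prod_(i < n) (b 0 i - a 0 i))%:E.
Proof.
elim: n a b => [|n IH] a b ab.
  rewrite big_ord0 /= diracE (_ : _ \in _) // inE /= => i; by case: i.
pose a' : 'rV[R]_n := \row_i a 0 (lift ord0 i).
pose b' : 'rV[R]_n := \row_i b 0 (lift ord0 i).
rewrite /= /pushforward (_ : _ @^-1` _ =
  [set x : 'rV[R]_n | forall i, a' 0 i <= x 0 i <= b' 0 i] `*`
  `[a 0 ord0, b 0 ord0]); last first.
  apply/seteqP; split => [p /= h|p /= [h1 h2] i].
    split; last by have := h ord0; rewrite rV_cons0 /= in_itv.
    by move=> i; have := h (lift ord0 i); rewrite rV_consS !mxE.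
  have [j ->|->] := unliftP ord0 i.
    by have := h1 j; rewrite rV_consS !mxE.
  by rewrite rV_cons0; move: h2; rewrite in_itv.
rewrite product_measure1E //; last first.
  rewrite (_ : [set _ | _] = \bigcap_(i in [set: 'I_n])
    ((fun x : 'rV[R]_n => x 0 i) @^-1` `[a' 0 i, b' 0 i])); last first.
    apply/seteqP; split => [x /= h i _ /=|x /= h i].
      by rewrite in_itv /=; exact: h.
    by have := h i Logic.I; rewrite /= in_itv.
  apply: fin_bigcap_measurable => // i _.
  rewrite -[X in measurable X]setTI; exact: measurable_coord.
rewrite [X in (X * _)%E]IH; last by move=> i; rewrite !mxE.
rewrite [X in (_ * X)%E]lebesgue_measure_itv /= lte_fin.
rewrite big_ord_recl mulrC EFinM; congr (_ * _)%E.
  by congr (_%:E); apply: eq_bigr => i _; rewrite !mxE.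
case: ltP => [_|ba]; first by [].
by rewrite (_ : b 0 ord0 = a 0 ord0) ?subrr //; apply/le_anti; rewrite ba ab.
Qed.

(* The library norm of ['rV[R]_n] is the sup norm; its topology is the usual
   one, but lengths are measured with [enorm]. *)
Definition enorm (R : realType) n (x : 'rV[R]_n) : R :=
  Num.sqrt (\sum_(i < n) x 0 i ^+ 2).

Definition unit_ball (R : realType) n : set 'rV[R]_n := [set x | enorm x < 1].
Definition unit_sphere (R : realType) n : set 'rV[R]_n := [set x | enorm x = 1].
Arguments unit_ball {R n}.
Arguments unit_sphere {R n}.

Definition radial (R : realType) n (x : 'rV[R]_n) : 'rV[R]_n :=
  (enorm x)^-1 *: x.

(* The surface measure of the sphere in polar coordinates: the area of A is n
   times the volume of the cone { t y | y in A, 0 < t < 1 }. *)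
Definition sphere_measure (R : realType) n (A : set 'rV[R]_n) : \bar R :=
  (n%:R%:E * lebesgue_rV ((@radial R n @^-1` A) `&` unit_ball))%E.
Arguments sphere_measure {R n}.

Lemma measurable_enorm (R : realType) n : measurable_fun setT (@enorm R n).
Proof.
apply: (measurableT_comp (continuous_measurable_fun (@sqrt_continuous R))).
by apply: measurable_sum => i; apply: measurable_funX; exact: measurable_coord.
Qed.

Lemma measurable_unit_ball (R : realType) n : measurable (@unit_ball R n).
Proof.
rewrite (_ : unit_ball = (@enorm R n) @^-1` `]-oo, 1[%classic); last first.
  by apply/seteqP; split => x; rewrite /unit_ball /= in_itv.
rewrite -[X in measurable X]setTI; exact: measurable_enorm.
Qed.

Lemma measurable_radial (R : realType) n : measurable_fun setT (@radial R n).
Proof.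
apply: measurable_fun_rV => i; under eq_fun do rewrite mxE.
apply: measurable_funM; last exact: measurable_coord.
rewrite (_ : (fun x => _) = (@powR R ^~ (-1)) \o (@enorm R n)); last first.
  by apply/funext => x /=; rewrite powR_inv1 ?sqrtr_ge0.
by apply: measurableT_comp; [exact: measurable_powR|exact: measurable_enorm].
Qed.

Section sphere_measure_instance.
Context (R : realType) (n : nat).
Let sigma := @sphere_measure R n.

Let sphere_measure_measure :
  exists mu : {measure set 'rV[R]_n -> \bar R}, sigma = mu.
Proof.
pose mu := mrestr lebesgue_rV (@measurable_unit_ball R n) : {measure set _ -> \bar R}.
pose nu := measure_function_pushforward__canonical__measure_function_Measure
  mu (@measurable_radial R n).
by exists (mscale (NngNum (ler0n R n)) nu).
Qed.

Let sphere0 : sigma set0 = 0%E.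
Proof. by have [nu ->] := sphere_measure_measure. Qed.

Let sphere_ge0 A : (0 <= sigma A)%E.
Proof. by have [nu ->] := sphere_measure_measure. Qed.

Let sphere_sigma_additive : semi_sigma_additive sigma.
Proof.
have [nu ->] := sphere_measure_measure; exact: measure_semi_sigma_additive.
Qed.

HB.instance Definition _ := isMeasure.Build _ _ _ (@sphere_measure R n)
  sphere0 sphere_ge0 sphere_sigma_additive.

End sphere_measure_instance.

Definition partial (R : realType) n (j : 'I_n) (f : 'rV[R]_n -> R) :
  'rV[R]_n -> R := fun x => 'D_(delta_mx 0 j) f x.

Fixpoint Ck (R : realType) n (k : nat) (f : 'rV[R]_n -> R) : Prop :=
  match k with
  | 0 => continuous f
  | m.+1 => continuous f /\
      forall j, (forall x, derivable f x (delta_mx 0 j)) /\ Ck m (partial j f)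
  end.

Definition smooth (R : realType) n (f : 'rV[R]_n -> R) : Prop :=
  forall k, Ck k f.

Definition test_function (R : realType) n (phi : 'rV[R]_n -> R) : Prop :=
  [/\ smooth phi, compact (closure [set x | phi x != 0])
    & closure [set x | phi x != 0] `<=` unit_ball].

Definition locally_integrable_ball (R : realType) n (f : 'rV[R]_n -> R) : Prop :=
  measurable_fun unit_ball f /\
  forall K, K `<=` unit_ball -> compact K ->
    (\int[lebesgue_rV]_(x in K) `|f x|%:E < +oo)%E.

Definition is_weak_partial (R : realType) n (j : 'I_n) (f g : 'rV[R]_n -> R) :
    Prop :=
  [/\ locally_integrable_ball f, locally_integrable_ball g
    & forall phi, test_function phi ->
      \int[lebesgue_rV]_(x in unit_ball) (f x * partial j phi x) =
      - \int[lebesgue_rV]_(x in unit_ball) (g x * phi x)].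

(* A representative of the weak derivative, which is unique almost everywhere
   in the ball; 0 if there is no weak derivative. *)
Definition weak_partial (R : realType) n (j : 'I_n) (f : 'rV[R]_n -> R) :
    'rV[R]_n -> R :=
  xget (fun=> 0) [set g | is_weak_partial j f g].

Definition Lp_ball (R : realType) n (p : nat) (f : 'rV[R]_n -> R) : Prop :=
  measurable_fun unit_ball f /\
  (\int[lebesgue_rV]_(x in unit_ball) (`|f x| ^+ p)%:E < +oo)%E.

Definition sobolev (R : realType) n (p : nat) (f : 'rV[R]_n -> R) : Prop :=
  Lp_ball p f /\
  forall j, exists g, is_weak_partial j f g /\ Lp_ball p g.

Definition Lp_cvg (R : realType) n (mu : set 'rV[R]_n -> \bar R)
    (D : set 'rV[R]_n) (p : nat) (f_ : nat -> 'rV[R]_n -> R)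
    (f : 'rV[R]_n -> R) : Prop :=
  (fun k => \int[mu]_(x in D) (`|f_ k x - f x| ^+ p)%:E)%E @ \oo --> 0%E.

(* The trace operator is the continuous extension, from W^{1,p} of the ball to
   L^p of the sphere, of the restriction of functions smooth up to the
   boundary. *)
Definition has_trace (R : realType) n (p : nat) (f g : 'rV[R]_n -> R) : Prop :=
  exists f_ : nat -> 'rV[R]_n -> R,
    [/\ forall k, smooth (f_ k),
        Lp_cvg lebesgue_rV unit_ball p f_ f,
        forall j, Lp_cvg lebesgue_rV unit_ball p
          (fun k => partial j (f_ k)) (weak_partial j f)
      & Lp_cvg sphere_measure unit_sphere p f_ g].

Definition component (R : realType) n (u : 'rV[R]_n -> 'rV[R]_n) (i : 'I_n) :
  'rV[R]_n -> R := fun x => u x 0 i.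

Definition sobolev_sphere (R : realType) n (p : nat)
    (u : 'rV[R]_n -> 'rV[R]_n) : Prop :=
  (forall i, sobolev p (component u i)) /\
  {ae lebesgue_rV, forall x, unit_ball x -> enorm (u x) = 1}.

Definition admissible (R : realType) n (p : nat)
    (u : 'rV[R]_n -> 'rV[R]_n) : Prop :=
  sobolev_sphere p u /\ forall i, has_trace p (component u i) (component id i).

Definition gradient_norm (R : realType) n (u : 'rV[R]_n -> 'rV[R]_n)
    (x : 'rV[R]_n) : R :=
  Num.sqrt (\sum_(i < n) \sum_(j < n) weak_partial j (component u i) x ^+ 2).

Definition energy (R : realType) n (p : nat) (alpha : R)
    (u : 'rV[R]_n -> 'rV[R]_n) : \bar R :=
  (\int[lebesgue_rV]_(x in unit_ball)
     (enorm x `^ alpha * gradient_norm u x ^+ p)%:E)%E.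

(* Main.v *)
Require Import Defs.
From HB Require Import structures.
From mathcomp Require Import all_boot all_order all_algebra.
From mathcomp Require Import all_classical all_reals all_analysis.
From mathcomp Require Import measurable_realfun fingroup perm ring lra.

Set Implicit Arguments.
Unset Strict Implicit.
Unset Printing Implicit Defensive.

Import Order.TTheory GRing.Theory Num.Theory.
Import numFieldNormedType.Exports.

Local Open Scope classical_set_scope.
Local Open Scope ring_scope.

(* Let A be the weak Jacobian matrix of an admissible u.  As |u| = 1, one has
   u A = 0.  In an orthonormal basis whose first vector is u, Hadamard's
   inequality for the principal minors and the arithmetic-geometric mean
   inequality bound the sum of the principal p-minors of A by the value it takes
   on the multiple g (1 - u^T u) of a projection having the same Frobenius norm
   as A; for u = x / |x| this is an equality, with g = 1 / |x|.  For
   phi = (|x|^2 + delta)^(alpha/2), adding to phi times this sum of minors the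
   term obtained by replacing one copy of A by u^T (grad phi) produces a null
   Lagrangian: its integral depends on the boundary values of u only, hence is
   the same for u and for x / |x|.  Young's inequality turns this identity, after
   delta -> 0, into an inequality between the integrals of |x|^alpha g^p, with a
   nonnegative remainder if alpha > 0.  When the energies agree the remainder
   vanishes, which gives u . x = |x| at once if p = 1, and g = 1 / |x| otherwise;
   in the latter case the null Lagrangian for p = 1 and phi = |x|^2 yields
   u . x = |x|.

   Null Lagrangians are first integrated for C^2 maps equal to the identity near
   the sphere.  A map with trace x is a W^{1,p} limit of such maps because cutting
   off u - x in a layer of width e costs e^-p times the integral of |u - x|^p
   over the layer, which a Hardy inequality controls. *)

(** * Sums of mixed minors *)

(** No smooth sphere-valued map on the closed ball has boundary values x, so smooth approximations
    cannot respect |u| = 1. The null Lagrangian is therefore an identity for maps into R^n,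
    continuous under W^{1,p} convergence, and the constraint enters only in the limit, through
    pointwise bounds on the minors. The weight is regularized because |x|^alpha need not be C^1 at
    0; the gradient of phi is then a multiple of x, which ties the second term of the Lagrangian to
    u . x. That term has degree p - 1 in g while the energy has degree p: Young's inequality trades
    g^(p-1) / |x| for g^p and 1 / |x|^p, with equality at g = 1 / |x|. The remainder carries the
    factor alpha, so it says nothing for alpha = 0; its weight is at least |x|^alpha / 2 whatever
    delta is, so it survives the limit. The map x / |x| is treated like any competitor: it is shown
    to be admissible, which needs the integrability of |x|^-p and hence p < n, and the same limit
    argument applies to it. *)

(* When all [M a] equal [A], this is [q`!] times the sum of the principal
   q x q minors of [A]. *)
Definition mdisc (R : comNzRingType) n q (M : 'I_q -> 'M[R]_n) : R :=
  \sum_(f : {ffun 'I_q -> 'I_n}) \det (\matrix_(a, b) M a (f a) (f b)).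

(** For a fixed permutation the sum over index maps is a product of traces, one per cycle, so this
    is the cyclicity of the trace. The inner indices [g] of the matrix products are made explicit
    and the outer ones are shifted along [s]. *)
Lemma sum_perm_mulC (R : comNzRingType) n q (s : 'S_q) (Q : 'M[R]_n)
    (M : 'I_q -> 'M[R]_n) :
  \sum_(f : {ffun 'I_q -> 'I_n}) \prod_a (Q *m M a) (f a) (f (s a)) =
  \sum_(f : {ffun 'I_q -> 'I_n}) \prod_a (M a *m Q) (f a) (f (s a)).
Proof.
pose F (f g : {ffun 'I_q -> 'I_n}) : R :=
  \prod_a (Q (f a) (g a) * M a (g a) (f (s a))).
transitivity (\sum_f \sum_g F f g).
  apply: eq_bigr => f _.
  under eq_bigr do rewrite mxE.
  by rewrite bigA_distr_bigA.
rewrite exchange_big /=; apply: eq_bigr => g _.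
under [RHS]eq_bigr do rewrite mxE.
rewrite bigA_distr_bigA /=.
pose h (f : {ffun 'I_q -> 'I_n}) : {ffun 'I_q -> 'I_n} := [ffun a => f (s a)].
pose h' (f : {ffun 'I_q -> 'I_n}) : {ffun 'I_q -> 'I_n} :=
  [ffun a => f ((s^-1)%g a)].
rewrite (reindex h') /=; last first.
  exists h => f _; apply/ffunP => a; rewrite !ffunE.
    by rewrite permK.
  by rewrite permKV.
apply: eq_bigr => f _; rewrite /F big_split /= [RHS]big_split /= mulrC.
congr (_ * _).
  by apply: eq_bigr => a _; rewrite ffunE permK.
rewrite (reindex_inj (@perm_inj _ s)) /=.
by apply: eq_bigr => a _; rewrite ffunE permK.
Qed.

Lemma mdiscE (R : comNzRingType) n q (M : 'I_q -> 'M[R]_n) :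
  mdisc M = \sum_(s : 'S_q) (-1) ^+ s *
    \sum_(f : {ffun 'I_q -> 'I_n}) \prod_a M a (f a) (f (s a)).
Proof.
rewrite /mdisc exchange_big /=; apply: eq_bigr => s _ //.
by rewrite mulr_sumr; apply: eq_bigr => f _; congr (_ * _); apply: eq_bigr => a _;
  rewrite mxE.
Qed.

Lemma mdisc_conj (R : comNzRingType) n q (Q : 'M[R]_n) (M : 'I_q -> 'M[R]_n) :
  Q^T *m Q = 1%:M -> mdisc (fun a => Q *m M a *m Q^T) = mdisc M.
Proof.
move=> QQ; rewrite !mdiscE; apply: eq_bigr => s _; congr (_ * _).
under eq_bigr do under eq_bigr do rewrite -mulmxA.
rewrite (sum_perm_mulC s Q (fun a => M a *m Q^T)).
by under eq_bigr do under eq_bigr do rewrite -mulmxA QQ mulmx1.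
Qed.

(** * Reflections and Hadamard's inequality *)

Section euclid.
Context {R : realType}.

Lemma enorm_ge0 n (x : 'rV[R]_n) : 0 <= enorm x.
Proof. exact: sqrtr_ge0. Qed.

Lemma enorm_sqr n (x : 'rV[R]_n) : enorm x ^+ 2 = \sum_i x 0 i ^+ 2.
Proof. by rewrite sqr_sqrtr // sumr_ge0 // => i _; exact: sqr_ge0. Qed.

Lemma enorm_sqrmx n (x : 'rV[R]_n) : (x *m x^T) 0 0 = enorm x ^+ 2.
Proof. by rewrite enorm_sqr mxE; apply: eq_bigr => i _; rewrite !mxE expr2. Qed.

Lemma enorm_orth n (x : 'rV[R]_n) (Q : 'M[R]_n) :
  Q *m Q^T = 1%:M -> enorm (x *m Q) = enorm x.
Proof.
move=> QQ; apply/eqP; rewrite -(@eqrXn2 _ 2) ?enorm_ge0 //.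
by rewrite -!enorm_sqrmx trmx_mul mulmxA -(mulmxA x) QQ mulmx1.
Qed.

(** Unless v already points along the first axis, Q is the reflection along z = v - |v| e_0. It maps
    v to |v| e_0 because the two vectors have the same length, which amounts to 2 v . z = |z|^2. *)
Lemma householder n (v : 'rV[R]_n.+1) : exists Q : 'M[R]_n.+1,
  [/\ Q *m Q^T = 1%:M, Q^T *m Q = 1%:M & v *m Q = enorm v *: delta_mx 0 0].
Proof.
have [vE|vE] := eqVneq v (enorm v *: delta_mx 0 0).
  by exists 1%:M; rewrite trmx1 !mulmx1.
pose z := v - enorm v *: delta_mx 0 0.
have z0 : z != 0 by rewrite subr_eq0.
pose e := enorm z ^+ 2.
have e0 : e != 0.
  rewrite /e enorm_sqr; apply: contra z0 => /eqP h.
  apply/eqP/rowP => i; rewrite [RHS]mxE; apply/eqP; rewrite -sqrf_eq0; apply/eqP.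
  by apply: (psumr_eq0P _ h) => // j _; exact: sqr_ge0.
have zz : z *m z^T = e%:M by rewrite [LHS]mx11_scalar enorm_sqrmx.
pose Q := 1%:M - (2 / e) *: (z^T *m z).
have QT : Q^T = Q.
  by rewrite /Q linearB /= linearZ /= trmx_mul trmxK trmx1.
have QQ : Q *m Q = 1%:M.
  have SS : z^T *m z *m (z^T *m z) = e *: (z^T *m z).
    by rewrite mulmxA -(mulmxA _ z) zz mul_mx_scalar -scalemxAl.
  rewrite /Q; set S := z^T *m z; rewrite -/S in SS *.
  rewrite mulmxBl mul1mx mulmxBr mulmx1 -scalemxAl -scalemxAr SS !scalerA.
  rewrite -addrA -opprD -scalerBl -scalerDl.
  by rewrite [X in X *: _](_ : _ = 0) ?scale0r ?subr0 //; field.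
exists Q; rewrite QT; split => //.
have vz : 2 * (v *m z^T) 0 0 = e.
  have ez i : z 0 i = v 0 i - enorm v * (i == 0)%:R by rewrite !mxE.
  rewrite /e enorm_sqr mxE !big_ord_recl /=.
  under eq_bigr do rewrite mxE ez /= mulr0 subr0.
  under [in RHS]eq_bigr do rewrite ez /= mulr0 subr0 expr2.
  rewrite mxE ez /= mulr1.
  have := enorm_sqr v; rewrite big_ord_recl /=.
  under eq_bigr do rewrite expr2.
  set S := \sum_(_ < _) _ => h.
  have -> : S = enorm v ^+ 2 - v 0 0 ^+ 2 by rewrite h addrC addKr.
  by ring.
rewrite /Q mulmxBr mulmx1 -scalemxAr mulmxA [v *m z^T]mx11_scalar mul_scalar_mx.
rewrite scalerA -mulrAC vz divff // scale1r /z.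
by rewrite opprB addrC subrK.
Qed.

(** After a reflection of the row space the first row is a multiple of e_0, and the determinant
    reduces to one cofactor. The other rows keep their length and only lose a coordinate in the
    cofactor. *)
Lemma hadamard n (M : 'M[R]_n) : `|\det M| <= \prod_i enorm (row i M).
Proof.
elim: n M => [|n IH] M; first by rewrite det_mx00 normr1 big_ord0.
have [Q [QQ QQ' h]] := householder (row ord0 M).
have dQ : `|\det Q| = 1.
  apply/eqP; rewrite -(@eqrXn2 _ 2) ?normr_ge0 // real_normK ?num_real //.
  by rewrite expr1n expr2 -{2}det_tr -det_mulmx QQ det1.
have -> : `|\det M| = `|\det (M *m Q)| by rewrite det_mulmx normrM dQ mulr1.
have hr i : enorm (row i M) = enorm (row i (M *m Q)).
  by rewrite row_mul enorm_orth.
have h0 j : (M *m Q) ord0 j = enorm (row ord0 M) * (j == ord0)%:R.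
  have := congr1 (fun A : 'rV[R]_n.+1 => A 0 j) h.
  by rewrite -row_mul !mxE eqxx.
rewrite (expand_det_row _ ord0) big_ord_recl big1 ?addr0; last first.
  by move=> j _; rewrite h0 /= mulr0 mul0r.
rewrite h0 eqxx mulr1 normrM ger0_norm ?enorm_ge0 // [leRHS]big_ord_recl.
rewrite ler_wpM2l ?enorm_ge0 // /cofactor normrM normrX normrN1 expr1n mul1r.
apply: (le_trans (IH _)); apply: ler_prod => i _.
rewrite enorm_ge0 /= hr ler_sqrt; last first.
  by apply: sumr_ge0 => j _; exact: sqr_ge0.
rewrite [leRHS]big_ord_recl; apply: ler_wpDl; first exact: sqr_ge0.
by apply: ler_sum => j _; rewrite !mxE.
Qed.

End euclid.

(** * Elementary symmetric sums *)

Section symmetric_sums.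
Context {R : realType}.
Implicit Types (x t a c : R).

(** The graph of t^(k+1) lies above its tangent line at a. Multiplying the bound by t leaves a
    nonnegative multiple of (t - a)^2. *)
Lemma bernoulli a t k : 0 <= a -> 0 <= t ->
  a ^+ k.+1 + k.+1%:R * a ^+ k * (t - a) <= t ^+ k.+1.
Proof.
move=> a0 t0; elim: k => [|k IH]; first by rewrite !expr1 expr0 !mul1r; lra.
rewrite [leRHS]exprS; apply: le_trans (ler_wpM2l t0 IH).
rewrite -subr_ge0 (_ : _ - _ = k.+1%:R * a ^+ k * (t - a) ^+ 2); last first.
  by rewrite !exprS -(natr1 k.+1); ring.
by apply: mulr_ge0; [apply: mulr_ge0; [exact: ler0n|exact: exprn_ge0]|exact: sqr_ge0].
Qed.

(** Maclaurin's inequality: an elementary symmetric function is largest when all entries equal their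
    mean. A new entry x moves the mean from a to t, where (m + 1) (t - a) = x - a, and the tangent
    line at a absorbs the new term. *)
Lemma coef_prod_le (s : seq R) q : all (>= 0) s ->
  (\prod_(x <- s) (1 + x *: 'X))`_q <=
  'C(size s, q)%:R * ((\sum_(x <- s) x) / (size s)%:R) ^+ q.
Proof.
elim: s q => [|x s IH] q /=.
  move=> _; rewrite !big_nil coef1 mul0r expr0n.
  by case: q => [|q]; rewrite ?bin0 ?mulr1 ?mulr0.
move=> /andP[x0 s0]; rewrite !big_cons mulrDl mul1r coefD -scalerAl coefZ.
rewrite coefXM.
set S := \sum_(_ <- _) _.
have S0 : 0 <= S.
  by rewrite /S big_seq; apply: sumr_ge0 => y ys; move/allP : s0 => /(_ y ys).
case: q => [|q].
  rewrite /= mulr0 addr0 bin0 expr0 mulr1.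
  by apply: le_trans (IH 0%N s0) _; rewrite bin0 expr0 mulr1.
rewrite /=; set m := size s.
pose a := S / m%:R; pose t := (x + S) / m.+1%:R.
(* This also covers an empty [s], where the convention S / 0 = 0 gives a = 0. *)
have aE : S = m%:R * a.
  rewrite /a mulrC; case: (posnP m) => [|m0].
    by move/size0nil; rewrite /S => ->; rewrite big_nil !mul0r.
  by rewrite divfK // pnatr_eq0 -lt0n.
have m1 : m.+1%:R != 0 :> R by rewrite pnatr_eq0.
have tE : m.+1%:R * (t - a) = x - a.
  by rewrite mulrBr /t mulrCA divff // mulr1 aE -natr1; ring.
have a0 : 0 <= a by rewrite divr_ge0.
have t0 : 0 <= t by rewrite divr_ge0 // addr_ge0.
apply: (@le_trans _ _ ('C(m, q.+1)%:R * a ^+ q.+1 + x * ('C(m, q)%:R * a ^+ q))).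
  by apply: lerD; [exact: IH|rewrite ler_wpM2l // IH].
apply: le_trans (ler_wpM2l _ (bernoulli q a0 t0)) => //.
rewrite mulrDr !mulrA -natrM [('C(_, _) * _)%N]mulnC -mul_bin_diag /=.
rewrite natrM mulrAC -!mulrA [m.+1%:R * _]mulrCA.
rewrite [m.+1%:R * (_ * (t - a))]mulrCA tE binS natrD exprS.
by rewrite le_eqVlt; apply/orP; left; apply/eqP; ring.
Qed.

Lemma coef_prod_le_card q n (rho : 'I_n -> R) : (forall i, 0 <= rho i) ->
  (\prod_i (1 + rho i *: 'X))`_q <=
  'C(n, q)%:R * ((\sum_i rho i) / n%:R) ^+ q.
Proof.
move=> r0; have := @coef_prod_le (map rho (enum 'I_n)) q.
rewrite size_map size_enum_ord (big_map rho predT (fun x => 1 + x *: ('X : {poly R})))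
  (big_map rho predT id) !big_enum; apply.
by apply/allP => x /mapP[i _ ->].
Qed.

(** The coefficient is the q-th elementary symmetric function of rho, and every set of q indices is
    the image of exactly q! injections. *)
Lemma sum_inj_coef q n (rho : 'I_n -> R) :
  \sum_(f : {ffun 'I_q -> 'I_n} | injectiveb f) \prod_a rho (f a) =
  q`!%:R * (\prod_i (1 + rho i *: 'X))`_q.
Proof.
transitivity (\sum_(S : {set 'I_n} | #|S| == q) q`!%:R * \prod_(i in S) rho i).
  rewrite (partition_big (fun f : {ffun 'I_q -> 'I_n} => [set f a | a in 'I_q]%SET)
    (fun S : {set 'I_n} => #|S| == q)) /=; last first.
    by move=> f /injectiveP fi; rewrite card_imset // card_ord.
  apply: eq_bigr => S /eqP Sq.
  rewrite (eq_bigr (fun=> \prod_(i in S) rho i)); last first.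
    by move=> f /andP[/injectiveP fi /eqP <-]; rewrite big_imset //= => a b _ _ /fi.
  pose A := [pred f : {ffun 'I_q -> 'I_n} |
    injectiveb f && ([set f a | a in 'I_q]%SET == S)].
  transitivity (\sum_(f in A) \prod_(i in S) rho i); first exact: eq_bigl.
  rewrite sumr_const -[LHS]mulr_natl; congr (_%:R * _).
  have := card_inj_ffuns_on 'I_q (mem S).
  rewrite card_ord Sq ffactnn => <-; apply: eq_card => f; rewrite !inE.
  apply/andP/andP => [[fi /eqP fS]|[/ffun_onP fS fi]]; split => //.
    apply/ffun_onP => a; rewrite -fS; exact: imset_f.
  rewrite eqEcard; apply/andP; split.
    by apply/fintype.subsetP => i /imsetP[a _ ->]; exact: fS.
  by rewrite card_imset ?card_ord ?Sq //; exact/injectiveP.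
rewrite -mulr_sumr; congr (_ * _).
under [in RHS]eq_bigr do rewrite addrC.
rewrite bigA_distr coef_sum [RHS](bigID (fun S : {set 'I_n} => #|S| == q)) /=.
rewrite [X in _ = _ + X]big1 ?addr0.
  apply: eq_bigr => S /eqP Sq.
  rewrite -big_mkcond /= scaler_prod prodr_const coefZ Sq coefXn eqxx.
  by rewrite mulr1.
move=> S Sq; rewrite -big_mkcond /= scaler_prod prodr_const coefZ coefXn.
by rewrite eq_sym (negbTE Sq) mulr0.
Qed.

(** Otherwise the sum of the squares (m rho_i - s)^2, which equals m ((c m)^2 - s^2), would be
    negative. *)
Lemma mean_le_rms m (rho : 'I_m -> R) c : (0 < m)%N -> 0 <= c ->
  \sum_i rho i ^+ 2 = m%:R * c ^+ 2 -> (\sum_i rho i) / m%:R <= c.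
Proof.
move=> m0 c0 h; set s := \sum_i _.
have mR : 0 < m%:R :> R by rewrite ltr0n.
rewrite ler_pdivrMr // leNgt; apply/negP => sc.
have : 0 <= \sum_i (m%:R * rho i - s) ^+ 2 by apply: sumr_ge0 => i _; exact: sqr_ge0.
rewrite (eq_bigr (fun i => m%:R ^+ 2 * rho i ^+ 2 + (- (2 * m%:R * s)) * rho i
  + s ^+ 2)); last by move=> i _; ring.
rewrite !big_split /= sumr_const card_ord -[s ^+ 2 *+ m]mulr_natl.
rewrite -!mulr_sumr h -/s.
apply/negP; rewrite -ltNge.
have {sc} sc : (c * m%:R) ^+ 2 < s ^+ 2.
  by rewrite ltr_pXn2r // nnegrE ?mulr_ge0 ?(ltW mR) // (le_trans _ (ltW sc)) // mulr_ge0 // ltW.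
rewrite (_ : _ + _ = m%:R * ((c * m%:R) ^+ 2 - s ^+ 2)); last by ring.
by rewrite pmulr_rlt0 // subr_lt0.
Qed.

End symmetric_sums.

(** * Sharp bounds for sums of mixed minors *)

Section mdisc_bounds.
Context {R : realType}.

Lemma det_eq_col q (B : 'M[R]_q) a b : a != b -> col a B = col b B -> \det B = 0.
Proof.
move=> ab ce; rewrite -det_tr; apply: (determinant_alternate ab) => i.
by have := congr1 (fun C : 'cV[R]_q => C i 0) ce; rewrite !mxE.
Qed.

(** A repeated index makes two columns equal; the corresponding rows may differ, as they come from
    different matrices. *)
Lemma mdisc_inj n q (M : 'I_q -> 'M[R]_n) :
  mdisc M = \sum_(f : {ffun 'I_q -> 'I_n} | injectiveb f)
    \det (\matrix_(a, b) M a (f a) (f b)).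
Proof.
rewrite /mdisc (bigID (fun f : {ffun 'I_q -> 'I_n} => injectiveb f)) /=.
rewrite [X in _ + X]big1 ?addr0 // => f /injectivePn[a [b ab fab]].
by apply: (det_eq_col ab); apply/colP => i; rewrite !mxE fab.
Qed.

(** Hadamard's inequality for every minor: since [f] is injective, row a of the minor is a part of
    row [f a] of [M a], hence no longer than it. *)
Lemma mdisc_le n q (M : 'I_q -> 'M[R]_n) :
  mdisc M <= \sum_(f : {ffun 'I_q -> 'I_n} | injectiveb f)
    \prod_a enorm (row (f a) (M a)).
Proof.
rewrite mdisc_inj; apply: ler_sum => f /injectiveP fi.
apply: le_trans (ler_norm _) _; apply: le_trans (hadamard _) _.
apply: ler_prod => a _; rewrite enorm_ge0 /= ler_sqrt; last first.
  by apply: sumr_ge0 => j _; exact: sqr_ge0.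
under eq_bigr do rewrite !mxE.
under [leRHS]eq_bigr do rewrite mxE.
rewrite -(big_imset (fun j => M a (f a) j ^+ 2)) /=; last by move=> b c _ _ /fi.
rewrite [leRHS](bigID (mem [set f a | a in 'I_q]%SET)) /= lerDl.
by apply: sumr_ge0 => j _; exact: sqr_ge0.
Qed.

Lemma mdisc_diag n q (M : 'I_q -> 'M[R]_n) (d : 'I_q -> 'I_n -> R) :
  (forall a i j, M a i j = d a i * (i == j)%:R) ->
  mdisc M = \sum_(f : {ffun 'I_q -> 'I_n} | injectiveb f) \prod_a d a (f a).
Proof.
move=> Md; rewrite mdisc_inj; apply: eq_bigr => f /injectiveP fi.
transitivity (\det (diag_mx (\row_a d a (f a)))).
  congr (\det _); apply/matrixP => a b; rewrite !mxE Md (inj_eq fi).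
  by case: eqVneq; rewrite ?mulr1 ?mulr0 ?mulr1n ?mulr0n.
by rewrite det_diag; apply: eq_bigr => a _; rewrite mxE.
Qed.

(** An injection with first value 0 is an injection of the other q points into the nonzero indices.
    On the right the injections that take the value 0 contribute nothing, because rho vanishes
    there. *)
Lemma sum_inj_recl q n (rho : 'I_n.+1 -> R) : rho 0 = 0 ->
  \sum_(f : {ffun 'I_q.+1 -> 'I_n.+1} | injectiveb f)
    ((f ord0 == 0)%:R * \prod_(a < q) rho (f (lift ord0 a))) =
  \sum_(f : {ffun 'I_q -> 'I_n.+1} | injectiveb f) \prod_a rho (f a).
Proof.
move=> rho0.
rewrite (bigID (fun f : {ffun 'I_q.+1 -> 'I_n.+1} => f ord0 == 0)) /=.
rewrite [X in _ + X]big1 ?addr0; last by move=> f /andP[_ /negbTE ->]; rewrite mul0r.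
pose h (f : {ffun 'I_q -> 'I_n.+1}) : {ffun 'I_q.+1 -> 'I_n.+1} :=
  [ffun a => if unlift ord0 a is Some b then f b else 0].
pose h' (f : {ffun 'I_q.+1 -> 'I_n.+1}) : {ffun 'I_q -> 'I_n.+1} :=
  [ffun b => f (lift ord0 b)].
have hl f b : h f (lift ord0 b) = f b by rewrite ffunE liftK.
have h0 f : h f ord0 = 0 by rewrite ffunE unlift_none.
have hK f : h' (h f) = f by apply/ffunP => b; rewrite ffunE hl.
rewrite (reindex_onto h h') /=; last first.
  move=> f /andP[_ /eqP f0]; apply/ffunP => a; rewrite ffunE.
  by case: unliftP => [b ->|->]; rewrite ?ffunE.
rewrite [RHS](bigID (fun f : {ffun 'I_q -> 'I_n.+1} => [forall a, f a != 0])) /=.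
rewrite [X in _ = _ + X]big1 ?addr0; last first.
  move=> f /andP[_]; rewrite negb_forall => /existsP[a]; rewrite negbK => /eqP fa.
  by rewrite (bigD1 a) //= fa rho0 mul0r.
apply: eq_big => [f|f _]; last first.
  by rewrite h0 eqxx mul1r; apply: eq_bigr => a _; rewrite hl.
rewrite h0 hK !eqxx !andbT; apply/injectiveP/andP => [hi|[/injectiveP fi /forallP f0]].
  split; first by apply/injectiveP => a b fab; apply: (@lift_inj _ ord0); apply: hi; rewrite !hl.
  apply/forallP => a; apply/eqP => fa.
  have : h f (lift ord0 a) = h f ord0 by rewrite hl h0.
  by move/hi/eqP; rewrite eq_sym (negbTE (neq_lift _ _)).
move=> a b; case: (unliftP ord0 a) => [a'|] ->; case: (unliftP ord0 b) => [b'|] -> //.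
- by rewrite !hl => /fi ->.
- by rewrite hl h0 => fa; have := f0 a'; rewrite fa eqxx.
- by rewrite hl h0 => fa; have := f0 b'; rewrite -fa eqxx.
Qed.

(** Up to the factor q! this is an elementary symmetric function of the m values other than rho_0.
    Maclaurin's inequality replaces them by their mean, which is at most c, and q! C(m, q) is the
    falling factorial. *)
Lemma sum_inj0_le q m (rho : 'I_m.+1 -> R) (c : R) : (0 < m)%N -> 0 <= c ->
    (forall i, 0 <= rho i) -> rho 0 = 0 ->
    \sum_i rho i ^+ 2 = m%:R * c ^+ 2 ->
  \sum_(f : {ffun 'I_q -> 'I_m.+1} | injectiveb f) \prod_a rho (f a) <=
  (m ^_ q)%:R * c ^+ q.
Proof.
move=> m0 c0 r0 r00 h; rewrite sum_inj_coef big_ord_recl r00 scale0r addr0 mul1r.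
rewrite -bin_ffact natrM [_%:R * q`!%:R]mulrC -mulrA ler_wpM2l ?ler0n //.
apply: le_trans (coef_prod_le_card _ _) _; first by move=> i; exact: r0.
rewrite ler_wpM2l ?ler0n //.
move: h; rewrite big_ord_recl r00 expr0n /= add0r => h.
rewrite lerXn2r ?nnegrE //; last exact: mean_le_rms.
by rewrite divr_ge0 ?ler0n // sumr_ge0.
Qed.

Lemma sum_inj0_const q m (c : R) :
  \sum_(f : {ffun 'I_q -> 'I_m.+1} | injectiveb f) \prod_a (c * (f a != 0)%:R) =
  (m ^_ q)%:R * c ^+ q.
Proof.
rewrite (sum_inj_coef q (fun i : 'I_m.+1 => c * (i != 0)%:R)).
rewrite big_ord_recl eqxx mulr0 scale0r addr0 mul1r.
under eq_bigr do rewrite /= mulr1.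
rewrite prodr_const card_ord exprDn coef_sum.
rewrite -bin_ffact natrM [_%:R * q`!%:R]mulrC -mulrA; congr (_ * _).
under eq_bigr do rewrite expr1n mul1r exprZn coefMn coefZ coefXn.
case: (leqP q m) => qm.
  rewrite (bigD1 (Ordinal (qm : (q < m.+1)%N))) //= eqxx mulr1 big1.
    by rewrite addr0 mulr_natl.
  by move=> i; rewrite -val_eqE /= eq_sym => /negbTE ->; rewrite mulr0 mul0rn.
rewrite bin_small // mul0r big1 // => i _.
by rewrite gtn_eqF ?mulr0 ?mul0rn // (leq_ltn_trans _ qm) // -ltnS.
Qed.

Lemma frobenius n (M : 'M[R]_n) :
  \sum_i enorm (row i M) ^+ 2 = \sum_i \sum_j M i j ^+ 2.
Proof. by apply: eq_bigr => i _; rewrite enorm_sqr; apply: eq_bigr => j _; rewrite mxE. Qed.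

Lemma frobenius_conj n (Q M : 'M[R]_n) : Q *m Q^T = 1%:M -> Q^T *m Q = 1%:M ->
  \sum_i \sum_j (Q^T *m M *m Q) i j ^+ 2 = \sum_i \sum_j M i j ^+ 2.
Proof.
move=> QQ QQ'; rewrite -!frobenius.
under eq_bigr do rewrite row_mul enorm_orth //.
rewrite !frobenius exchange_big /= [RHS]exchange_big /=.
have tr (A : 'M[R]_n) : \sum_j \sum_i A i j ^+ 2 = \sum_j enorm (row j A^T) ^+ 2.
  by rewrite frobenius; apply: eq_bigr => j _; apply: eq_bigr => i _; rewrite mxE.
rewrite !tr trmx_mul trmxK.
by apply: eq_bigr => j _; rewrite row_mul enorm_orth.
Qed.

Section upper.
Variables (m : nat) (u : 'rV[R]_m.+1) (A : 'M[R]_m.+1) (c : R).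
Hypotheses (m0 : (0 < m)%N) (u1 : enorm u = 1) (uA : u *m A = 0) (c0 : 0 <= c).
Hypothesis Ac : \sum_i \sum_j A i j ^+ 2 = m%:R * c ^+ 2.

(** In an orthonormal basis with first vector u, the first row of A becomes u A = 0. The bound by
    row lengths then involves m rows only, whose squared lengths add up to m c^2. *)
Lemma mdisc_ub q : mdisc (fun _ : 'I_q => A) <= (m ^_ q)%:R * c ^+ q.
Proof.
have [Q [QQ QQ' uQ]] := householder u; rewrite u1 scale1r in uQ.
rewrite -(mdisc_conj (Q := Q^T)) ?trmxK //.
apply: le_trans (mdisc_le _) _.
apply: (@sum_inj0_le q m (fun i => enorm (row i (Q^T *m A *m Q)))) => //.
- by move=> i; exact: enorm_ge0.
- rewrite rowE !mulmxA -uQ -(mulmxA u) QQ mulmx1 uA mul0mx /enorm.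
  by rewrite big1 ?sqrtr0 // => j _; rewrite mxE expr0n.
- by rewrite frobenius frobenius_conj.
Qed.

(** In the same basis u^T w has a single nonzero row, the row 0, of length |w| = 1. Only index maps
    with [f ord0 = 0] contribute, and what remains is the bound for q rows of A. *)
Lemma mdisc_ub1 q (w : 'rV[R]_m.+1) : enorm w = 1 ->
  mdisc (fun a : 'I_q.+1 => if a == ord0 then u^T *m w else A) <=
  (m ^_ q)%:R * c ^+ q.
Proof.
move=> w1.
have [Q [QQ QQ' uQ]] := householder u; rewrite u1 scale1r in uQ.
pose rho i := enorm (row i (Q^T *m A *m Q)).
have rho0 : rho 0 = 0.
  rewrite /rho rowE !mulmxA -uQ -(mulmxA u) QQ mulmx1 uA mul0mx /enorm.
  by rewrite big1 ?sqrtr0 // => j _; rewrite mxE expr0n.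
rewrite -(mdisc_conj (Q := Q^T)) ?trmxK //.
apply: le_trans (mdisc_le _) _.
apply: (@le_trans _ _ (\sum_(f : {ffun 'I_q -> 'I_m.+1} | injectiveb f)
    \prod_a rho (f a))); last first.
  apply: sum_inj0_le => //; first by move=> i; exact: enorm_ge0.
  by rewrite frobenius frobenius_conj.
rewrite -sum_inj_recl //; apply: ler_sum => f _.
rewrite big_ord_recl eqxx le_eqVlt; apply/orP; left; apply/eqP.
congr (_ * _).
have -> : Q^T *m (u^T *m w) *m Q = (u *m Q)^T *m (w *m Q).
  by rewrite trmx_mul !mulmxA.
rewrite uQ.
rewrite row_mul rowE trmx_delta mul_delta_mx_cond.
case: (f ord0 == 0).
  have -> : delta_mx 0 0 = 1%:M :> 'M[R]_1 by apply/matrixP => i j; rewrite !ord1 !mxE.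
  by rewrite mulr1n mul1mx enorm_orth.
by rewrite mulr0n mul0mx /enorm big1 ?sqrtr0 // => j _; rewrite mxE expr0n.
Qed.

End upper.

Section equality.
Variables (m : nat) (w : 'rV[R]_m.+1) (c : R).
Hypothesis w1 : enorm w = 1.
Let A : 'M[R]_m.+1 := c *: (1%:M - w^T *m w).

(** In a basis with first vector w the matrix A is diagonal with entries 0, c, ..., c, so that its
    mixed minors attain the bounds obtained above. *)
Let conjA (Q : 'M[R]_m.+1) : Q^T *m Q = 1%:M -> w *m Q = delta_mx 0 0 ->
  forall i j, (Q^T *m A *m Q) i j = c * (i != 0)%:R * (i == j)%:R.
Proof.
move=> QQ' wQ i j.
rewrite /A -scalemxAr -scalemxAl mulmxBr mulmxBl mulmx1 QQ'.
rewrite !mulmxA -trmx_mul wQ -mulmxA wQ trmx_delta mul_delta_mx !mxE -mulrA.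
congr (_ * _); case: eqVneq => [->|ij].
  by rewrite andbb mulr1; case: (j == 0); rewrite ?subrr ?subr0.
rewrite mulr0; case: (eqVneq i 0) => [i0|]; last by rewrite subr0.
by rewrite -i0 eq_sym (negbTE ij) subr0.
Qed.

Lemma mdisc_radial q : mdisc (fun _ : 'I_q => A) = (m ^_ q)%:R * c ^+ q.
Proof.
have [Q [QQ QQ' wQ]] := householder w; rewrite w1 scale1r in wQ.
rewrite -(mdisc_conj (Q := Q^T)) ?trmxK //.
rewrite (mdisc_diag (d := fun _ i => c * (i != 0)%:R)); last by move=> _; exact: conjA.
exact: sum_inj0_const.
Qed.

Lemma mdisc_radial1 q :
  mdisc (fun a : 'I_q.+1 => if a == ord0 then w^T *m w else A) =
  (m ^_ q)%:R * c ^+ q.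
Proof.
have [Q [QQ QQ' wQ]] := householder w; rewrite w1 scale1r in wQ.
rewrite -(mdisc_conj (Q := Q^T)) ?trmxK //.
rewrite (mdisc_diag (d := fun a i => if a == ord0 then (i == 0)%:R
  else c * (i != 0)%:R)); last first.
  move=> a i j; case: ifP => _; last exact: conjA.
  rewrite !mulmxA -trmx_mul wQ -mulmxA wQ trmx_delta mul_delta_mx !mxE.
  by case: (eqVneq i 0) => [->|]; rewrite ?mul0r ?mul1r // eq_sym.
rewrite -sum_inj0_const -(@sum_inj_recl q m (fun i => c * (i != 0)%:R)); last first.
  by rewrite eqxx mulr0.
apply: eq_bigr => f _; rewrite big_ord_recl eqxx; congr (_ * _).
Qed.

End equality.
End mdisc_bounds.

(** * Functions of class C^k *)

Section calculus.
Context {R : realType}.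

(** The difference quotients of f in direction v and of its restriction to a line along v are the
    same function. One-variable results such as the chain rule and the mean value theorem are
    carried over in this way. *)
Lemma derive_line (V : normedModType R) (f : V -> R) x v (t : R) :
  (fun h : R => h^-1 *: (((fun s => f (s *: v + x)) \o shift t) (h *: (1 : R))
     - f (t *: v + x))) =
  (fun h => h^-1 *: ((f \o shift (t *: v + x)) (h *: v) - f (t *: v + x))).
Proof.
apply/funext => h /=; congr (_ *: (f _ - _)).
by rewrite [h *: 1]mulr1 scalerDl addrA.
Qed.

Lemma is_derive_lineP (V : normedModType R) (f : V -> R) x v (t df : R) :
  is_derive t (1 : R) (fun s => f (s *: v + x)) df <->
  is_derive (t *: v + x) v f df.
Proof.
by split=> -[fd fE]; split; move: fd fE; rewrite /derivable /derive derive_line.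
Qed.

Lemma is_derive_line0P (V : normedModType R) (f : V -> R) x v (df : R) :
  is_derive (0 : R) (1 : R) (fun s => f (s *: v + x)) df <-> is_derive x v f df.
Proof. by rewrite is_derive_lineP scale0r add0r. Qed.

Lemma is_derive_comp1 (V : normedModType R) (h : R -> R) (f : V -> R) x v dh df :
  is_derive (f x) (1 : R) h dh -> is_derive x v f df ->
  is_derive x v (fun y => h (f y)) (dh * df).
Proof.
move=> hd /is_derive_line0P fd; apply/is_derive_line0P.
by apply: is_derive1_comp; rewrite scale0r add0r.
Qed.

Lemma MVT0 (f df : R -> R) (s : R) :
  (forall t : R, is_derive t (1 : R) f (df t)) ->
  exists2 c, `|c| <= `|s| & f s - f 0 = df c * s.
Proof.
move=> fd; have fc : continuous f.
  by move=> t; apply/differentiable_continuous/derivable1_diffP; case: (fd t).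
have [s0|s0] := leP 0 s.
  have [c] := MVT_segment s0 (fun t _ => fd t) (continuous_subspaceT fc).
  rewrite in_itv /= subr0 => /andP[c0 cs] ->; exists c => //.
  by rewrite !ger0_norm // (le_trans c0).
have [c] := MVT_segment (ltW s0) (fun t _ => fd t) (continuous_subspaceT fc).
rewrite in_itv /= sub0r => /andP[sc c0] h; exists c.
  by rewrite ler0_norm // ler0_norm ?lerN2 // ltW.
by rewrite -opprB h mulrN opprK.
Qed.

Section partial.
Context {n : nat}.
Implicit Types (f g : 'rV[R]_n -> R) (x v : 'rV[R]_n) (i j : 'I_n).

Lemma Ck_continuous k f : Ck k f -> continuous f.
Proof. by case: k => [//|k []]. Qed.
Arguments Ck_continuous [k f] _ _.

Lemma Ck_derivable k f j x : Ck k.+1 f -> derivable f x (delta_mx 0 j).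
Proof. by move=> [_ /(_ j)[]]. Qed.

Lemma Ck_partial k f j : Ck k.+1 f -> Ck k (partial j f).
Proof. by move=> [_ /(_ j)[]]. Qed.

Lemma CkW k f : Ck k.+1 f -> Ck k f.
Proof.
elim: k f => [|k IH] f; first by case.
move=> [fc fd]; split => // j; have [d c] := fd j; split => //; exact: IH.
Qed.

Lemma Ck_build k f (df : 'I_n -> 'rV[R]_n -> R) : continuous f ->
  (forall j x, is_derive x (delta_mx 0 j) f (df j x)) ->
  (forall j, Ck k (df j)) -> Ck k.+1 f.
Proof.
move=> fc fd dc; split => // j; split; first by move=> x; case: (fd j x).
by rewrite (_ : partial j f = df j) //; apply/funext => x; case: (fd j x).
Qed.

Lemma Ck_is_derive k f j x : Ck k.+1 f -> is_derive x (delta_mx 0 j) f (partial j f x).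
Proof. by move=> fk; split => //; exact: Ck_derivable fk. Qed.

Lemma Ck_cst k (c : R) : Ck k (cst c : 'rV[R]_n -> R).
Proof.
elim: k c => [|k IH] c; first exact: cst_continuous.
apply: (@Ck_build _ _ (fun=> cst 0)) => //; first exact: cst_continuous.
Qed.

Lemma CkD k f g : Ck k f -> Ck k g -> Ck k (fun x => f x + g x).
Proof.
elim: k f g => [|k IH] f g fk gk.
  by move=> x; exact: (continuousD (Ck_continuous fk x) (Ck_continuous gk x)).
apply: (@Ck_build _ _ (fun j x => partial j f x + partial j g x)).
- by move=> x; exact: (continuousD (Ck_continuous fk x) (Ck_continuous gk x)).
- move=> j x; have := Ck_is_derive j x fk; have := Ck_is_derive j x gk.
  by move=> ? ?; apply: is_deriveD.
- by move=> j; apply: IH; apply: Ck_partial.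
Qed.

Lemma CkM k f g : Ck k f -> Ck k g -> Ck k (fun x => f x * g x).
Proof.
elim: k f g => [|k IH] f g fk gk.
  by move=> x; exact: (continuousM (Ck_continuous fk x) (Ck_continuous gk x)).
apply: (@Ck_build _ _ (fun j x => f x * partial j g x + g x * partial j f x)).
- by move=> x; exact: (continuousM (Ck_continuous fk x) (Ck_continuous gk x)).
- move=> j x; have := Ck_is_derive j x fk; have := Ck_is_derive j x gk.
  by move=> ? ?; apply: is_deriveM.
- by move=> j; apply: CkD; apply: IH; try apply: Ck_partial => //; apply: CkW.
Qed.

Lemma CkZ k (c : R) f : Ck k f -> Ck k (fun x => c * f x).
Proof. by apply: CkM; exact: Ck_cst. Qed.

Lemma CkN k f : Ck k f -> Ck k (fun x => - f x).
Proof.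
by move=> /(CkZ (- 1)); rewrite (_ : (fun x => -1 * _) = fun x => - f x) //;
  apply/funext => x; rewrite mulN1r.
Qed.

Lemma CkB k f g : Ck k f -> Ck k g -> Ck k (fun x => f x - g x).
Proof. by move=> fk /CkN; exact: CkD. Qed.

Lemma CkX k m f : Ck k f -> Ck k (fun x => f x ^+ m).
Proof.
move=> fk; elim: m => [|m IH]; first exact: Ck_cst.
by under eq_fun do rewrite exprS; exact: CkM.
Qed.

Lemma Ck_sum k (I : Type) (r : seq I) (P : pred I) (F : I -> 'rV[R]_n -> R) :
  (forall i : I, P i -> Ck k (F i)) -> Ck k (fun x => \sum_(i <- r | P i) F i x).
Proof.
move=> Fk; elim: r => [|i r IH].
  by under eq_fun do rewrite big_nil; exact: Ck_cst.
case Pi : (P i); under eq_fun do rewrite big_cons Pi; last by [].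
by apply: CkD => //; exact: Fk.
Qed.

Lemma Ck_prod k (I : Type) (r : seq I) (P : pred I) (F : I -> 'rV[R]_n -> R) :
  (forall i : I, P i -> Ck k (F i)) -> Ck k (fun x => \prod_(i <- r | P i) F i x).
Proof.
move=> Fk; elim: r => [|i r IH].
  by under eq_fun do rewrite big_nil; exact: Ck_cst.
case Pi : (P i); under eq_fun do rewrite big_cons Pi; last by [].
by apply: CkM => //; exact: Fk.
Qed.

Lemma is_derive_coord i v x : is_derive x v (fun y : 'rV[R]_n => y 0 i) (v 0 i).
Proof.
have h : (fun h : R => h^-1 *: (((fun y : 'rV[R]_n => y 0 i) \o shift x) (h *: v) - x 0 i))
    @ 0^' --> v 0 i.
  apply: cvg_near_cst; near=> h => /=.
  rewrite !mxE addrK [_ *: _]mulrA mulVf ?mul1r //.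
  by near: h; exact: nbhs_dnbhs_neq.
split; first by apply/cvg_ex; exists (v 0 i).
exact/cvg_lim.
Unshelve. all: by end_near. Qed.

Lemma Ck_coord k i : Ck k (fun x : 'rV[R]_n => x 0 i).
Proof.
have c : continuous (fun x : 'rV[R]_n => x 0 i) by exact: coord_continuous.
case: k => // k; apply: (@Ck_build _ _ (fun j => cst ((delta_mx 0 j : 'rV[R]_n) 0 i))) => //.
  by move=> j x; exact: is_derive_coord.
by move=> j; exact: Ck_cst.
Qed.

Lemma partialD f g j x : derivable f x (delta_mx 0 j) -> derivable g x (delta_mx 0 j) ->
  partial j (fun y => f y + g y) x = partial j f x + partial j g x.
Proof. exact: deriveD. Qed.

Lemma partialB f g j x : derivable f x (delta_mx 0 j) -> derivable g x (delta_mx 0 j) ->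
  partial j (fun y => f y - g y) x = partial j f x - partial j g x.
Proof. exact: deriveB. Qed.

Lemma partialM f g j x : derivable f x (delta_mx 0 j) -> derivable g x (delta_mx 0 j) ->
  partial j (fun y => f y * g y) x = f x * partial j g x + g x * partial j f x.
Proof. exact: deriveM. Qed.

Lemma partial_coord i j x : partial j (fun y : 'rV[R]_n => y 0 i) x = (i == j)%:R.
Proof. by have [_] := is_derive_coord i (delta_mx 0 j) x; rewrite /partial mxE. Qed.

Lemma partial_cst (c : R) j x : partial j (cst c) x = 0.
Proof. exact: derive_cst. Qed.

(** The exponent is general in the induction, since each derivative lowers it by 1. *)
Lemma Ck_powR k (a : R) f : (forall x, 0 < f x) -> Ck k f -> Ck k (fun x => f x `^ a).
Proof.
move=> f0; elim: k a => [|k IH] a fk.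
  move=> x; apply: (@continuous_comp _ _ _ f (fun t => t `^ a)); first exact: (Ck_continuous fk).
  apply/differentiable_continuous/derivable1_diffP.
  by have [] := @is_derive1_powR R a (f x) (f0 x).
have fc := Ck_continuous fk.
apply: (@Ck_build _ _ (fun j x => (a * f x `^ (a - 1)) * partial j f x)).
- move=> x; apply: (@continuous_comp _ _ _ f (fun t => t `^ a)); first exact: fc.
  apply/differentiable_continuous/derivable1_diffP.
  by have [] := @is_derive1_powR R a (f x) (f0 x).
- move=> j x.
  exact: (is_derive_comp1 (@is_derive1_powR R a (f x) (f0 x)) (Ck_is_derive j x fk)).
- move=> j; apply: CkM; last exact: Ck_partial.
  by apply: CkZ; apply: IH; exact: CkW.
Qed.

Lemma partial_powR f (a : R) j x : 0 < f x -> derivable f x (delta_mx 0 j) ->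
  partial j (fun y => f y `^ a) x = a * f x `^ (a - 1) * partial j f x.
Proof.
move=> f0 fd; have fd' : is_derive x (delta_mx 0 j) f (partial j f x) by split.
by have [] := is_derive_comp1 (@is_derive1_powR R a (f x) f0) fd'.
Qed.

End partial.
End calculus.

Arguments Ck_continuous {R n} [k f] _ _.

(** * First-order expansion, chain rule and symmetry of second derivatives *)

Section chain_rule.
Context {R : realType} {n : nat}.
Implicit Types (f g : 'rV[R]_n -> R) (x v h : 'rV[R]_n) (i j : 'I_n).

Lemma coord_le_norm x i : `|x 0 i| <= `|x|.
Proof. by rewrite [leRHS]mx_normrE; exact: (le_bigmax _ (fun k => `|x k.1 k.2|) (0, i)). Qed.

Lemma norm_le_coord x (c : R) : 0 <= c -> (forall i, `|x 0 i| <= c) -> `|x| <= c.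
Proof.
move=> c0 xc; rewrite [leLHS]mx_normrE; apply: bigmax_le => // -[i j] _ /=.
by rewrite ord1.
Qed.

Lemma continuousP_norm f x : {for x, continuous f} ->
  forall e : R, 0 < e -> exists2 d : R, 0 < d & forall y, `|y - x| < d -> `|f y - f x| < e.
Proof.
move=> /cvgrPdist_lt fx e e0; have /nbhs_ballP[d d0 H] := fx e e0.
exists d => // y yd; rewrite distrC; apply: H; rewrite -ball_normE /=.
by rewrite distrC.
Qed.

Let trunc (k : nat) h : 'rV[R]_n := \row_i (if (i < k)%N then h 0 i else 0).

(** The increment is split by changing one coordinate at a time, along the points [trunc k h]. The
    mean value theorem turns each part into a partial derivative at a point within |h| of x, where
    continuity applies. *)
Lemma C1_expansion f x : Ck 1 f -> forall e : R, 0 < e -> exists2 d : R, 0 < d &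
  forall h, `|h| < d ->
  `|f (h + x) - f x - \sum_j h 0 j * partial j f x| <= e * `|h|.
Proof.
move=> f1 e e0; pose e' := e / n.+1%:R.
have e'0 : 0 < e' by rewrite divr_gt0.
have [d d0 dP] : exists2 d : R, 0 < d & forall y, `|y - x| < d ->
    forall j, `|partial j f y - partial j f x| < e'.
  have dj j := continuousP_norm (Ck_continuous (Ck_partial j f1) x) e'0.
  pose D j := xget 1 [set d : R | 0 < d /\ forall y, `|y - x| < d ->
    `|partial j f y - partial j f x| < e'].
  have DP j : 0 < D j /\ forall y, `|y - x| < D j ->
      `|partial j f y - partial j f x| < e'.
    rewrite /D; case: xgetP => [d -> //|h].
    by have [d d0 dP] := dj j; exfalso; apply: (h d).
  exists (\big[Order.min/1]_j D j).
    by apply: lt_bigmin => [|j _]; [exact: ltr01|case: (DP j)].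
  move=> y yd j; have [_] := DP j; apply; apply: (lt_le_trans yd).
  exact: bigmin_le.
exists d => // h hd.
have t0 : trunc 0 h = 0 by apply/rowP => i; rewrite !mxE ltn0.
have tn : trunc n h = h by apply/rowP => i; rewrite !mxE ltn_ord.
have tS j : trunc j.+1 h = h 0 j *: delta_mx 0 j + trunc j h.
  apply/rowP => i; rewrite !mxE /= ltnS leq_eqVlt -val_eqE eq_sym /=.
  case: (eqVneq j i) => [->|ij] /=.
    by rewrite eqxx ltnn mulr1 addr0.
  by move: ij; rewrite -val_eqE /= => /negbTE ->; rewrite mulr0 add0r.
have step j : `|f (trunc j.+1 h + x) - f (trunc j h + x) - h 0 j * partial j f x| <=
    e' * `|h|.
  have [c ch E] := @MVT0 _ (fun t : R => f (t *: delta_mx 0 j + (trunc j h + x)))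
    (fun t => partial j f (t *: delta_mx 0 j + (trunc j h + x))) (h 0 j)
    (fun t => (is_derive_lineP _ _ _ _ _).2 (Ck_is_derive j _ f1)).
  rewrite tS -(addrA (h 0 j *: _)); rewrite scale0r add0r in E; rewrite E.
  rewrite [h 0 j * _]mulrC -mulrBl normrM ler_pM //; last exact: coord_le_norm.
  apply/ltW/dP; rewrite addrA addrK.
  apply: le_lt_trans hd; apply: norm_le_coord => // i.
  rewrite !mxE /=; case: eqVneq => [->|ij].
    by rewrite ltnn addr0 mulr1 (le_trans ch) // coord_le_norm.
  rewrite mulr0 add0r; case: ifP => _; first exact: coord_le_norm.
  by rewrite normr0.
have -> : f (h + x) - f x - \sum_j h 0 j * partial j f x =
    \sum_(j < n) (f (trunc j.+1 h + x) - f (trunc j h + x) - h 0 j * partial j f x).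
  rewrite sumrB -(big_mkord predT (fun k => f (trunc k.+1 h + x) - f (trunc k h + x))).
  by rewrite telescope_sumr // t0 tn add0r.
apply: le_trans (ler_norm_sum _ _ _) _.
apply: (@le_trans _ _ (\sum_(j < n) e' * `|h|)).
  by apply: ler_sum => j _; exact: step.
rewrite sumr_const card_ord -mulr_natl mulrA ler_wpM2r //.
by rewrite /e' mulrCA ger_pMr // ler_pdivrMr // mul1r ler_nat.
Qed.

Lemma C1_is_derive f x v : Ck 1 f -> is_derive x v f (\sum_j v 0 j * partial j f x).
Proof.
move=> f1.
have H : (fun t : R => t^-1 *: ((f \o shift x) (t *: v) - f x)) @ 0^' -->
    \sum_j v 0 j * partial j f x.
  apply/cvgrPdist_le => /= e e0.
  have e'0 : 0 < e / (`|v| + 1) by rewrite divr_gt0 // ltr_wpDl.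
  have [d d0 dP] := C1_expansion x f1 e'0.
  near=> t.
  have t0 : t != 0 by near: t; exact: nbhs_dnbhs_neq.
  have td : `|t *: v| < d.
    rewrite normrZ; apply: (@le_lt_trans _ _ (`|t| * (`|v| + 1))).
      by rewrite ler_wpM2l // lerDl.
    rewrite -ltr_pdivlMr ?ltr_wpDl //.
    by near: t; apply: dnbhs0_lt; rewrite divr_gt0 // ltr_wpDl.
  have := dP _ td.
  have -> : \sum_j (t *: v) 0 j * partial j f x = t * \sum_j v 0 j * partial j f x.
    by rewrite mulr_sumr; apply: eq_bigr => j _; rewrite mxE mulrA.
  set S := \sum_j _; move=> dd.
  rewrite distrC (_ : _ - S = t^-1 * (f (t *: v + x) - f x - t * S)); last first.
    by rewrite mulrBr mulrA mulVf // mul1r.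
  rewrite normrM normfV ler_pdivrMl ?normr_gt0 //; apply: (le_trans dd).
  rewrite normrZ mulrCA ler_wpM2l // mulrAC ler_pdivrMr ?ltr_wpDl //.
  by rewrite ler_wpM2l ?ltW // ltrDl.
split; first by apply/cvg_ex; exists (\sum_j v 0 j * partial j f x).
exact/cvg_lim.
Unshelve. all: by end_near. Qed.

Lemma C1_differentiable f x : Ck 1 f -> differentiable f x.
Proof.
move=> f1.
pose df h := \sum_j h 0 j * partial j f x.
have dfl : linear df.
  move=> a h1 h2; rewrite /df scaler_sumr -big_split /=; apply: eq_bigr => j _.
  by rewrite !mxE mulrDl -mulrA.
pose dfL := HB.pack df (GRing.isLinear.Build _ _ _ _ df dfl) : {linear 'rV[R]_n -> R}.
have dfc : continuous dfL.
  move=> y; apply: (@Ck_continuous _ _ 0 df); apply: Ck_sum => j _.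
  by apply: CkM; [exact: Ck_coord|exact: Ck_cst].
have E : f \o shift x = cst (f x) + dfL +o_ (0 : 'rV[R]_n) id.
  apply/eqaddoP => e e0; have [d d0 dP] := C1_expansion x f1 e0.
  near=> h => /=; have hd : `|h| < d.
    by near: h; apply/nbhs_ballP; exists d => // h; rewrite -ball_normE /= sub0r normrN.
  have := dP h hd; rewrite !fctE opprD addrA; exact.
by apply/diff_locallyP; rewrite (diff_unique dfc E).
Unshelve. all: by end_near. Qed.

Lemma C1_chain f (g : R -> 'rV[R]_n) (dg : 'I_n -> R) t : Ck 1 f ->
  (forall j, is_derive t (1 : R) (fun s => g s 0 j) (dg j)) ->
  is_derive t (1 : R) (fun s => f (g s)) (\sum_j dg j * partial j f (g t)).
Proof.
move=> f1 gd.
have gd' : derivable g t 1.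
  by apply/derivable_mxP => i j; rewrite ord1; case: (gd j).
have dg' : 'd g t 1 = \row_j dg j.
  rewrite -deriveE; last exact/derivable1_diffP.
  rewrite derive_mx //; apply/rowP => j; rewrite !mxE.
  by case: (gd j).
have gdf : differentiable g t by apply/derivable1_diffP.
have fd := C1_differentiable (g t) f1.
have cd : differentiable (fun s => f (g s)) t by exact: differentiable_comp.
split; first exact/derivable1_diffP.
rewrite deriveE // (diff_comp gdf fd) /= dg' -deriveE //.
have [_ ->] := C1_is_derive (g t) (\row_j dg j) f1.
by apply: eq_bigr => j _; rewrite mxE.
Qed.

Lemma C1_comp_is_derive m f (G : 'rV[R]_m -> 'rV[R]_n) (dG : 'I_n -> R) (x v : 'rV[R]_m) :
  Ck 1 f -> (forall i, is_derive x v (fun y => G y 0 i) (dG i)) ->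
  is_derive x v (fun y => f (G y)) (\sum_i dG i * partial i f (G x)).
Proof.
move=> f1 Gd; apply/is_derive_line0P.
have := @C1_chain f (fun s => G (s *: v + x)) dG 0 f1.
rewrite scale0r add0r; apply => j.
by apply/(is_derive_line0P (fun y => G y 0 j)).
Qed.

Lemma continuous_comp_rV m (G : 'rV[R]_m -> 'rV[R]_n) f :
  (forall i, continuous (fun y => G y 0 i)) -> continuous f ->
  continuous (fun y => f (G y)).
Proof.
move=> Gc fc y; apply: continuous_comp; last exact: fc.
apply/(@cvgrPdist_le _ _ _ (nbhs (y : 'rV[R]_m)) _ G (G y)) => /= e e0.
have H : nbhs (y : 'rV[R]_m) [set z | forall i, `|G y 0 i - G z 0 i| <= e].
  have Hi i : \forall z \near (y : 'rV[R]_m), `|G y 0 i - G z 0 i| <= e.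
    exact: ((@cvgrPdist_le _ _ _ (nbhs (y : 'rV[R]_m)) _ (fun z => G z 0 i)
    (G y 0 i)).1 (Gc i y)).
  exact: filter_forall Hi.
apply: filterS H => z H; apply: norm_le_coord; first exact: ltW.
by move=> i; rewrite !mxE.
Qed.

Lemma C1_comp m f (G : 'rV[R]_m -> 'rV[R]_n) : Ck 1 f ->
  (forall i, Ck 1 (fun y => G y 0 i)) -> Ck 1 (fun y => f (G y)).
Proof.
move=> f1 G1.
apply: (@Ck_build _ _ 0 _
  (fun (j : 'I_m) (x : 'rV[R]_m) => \sum_i partial j (fun y => G y 0 i) x * partial i f (G x))).
- apply: continuous_comp_rV; last exact: Ck_continuous f1.
  by move=> i; exact: Ck_continuous (G1 i).
- by move=> j x; apply: C1_comp_is_derive => // i; exact: Ck_is_derive.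
- move=> j; apply: (@Ck_sum _ _ 0) => i _; apply: CkM; first exact: Ck_partial.
  apply: continuous_comp_rV; last exact: Ck_continuous (Ck_partial i f1).
  by move=> k; exact: Ck_continuous (G1 k).
Qed.

(** The second difference of f over a square of side s is symmetric in the two directions. Two
    applications of the mean value theorem, in either order, identify it with s^2 times one or the
    other mixed derivative at a nearby point. *)
Lemma partial_sym f i j x : Ck 2 f ->
  partial i (partial j f) x = partial j (partial i f) x.
Proof.
move=> f2; set A := LHS; set B := RHS.
suff H (e : R) : 0 < e -> `|A - B| <= 2 * e.
  apply/eqP; rewrite -subr_eq0 -normr_eq0; apply/eqP/le_anti.
  rewrite normr_ge0 andbT; apply/ler_addgt0Pl => e e0; rewrite addr0.
  by rewrite (le_trans (H (e / 2) _)) ?divr_gt0 // mulrC divfK.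
move=> e0.
have cA : continuous (partial i (partial j f)).
  by apply: (@Ck_continuous _ _ 0); do 2 apply: Ck_partial.
have cB : continuous (partial j (partial i f)).
  by apply: (@Ck_continuous _ _ 0); do 2 apply: Ck_partial.
have [d1 d10 dA] := continuousP_norm (cA x) e0.
have [d2 d20 dB] := continuousP_norm (cB x) e0.
(* The intermediate points are within 2 s of x, which has to stay below both radii of continuity. *)
pose s : R := Num.min d1 d2 / 3.
have s0 : 0 < s by rewrite divr_gt0 // lt_min d10.
have f1 := CkW f2.
have key (k l : 'I_n) : exists2 y : 'rV[R]_n, `|y - x| <= 2 * s &
   f (s *: delta_mx 0 k + s *: delta_mx 0 l + x) - f (s *: delta_mx 0 k + x)
  - f (s *: delta_mx 0 l + x) + f x = partial l (partial k f) y * s * s.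
  pose u := s *: delta_mx 0 l + x.
  have [c cs Ec] := @MVT0 _ (fun t : R => f (t *: delta_mx 0 k + u)
      - f (t *: delta_mx 0 k + x))
    (fun t => partial k f (t *: delta_mx 0 k + u) - partial k f (t *: delta_mx 0 k + x))
    s (fun t => is_deriveB ((is_derive_lineP _ _ _ _ _).2 (Ck_is_derive k _ f1))
      ((is_derive_lineP _ _ _ _ _).2 (Ck_is_derive k _ f1))).
  have [c' cs' Ec'] := @MVT0 _ (fun t : R => partial k f (t *: delta_mx 0 l +
      (c *: delta_mx 0 k + x)))
    (fun t => partial l (partial k f) (t *: delta_mx 0 l + (c *: delta_mx 0 k + x)))
    s (fun t => (is_derive_lineP _ _ _ _ _).2 (Ck_is_derive l _ (Ck_partial k f2))).
  exists (c' *: delta_mx 0 l + (c *: delta_mx 0 k + x)).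
    rewrite addrA addrK; apply: norm_le_coord; first by rewrite mulr_ge0 // ltW.
    move=> m; rewrite !mxE /= (le_trans (ler_normD _ _)) // mulr_natl mulr2n.
    rewrite !normrM; rewrite (ger0_norm (ltW s0)) in cs cs'.
    have nb (b : bool) : `|b%:R| <= 1 :> R by case: b; rewrite ?normr1 ?normr0.
    by apply: lerD; rewrite -[leRHS]mulr1 ler_pM.
  rewrite -Ec' !scale0r !add0r.
  have -> : s *: delta_mx 0 l + (c *: delta_mx 0 k + x) = c *: delta_mx 0 k + u.
    by rewrite /u addrCA.
  rewrite -Ec /u !scale0r !add0r addrA; ring.
have [y1 y1s E1] := key i j; have [y2 y2s E2] := key j i.
have s2 : 2 * s < Num.min d1 d2.
  rewrite /s mulrA ltr_pdivrMr // mulrC ltr_pM2l ?lt_min ?d10 //.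
  by rewrite ltr_nat.
have : partial j (partial i f) y1 * s * s = partial i (partial j f) y2 * s * s.
  apply: (etrans (esym E1)); apply: (etrans _ E2); congr (_ + _).
  apply: (etrans (addrAC _ _ _)); congr (f (_ + x) - _ - _).
  exact: addrC.
move/(mulIf (lt0r_neq0 s0))/(mulIf (lt0r_neq0 s0)) => E.
have h1 : `|partial i (partial j f) y2 - A| < e.
  apply: dA; apply: le_lt_trans y2s _; apply: lt_le_trans s2 _.
  by rewrite ge_min lexx.
have h2 : `|partial j (partial i f) y1 - B| < e.
  apply: dB; apply: le_lt_trans y1s _; apply: lt_le_trans s2 _.
  by rewrite ge_min lexx orbT.
rewrite E in h2.
rewrite mulr_natl mulr2n (_ : A - B = - (partial i (partial j f) y2 - A) +
  (partial i (partial j f) y2 - B)); last by ring.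
apply: (le_trans (ler_normD _ _)); rewrite normrN.
by apply: lerD; apply: ltW; [exact: h1|exact: h2].
Qed.

End chain_rule.

(** * Smooth step functions *)

Section bump.
Context {R : realType}.
Implicit Types (t y : R) (m : nat).

(* The functions t^-m exp(-1/t), extended by 0 to t <= 0, form a family stable
   under differentiation. *)
Definition bump m t : R := if 0 < t then t^-1 ^+ m * expR (- t^-1) else 0.

Lemma bump_pos m t : 0 < t -> bump m t = t^-1 ^+ m * expR (- t^-1).
Proof. by rewrite /bump => ->. Qed.

Lemma bump_npos m t : t <= 0 -> bump m t = 0.
Proof. by rewrite /bump ltNge => ->. Qed.

Lemma bump_gt0 m t : 0 < t -> 0 < bump m t.
Proof. by move=> t0; rewrite bump_pos // mulr_gt0 ?expR_gt0 // exprn_gt0 // invr_gt0. Qed.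

Lemma bump_ge0 m t : 0 <= bump m t.
Proof. by have [/(bump_npos m) ->//|/(bump_gt0 m)/ltW] := leP t 0. Qed.

Lemma bumpS m t : 0 < t -> t * bump m.+1 t = bump m t.
Proof.
by move=> t0; rewrite !bump_pos // exprS !mulrA divff ?mul1r // gt_eqF.
Qed.

(** With y = 1 / t this is y^m / m! <= exp y. *)
Lemma bump_le_fact m t : bump m t <= m`!%:R.
Proof.
have [/(bump_npos m) ->|t0] := leP t 0; first exact: ler0n.
rewrite bump_pos // expRN ler_pdivrMr ?expR_gt0 //.
have y0 : 0 <= t^-1 by rewrite invr_ge0 ltW.
case: m => [|m]; first by rewrite expr0 mul1r -expR0 ler_expR.
rewrite mulrC -ler_pdivrMr ?ltr0n ?fact_gt0 //.
by apply: le_trans (expR_ge1Dxn m y0); rewrite lerDr.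
Qed.

Lemma bump_le m t : 0 <= t -> bump m t <= m.+1`!%:R * t.
Proof.
rewrite le_eqVlt => /orP[/eqP <-|t0]; first by rewrite bump_npos // mulr0.
by rewrite -bumpS // mulrC ler_pM2r // bump_le_fact.
Qed.

(** For t > 0 the function y^m exp (- y) is differentiated at y = 1 / t. At t = 0 the right
    difference quotient is [bump m.+1 h], which is O(h), and the left one vanishes. *)
Lemma is_derive_bump m t :
  is_derive t (1 : R) (bump m) (bump m.+2 t - m%:R * bump m.+1 t).
Proof.
have [t0|t0|->] := ltgtP t 0.
- rewrite !bump_npos ?(ltW t0) // mulr0 subr0.
  apply: (@near_eq_is_derive _ _ _ (cst 0)).
    near=> s; rewrite bump_npos // ltW //.
    by near: s; exact: lt_nbhsl.
- pose f s : R := s^-1 ^+ m * expR (- s^-1).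
  apply: (@near_eq_is_derive _ _ _ f).
    near=> s; rewrite bump_pos //.
    by near: s; exact: lt_nbhsr.
  pose h : R -> R := fun y => y ^+ m * expR (- y).
  have hd y : is_derive y (1 : R) h (y ^+ m * - expR (- y) + expR (- y) * (m%:R * y ^+ m.-1)).
    have d1 : is_derive y (1 : R) (fun y : R => y ^+ m) (m%:R * y ^+ m.-1).
      split; first exact: exprn_derivable.
      by rewrite exp_derive [LHS]mulr1.
    have d2 : is_derive y (1 : R) (fun y : R => expR (- y)) (- expR (- y)).
      rewrite -[X in is_derive _ _ _ X]mulrN1.
      apply: (@is_derive1_comp _ expR -%R).
    exact: (is_deriveM d1 d2).
  have tn0 : t != 0 by rewrite gt_eqF.
  have id' : is_derive t (1 : R) (fun s : R => s^-1) (- t ^- 2 *: 1).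
    exact: (@is_deriveV _ id).
  have := is_derive1_comp (hd t^-1) id'.
  move=> /is_derive_eq; apply.
  rewrite !bump_pos // [_ *: 1]mulr1.
  case: m @f @h hd => [|m] f h hd /=.
    by rewrite expr0 !mul0r subr0 mulr0 addr0 mul1r -exprVn mulrNN mulrC.
  by rewrite -exprVn !exprS; ring.
- rewrite !bump_npos // mulr0 subr0.
  have H : (fun h : R => h^-1 *: ((bump m \o shift 0) (h *: (1 : R)) - bump m 0)) @ 0^' --> (0 : R).
    apply/cvgrPdist_le => /= e e0; near=> h.
    rewrite sub0r normrN (@bump_npos m 0) // subr0 addr0 [h *: 1]mulr1.
    have [h0|h0] := leP h 0; first by rewrite bump_npos // scaler0 normr0 ltW.
    rewrite -bumpS // [_ *: _]mulrA mulVf ?gt_eqF // mul1r ger0_norm ?bump_ge0 //.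
    apply: (le_trans (bump_le _ (ltW h0))).
    rewrite mulrC -ler_pdivlMr ?ltr0n ?fact_gt0 //.
    rewrite -[h]ger0_norm ?ltW //; near: h.
    by apply: dnbhs0_lt; rewrite divr_gt0 // ltr0n fact_gt0.
  split; first by apply/cvg_ex; exists 0.
  exact/cvg_lim.
Unshelve. all: by end_near. Qed.

Lemma continuous_bump m : continuous (bump m).
Proof.
move=> t; apply/differentiable_continuous/derivable1_diffP.
by case: (is_derive_bump m t).
Qed.

Lemma Ck_bump n k m (f : 'rV[R]_n -> R) : Ck k f -> Ck k (fun x => bump m (f x)).
Proof.
elim: k m => [|k IH] m fk.
  move=> x; apply: (@continuous_comp _ _ _ f (bump m)); first exact: (Ck_continuous fk).
  exact: continuous_bump.
apply: (@Ck_build _ _ _ _ (fun j x => (bump m.+2 (f x) - m%:R * bump m.+1 (f x)) * partial j f x)).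
- move=> x; apply: (@continuous_comp _ _ _ f (bump m)); first exact: (Ck_continuous fk).
  exact: continuous_bump.
- move=> j x; exact: (is_derive_comp1 (is_derive_bump m (f x)) (Ck_is_derive j x fk)).
- move=> j; apply: CkM; last exact: Ck_partial.
  by apply: CkB; [|apply: CkZ]; apply: IH; exact: CkW.
Qed.

Definition sstep t : R := bump 0 t * (bump 0 t + bump 0 (1 - t))^-1.

(** One of t and 1 - t is at least 1/2, where [bump 0] is at least exp (-2). *)
Lemma sstep_den t : expR (- 2) <= bump 0 t + bump 0 (1 - t).
Proof.
have H s : 2^-1 <= s -> expR (- 2) <= bump 0 s.
  move=> hs; have s0 : 0 < s by apply: lt_le_trans hs.
  rewrite bump_pos // expr0 mul1r ler_expR lerN2.
  by rewrite -[leRHS]invrK lef_pV2 // posrE.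
have [t2|t2] := leP 2^-1 t; first by rewrite ler_wpDr ?bump_ge0 // H.
by rewrite ler_wpDl ?bump_ge0 // H //; lra.
Qed.

Lemma sstep_den_gt0 t : 0 < bump 0 t + bump 0 (1 - t).
Proof. exact: lt_le_trans (expR_gt0 _) (sstep_den t). Qed.

Lemma sstep_ge0 t : 0 <= sstep t.
Proof. by rewrite mulr_ge0 ?bump_ge0 // invr_ge0 ltW // sstep_den_gt0. Qed.

Lemma sstep_le1 t : sstep t <= 1.
Proof. by rewrite ler_pdivrMr ?sstep_den_gt0 // mul1r lerDl bump_ge0. Qed.

Lemma sstep0 t : t <= 0 -> sstep t = 0.
Proof. by move=> t0; rewrite /sstep bump_npos // mul0r. Qed.

Lemma sstep1 t : 1 <= t -> sstep t = 1.
Proof.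
move=> t1; have t0 : 0 < t by apply: lt_le_trans t1.
by rewrite /sstep (@bump_npos _ (1 - t)) ?subr_le0 // addr0 divff // gt_eqF // bump_gt0.
Qed.

Definition dsstep t : R :=
  (bump 2 t * bump 0 (1 - t) + bump 0 t * bump 2 (1 - t)) /
  (bump 0 t + bump 0 (1 - t)) ^+ 2.

Lemma is_derive_sstep t : is_derive t (1 : R) sstep (dsstep t).
Proof.
have d0 s : is_derive s (1 : R) (bump 0) (bump 2 s).
  by have := is_derive_bump 0 s; rewrite mul0r subr0.
have d1 : is_derive t (1 : R) (fun s : R => 1 - s) (- 1).
  have := is_deriveB (is_derive_cst (1 : R) t (1 : R)) (is_derive_id t (1 : R)).
  by rewrite sub0r.
have d2 := @is_derive1_comp _ (bump 0) (fun s : R => 1 - s) t _ _ (d0 (1 - t)) d1.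
have d3 := is_deriveD (d0 t) d2.
have n0 : (bump 0 + (bump 0 \o (fun s => 1 - s))) t != 0.
  by rewrite gt_eqF // sstep_den_gt0.
have := is_deriveM (d0 t) (is_deriveV n0 d3).
move=> /is_derive_eq; apply.
have := sstep_den_gt0 t; rewrite /dsstep fctE /= => /lt0r_neq0 h.
rewrite /GRing.scale /=; field.
exact: h.
Qed.

(** By [bump_le_fact] the numerator is at most 2! 0! + 0! 2! = 4, and the denominator is at least
    exp (-4). *)
Lemma dsstep_le t : `|dsstep t| <= 4 * expR 4.
Proof.
have h0 : 0 <= bump 2 t * bump 0 (1 - t) + bump 0 t * bump 2 (1 - t).
  by rewrite addr_ge0 // mulr_ge0 // bump_ge0.
have d0 := sstep_den_gt0 t.
rewrite ger0_norm ?divr_ge0 ?sqr_ge0 // ler_pdivrMr ?exprn_gt0 //.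
have e2 : expR (- 4) <= (bump 0 t + bump 0 (1 - t)) ^+ 2.
  rewrite (_ : -4 = -2 + -2) ?expRD -?expr2; last by lra.
  by rewrite lerXn2r ?nnegrE ?expR_ge0 ?(ltW d0) ?sstep_den.
apply: (@le_trans _ _ 4).
  rewrite (_ : 4 = 2 * 1 + 1 * 2 :> R); last by lra.
  by apply: lerD; apply: ler_pM; rewrite ?bump_ge0 //; exact: bump_le_fact.
rewrite -mulrA ler_peMr // -[leLHS](_ : expR 4 * expR (- 4) = 1).
  by rewrite ler_pM2l ?expR_gt0.
by rewrite -expRD subrr expR0.
Qed.

Lemma dsstep_out t : t <= 0 \/ 1 <= t -> dsstep t = 0.
Proof.
rewrite /dsstep; case=> h.
  by rewrite !(bump_npos _ h) !mul0r addr0 mul0r.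
have h' : 1 - t <= 0 by rewrite subr_le0.
by rewrite !(bump_npos _ h') !mulr0 addr0 mul0r.
Qed.

Lemma Ck_sstep n k (f : 'rV[R]_n -> R) : Ck k f -> Ck k (fun x => sstep (f x)).
Proof.
move=> fk; apply: CkM; first exact: Ck_bump.
have -> : (fun x => (bump 0 (f x) + bump 0 (1 - f x))^-1) =
    (fun x => (bump 0 (f x) + bump 0 (1 - f x)) `^ (-1)).
  by apply/funext => x; rewrite powR_inv1 // ltW // sstep_den_gt0.
apply: Ck_powR; first by move=> x; exact: sstep_den_gt0.
apply: CkD; first exact: Ck_bump.
by apply: Ck_bump; apply: CkB => //; exact: Ck_cst.
Qed.

End bump.

(** * Integration on the ball *)

Section measurable_rV.
Context {R : realType} {n : nat}.

Definition qbox (q : 'rV[rat]_n) (k : nat) : set 'rV[R]_n :=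
  [set y | forall i, `|y 0 i - ratr (q 0 i)| < k.+1%:R^-1].

Lemma measurable_coord_set (P : 'I_n -> set R) : (forall i, measurable (P i)) ->
  measurable [set y : 'rV[R]_n | forall i, P i (y 0 i)].
Proof.
move=> mP; rewrite (_ : [set _ | _] = \bigcap_(i in [set: 'I_n])
    ((fun x : 'rV[R]_n => x 0 i) @^-1` (P i))); last first.
  by apply/seteqP; split => [y h i _|y h i]; [exact: h|exact: (h i Logic.I)].
apply: fin_bigcap_measurable => // i _.
by rewrite -[X in measurable X]setTI; exact: measurable_coord.
Qed.

Lemma measurable_qbox q k : measurable (qbox q k).
Proof.
apply: (@measurable_coord_set (fun i => [set t | `|t - ratr (q 0 i)| < k.+1%:R^-1])) => i.
rewrite (_ : [set _ | _] = `]ratr (q 0 i) - k.+1%:R^-1, ratr (q 0 i) + k.+1%:R^-1[%classic) //.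
by apply/seteqP; split => t /=; rewrite in_itv /= ltr_distl.
Qed.

(** An open set is the union of the countably many rational cubes it contains: a cube of half-side 1
    / (k + 1) < e / 2 whose centre is that close to x lies in the ball of radius e about x. Pairs
    (q, k) whose cube is not contained in O are assigned the empty set. *)
Lemma open_measurable_rV (O : set 'rV[R]_n) : open O -> measurable O.
Proof.
move=> oO.
pose U m := if @unpickle ('rV[rat]_n * nat)%type m is Some qk then
  (if `[< qbox qk.1 qk.2 `<=` O >] then qbox qk.1 qk.2 else set0) else set0.
have -> : O = \bigcup_m U m.
  apply/seteqP; split => [x Ox|x [m _]]; last first.
    by rewrite /U; case: unpickle => // -[q k]; case: asboolP => // + qx; exact.
  have /nbhs_ballP[e /= e0 eO] : nbhs x O by exact: open_nbhs_nbhs.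
  have [k ke] : exists k, k.+1%:R^-1 < e / 2.
    have e20 : 0 < e / 2 by rewrite divr_gt0.
    exists (Num.truncn (e / 2)^-1); rewrite -[ltRHS]invrK ltf_pV2 ?posrE ?invr_gt0 //.
    exact: truncnS_gt.
  have k0 : 0 < k.+1%:R^-1 :> R by rewrite invr_gt0.
  have xi i : exists q, `|x 0 i - ratr q| < k.+1%:R^-1.
    have [q] := rat_in_itvoo (ltr_pwDr k0 (lexx (x 0 i))).
    rewrite in_itv /= => /andP[h1 h2]; exists q.
    by rewrite ltr_distlC; apply/andP; split => //; rewrite ltrBlDr (lt_trans h1) // ltrDl.
  pose q := \row_i xchoose (xi i).
  have qP i : `|x 0 i - ratr (q 0 i)| < k.+1%:R^-1 by rewrite mxE; exact: (xchooseP (xi i)).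
  exists (pickle (q, k)) => //; rewrite /U pickleK /=; case: asboolP => //; case.
  move=> y yq; apply: eO; rewrite -ball_normE /=.
  apply: (@le_lt_trans _ _ (k.+1%:R^-1 + k.+1%:R^-1)).
    apply: norm_le_coord => [|i]; first by rewrite addr_ge0 // ltW.
    rewrite !mxE (_ : _ - _ = x 0 i - ratr (q 0 i) - (y 0 i - ratr (q 0 i))); last by ring.
    by rewrite (le_trans (ler_normB _ _)) // lerD // ltW.
  by rewrite -[e](divfK (_ : 2 != 0)) // mulr_natr mulr2n ltrD.
apply: bigcup_measurable => m _; rewrite /U; case: unpickle => // -[q k].
by case: asboolP => // _; exact: measurable_qbox.
Qed.

Lemma continuous_measurable_rV (f : 'rV[R]_n -> R) : continuous f -> measurable_fun setT f.
Proof.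
move=> fc; apply: (measurability _ (RGenOpens.measurableE R)).
move=> _ [_ [a [b ->]] <-]; rewrite setTI; apply: open_measurable_rV.
by move/continuousP : fc; apply; exact: interval_open.
Qed.

End measurable_rV.

Lemma sigma_finite_lebesgue_rV (R : realType) n :
  sigma_finite setT (@lebesgue_rV R n).
Proof.
exists (fun k : nat => [set x : 'rV[R]_n | forall i,
    (- const_mx k%:R : 'rV[R]_n) 0 i <= x 0 i <= (const_mx k%:R : 'rV[R]_n) 0 i]).
  apply/esym/seteqP; split => // x _.
  exists (Num.truncn `|x|).+1 => //= i; rewrite !mxE -ler_norml.
  by rewrite (le_trans (coord_le_norm _ _)) // ltW // truncnS_gt.
move=> k; split.
  apply: (@measurable_coord_set _ _ (fun i => [set t | (- const_mx k%:R : 'rV[R]_n) 0 i <= t <=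
    (const_mx k%:R : 'rV[R]_n) 0 i])) => i.
  by rewrite -(_ : `[(- const_mx k%:R : 'rV[R]_n) 0 i, (const_mx k%:R : 'rV[R]_n) 0 i]%classic
    = [set t | _]) //; apply/seteqP; split => t /=; rewrite in_itv.
rewrite lebesgue_rV_box ?ltry // => i; rewrite !mxE.
by rewrite (le_trans (_ : _ <= 0)) ?oppr_le0.
Qed.

HB.instance Definition _ (R : realType) n :=
  @Measure_isSigmaFinite.Build _ _ _ (@lebesgue_rV R n) (@sigma_finite_lebesgue_rV R n).

(** * Fubini's theorem and integrability on cubes *)

Section fubini_rV.
Context {R : realType} {n : nat}.
Local Open Scope ereal_scope.
Local Notation mu := (@lebesgue_rV R n).
Local Notation leb := (@lebesgue_measure R).

Lemma ge0_integral_rVS (f : 'rV[R]_n.+1 -> \bar R) : measurable_fun setT f ->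
  (forall x, 0 <= f x) ->
  \int[lebesgue_rV]_x f x = \int[mu \x leb]_z f (rV_cons z).
Proof.
move=> mf f0.
have := @ge0_integral_pushforward _ _ ('rV[R]_n * measurableTypeR R)%type _ R (@rV_cons R n) (@measurable_rV_cons R n)
  (mu \x leb) setT f measurableT mf (fun y _ => f0 y).
by rewrite preimage_setT => <-.
Qed.

Lemma integrable_rVS (f : 'rV[R]_n.+1 -> \bar R) :
  lebesgue_rV.-integrable setT f -> (mu \x leb).-integrable setT (f \o @rV_cons R n).
Proof.
move=> /integrableP[mf fi]; apply/integrableP; split.
  by apply: measurableT_comp => //; exact: measurable_rV_cons.
have mf' : measurable_fun setT (fun x => `|f x|) by exact: measurableT_comp.
by rewrite -(ge0_integral_rVS mf').
Qed.

Lemma integral_rVS (f : 'rV[R]_n.+1 -> \bar R) : lebesgue_rV.-integrable setT f ->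
  \int[lebesgue_rV]_x f x = \int[mu \x leb]_z f (rV_cons z).
Proof.
move=> fi; have mf := measurable_int _ fi.
have := @integral_pushforward _ _ ('rV[R]_n * measurableTypeR R)%type _ R (@rV_cons R n) (@measurable_rV_cons R n)
  (mu \x leb) setT f mf (integrable_rVS fi) measurableT.
by rewrite preimage_setT => <-.
Qed.

Lemma integral_rVS1 (f : 'rV[R]_n.+1 -> \bar R) : lebesgue_rV.-integrable setT f ->
  \int[lebesgue_rV]_x f x = \int[mu]_x \int[leb]_t f (rV_cons (x, t)).
Proof. by move=> fi; rewrite integral_rVS // -(integral12_prod_meas1 (integrable_rVS fi)). Qed.

Lemma integral_rVS2 (f : 'rV[R]_n.+1 -> \bar R) : lebesgue_rV.-integrable setT f ->
  \int[lebesgue_rV]_x f x = \int[leb]_t \int[mu]_x f (rV_cons (x, t)).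
Proof. by move=> fi; rewrite integral_rVS // -(integral21_prod_meas1 (integrable_rVS fi)). Qed.

End fubini_rV.

Section boxes.
Context {R : realType} {n : nat}.
Local Notation mu := (@lebesgue_rV R n).

Definition cube (c : R) : set 'rV[R]_n := [set x | forall i, `|x 0 i| <= c].

Lemma cubeE (c : R) : 0 <= c -> cube c = [set x | `|x| <= c].
Proof.
move=> c0; apply/seteqP; split => x /= h; first exact: norm_le_coord.
by move=> i; apply: le_trans h; exact: coord_le_norm.
Qed.

Lemma measurable_cube c : measurable (cube c).
Proof.
apply: (@measurable_coord_set _ _ (fun=> [set t | `|t| <= c])) => i.
rewrite (_ : [set _ | _] = `[- c, c]%classic) //.
by apply/seteqP; split => t /=; rewrite in_itv /= ler_norml.
Qed.

Lemma cube_fin c : 0 <= c -> (mu (cube c) < +oo)%E.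
Proof.
move=> c0; rewrite (_ : cube c = [set x : 'rV[R]_n | forall i,
    (const_mx (- c) : 'rV[R]_n) 0 i <= x 0 i <= (const_mx c : 'rV[R]_n) 0 i]).
  by rewrite lebesgue_rV_box ?ltry // => i; rewrite !mxE; lra.
by apply/seteqP; split => x /= h i; have := h i; rewrite !mxE ler_norml.
Qed.

Lemma compact_cube c : 0 <= c -> compact (cube c).
Proof.
move=> c0; apply: bounded_closed_compact.
  exists c; split; first exact: num_real.
  by move=> M cM x xc; apply: ltW; apply: le_lt_trans cM; exact: norm_le_coord.
rewrite cubeE // (_ : [set x | _] = (fun x : 'rV[R]_n => `|x|) @^-1` [set t | t <= c]) //.
apply: preimage_closed; last exact: closed_le.
by move=> x _; exact: norm_continuous.
Qed.

Lemma continuous_bounded (f : 'rV[R]_n -> R) (A : set 'rV[R]_n) :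
  continuous f -> compact A -> exists2 M : R, 0 <= M & forall x, A x -> `|f x| <= M.
Proof.
move=> fc Ac; have [->|/set0P A0] := eqVneq A set0; first by exists 0.
have nfc : continuous (fun x => `|f x|).
  by move=> x; apply: continuous_comp; [exact: fc|exact: norm_continuous].
have [x Ax xM] := @EVT_max_rV R n (fun x => `|f x|) A A0 Ac (continuous_subspaceT nfc).
by exists `|f x| => // y Ay; apply: xM; exact: mem_set.
Qed.

Lemma bounded_integrable (D : set 'rV[R]_n) (f : 'rV[R]_n -> R) (M : R) :
  measurable D -> (mu D < +oo)%E -> measurable_fun D f ->
  (forall x, D x -> `|f x| <= M) -> mu.-integrable D (EFin \o f).
Proof.
move=> mD Dfin mf fM; apply: measurable_bounded_integrable => //.
exists M; split; first exact: num_real.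
by move=> N MN x Dx; apply: le_trans (fM _ Dx) (ltW MN).
Qed.

Lemma continuous_compact_support_integrable (f : 'rV[R]_n -> R) c : 0 <= c ->
  continuous f -> (forall x, ~ cube c x -> f x = 0) ->
  mu.-integrable setT (EFin \o f).
Proof.
move=> c0 fc f0.
have [M M0 fM] := continuous_bounded fc (compact_cube c0).
rewrite (_ : EFin \o f = (EFin \o f) \_ (cube c)); last first.
  apply/funext => x /=; rewrite patchE; case: ifPn => //.
  by rewrite notin_setE => /f0 ->.
apply: (integrable_mkcond (EFin \o f) (measurable_cube c)).1.
apply: (@bounded_integrable _ _ M (measurable_cube c) (cube_fin c0)) => //.
by apply: measurable_funTS; exact: continuous_measurable_rV.
Qed.

End boxes.

(** * Integrals of derivatives of compactly supported functions *)

Section divergence.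
Context {R : realType}.

Lemma line_coord n (h : R) (j : 'I_n) (x : 'rV[R]_n) i :
  (h *: delta_mx 0 j + x) 0 i = h * (i == j)%:R + x 0 i.
Proof. by rewrite !mxE. Qed.

Lemma rV_consD0 n (y : 'rV[R]_n) (t h : R) :
  rV_cons (y, h + t) = h *: delta_mx 0 ord0 + rV_cons (y, t).
Proof.
apply/rowP => i; rewrite line_coord; have [j ->|->] := unliftP ord0 i.
  by rewrite !rV_consS /= mulr0 add0r.
by rewrite !rV_cons0 /= mulr1.
Qed.

Lemma rV_consDS n (y : 'rV[R]_n) (t h : R) (j : 'I_n) :
  rV_cons (h *: delta_mx 0 j + y, t) = h *: delta_mx 0 (lift ord0 j) + rV_cons (y, t).
Proof.
apply/rowP => i; rewrite line_coord; have [k ->|->] := unliftP ord0 i.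
  by rewrite !rV_consS line_coord (inj_eq lift_inj).
by rewrite !rV_cons0 /= mulr0 add0r.
Qed.

Lemma continuous_rV_consl n (f : 'rV[R]_n.+1 -> R) (t : R) : continuous f ->
  continuous (fun y : 'rV[R]_n => f (rV_cons (y, t))).
Proof.
move=> fc; apply: (@continuous_comp_rV _ _ _ (fun y => rV_cons (y, t))) => // i.
have [j ->|->] := unliftP ord0 i.
  by under eq_fun do rewrite rV_consS; exact: coord_continuous.
by under eq_fun do rewrite rV_cons0; exact: cst_continuous.
Qed.

Lemma continuous_line n (f : 'rV[R]_n -> R) (v x : 'rV[R]_n) : continuous f ->
  continuous (fun t : R => f (t *: v + x)).
Proof.
move=> fc t; apply: (@continuous_comp _ _ _ (fun t : R => t *: v + x) f); last exact: fc.
by apply: cvgD; [exact: scalel_continuous|exact: cvg_cst].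
Qed.

Lemma integral_derive0 (f df : R -> R) (c : R) : 0 < c ->
  (forall t : R, is_derive t (1 : R) f (df t)) -> continuous df ->
  (forall t, c <= `|t| -> f t = 0) -> (forall t, c < `|t| -> df t = 0) ->
  (\int[lebesgue_measure]_t (df t)%:E = 0)%E.
Proof.
move=> c0 fd dc f0 df0.
have cc : - c < c by lra.
have fc : continuous f.
  by move=> t; apply/differentiable_continuous/derivable1_diffP; case: (fd t).
transitivity (\int[lebesgue_measure]_(t in `[(- c)%R, c]) (df t)%:E)%E.
  rewrite [RHS]integral_mkcond; apply: eq_integral => t _.
  rewrite patchE; case: ifPn => //; rewrite notin_setE /= in_itv /= -ler_norml.
  by move=> /negP; rewrite -ltNge => /df0 ->.
rewrite (@continuous_FTC2 _ df f) //.
- rewrite !f0 ?subee // ?normrN ?ger0_norm //; exact: ltW.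
- exact: continuous_subspaceT.
- split.
  + by move=> t _; case: (fd t).
  + by apply: cvg_at_right_filter; exact: fc.
  + by apply: cvg_at_left_filter; exact: fc.
- by move=> t _; rewrite derive1E; case: (fd t).
Qed.

Lemma derive_eq0_far n (F : 'rV[R]_n -> R) (v x : 'rV[R]_n) (c : R) i :
  (forall y : 'rV[R]_n, (exists i, c <= `|y 0 i|) -> F y = 0) -> c < `|x 0 i| ->
  'D_v F x = 0.
Proof.
move=> F0 cx; rewrite (@near_eq_derive _ _ _ _ (cst 0)) ?derive_cst //.
have xc : continuous (fun y : 'rV[R]_n => `|y 0 i|).
  by move=> y; apply: continuous_comp; [exact: coord_continuous|exact: norm_continuous].
have H : nbhs x [set y : 'rV[R]_n | c < `|y 0 i|].
  exact: (cvgr_gt (`|x 0 i|) (xc x) c cx).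
by apply: filterS H => y cy; rewrite F0 //; exists i; exact: ltW.
Qed.

(** Induction on the dimension by Fubini's theorem. If j is the first coordinate, the inner integral
    is taken along it and vanishes by the fundamental theorem of calculus; otherwise the slices with
    fixed first coordinate satisfy the same hypotheses in dimension n. *)
Lemma integral_partial0 n (j : 'I_n) (F : 'rV[R]_n -> R) (c : R) : 0 < c ->
  (forall x, derivable F x (delta_mx 0 j)) -> continuous (partial j F) ->
  (forall x : 'rV[R]_n, (exists i, c <= `|x 0 i|) -> F x = 0) ->
  (\int[lebesgue_rV]_x (partial j F x)%:E = 0)%E.
Proof.
move=> c0; elim: n j F => [[]//|n IH] j F Fd Fc F0.
have Fi : lebesgue_rV.-integrable setT (EFin \o partial j F).
  apply: (@continuous_compact_support_integrable _ _ _ c (ltW c0)) => // x.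
  move=> /existsNP[i] /negP; rewrite -ltNge => xi.
  exact: (derive_eq0_far _ F0 xi).
have [k jE|jE] := unliftP ord0 j; last first.
  rewrite (integral_rVS1 Fi); apply: integral0_eq => y _ /=.
  have E t : rV_cons (y, t) = t *: delta_mx 0 ord0 + rV_cons (y, 0).
    by rewrite -rV_consD0 addr0.
  under eq_integral do rewrite E.
  apply: (@integral_derive0 (fun t => F (t *: delta_mx 0 ord0 + rV_cons (y, 0)))
    (fun t => partial j F (t *: delta_mx 0 ord0 + rV_cons (y, 0))) c) => //.
  - move=> t; apply/is_derive_lineP; rewrite /partial jE; split => //.
    by rewrite -jE; exact: Fd.
  - exact: continuous_line.
  - move=> t ct; apply: F0; exists ord0; by rewrite -E rV_cons0.
  - by move=> t ct; apply: (@derive_eq0_far _ _ _ _ c ord0) => //; rewrite -E rV_cons0.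
rewrite (integral_rVS2 Fi); apply: integral0_eq => t _ /=.
pose G y := F (rV_cons (y, t)).
have E y : (fun h : R => h^-1 *: ((F \o shift (rV_cons (y, t))) (h *: delta_mx 0 j)
      - F (rV_cons (y, t)))) =
    (fun h : R => h^-1 *: ((G \o shift y) (h *: delta_mx 0 k) - G y)).
  by apply/funext => h; rewrite /G /= rV_consDS jE.
have pE y : partial j F (rV_cons (y, t)) = partial k G y.
  by rewrite /partial /derive E.
under eq_integral do rewrite pE.
apply: IH.
- by move=> y; have := Fd (rV_cons (y, t)); rewrite /derivable E.
- rewrite (_ : partial _ _ = fun y => partial j F (rV_cons (y, t))).
    exact: continuous_rV_consl.
  by apply/funext => y; rewrite pE.
- by move=> y [i ci]; apply: F0; exists (lift ord0 i); rewrite rV_consS.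
Qed.

End divergence.

(** * Functions on the unit ball *)

Section ball.
Context {R : realType} {n : nat}.
Local Notation mu := (@lebesgue_rV R n).
Local Notation B := (@unit_ball R n).
Implicit Types (x : 'rV[R]_n) (f : 'rV[R]_n -> R).

(** Stands in for the length wherever smoothness at the origin matters. *)
Definition nsq x : R := \sum_i x 0 i ^+ 2.

Lemma nsqE x : nsq x = enorm x ^+ 2.
Proof. by rewrite enorm_sqr. Qed.

Lemma nsq_ge0 x : 0 <= nsq x.
Proof. by apply: sumr_ge0 => i _; exact: sqr_ge0. Qed.

Lemma Ck_nsq k : Ck k nsq.
Proof. by apply: Ck_sum => i _; apply: CkX; exact: Ck_coord. Qed.

Lemma partial_nsq j x : partial j nsq x = 2 * x 0 j.
Proof.
have d i : is_derive x (delta_mx 0 j) (fun y : 'rV[R]_n => y 0 i ^+ 2) (2 * x 0 i * (i == j)%:R).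
  have h := is_derive_coord i (delta_mx 0 j) x; rewrite mxE eqxx /= in h.
  by have := is_deriveX 2 h => /is_derive_eq; apply; rewrite expr1.
have := is_derive_sum d; rewrite /partial => -[_ E].
have -> : nsq = \sum_(i < n) (fun y : 'rV[R]_n => y 0 i ^+ 2).
  by apply/funext => y; rewrite fct_sumE.
rewrite E (bigD1 j) //= eqxx mulr1 big1 ?addr0 // => i /negbTE ->.
by rewrite mulr0.
Qed.

Lemma unit_ballE x : B x <-> nsq x < 1.
Proof.
rewrite nsqE /unit_ball /=; split => h.
  by rewrite expr_lt1 ?enorm_ge0.
by rewrite -(expr_lt1 (n := 2)) ?enorm_ge0.
Qed.

Lemma coord_sqr_le x i : x 0 i ^+ 2 <= nsq x.
Proof.
by rewrite /nsq (bigD1 i) //= lerDl; apply: sumr_ge0 => k _; exact: sqr_ge0.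
Qed.

Lemma coord_le_enorm x i : `|x 0 i| <= enorm x.
Proof.
by rewrite -[leLHS]sqrtr_sqr ler_sqrt ?nsq_ge0 // coord_sqr_le.
Qed.

Lemma norm_le_enorm x : `|x| <= enorm x.
Proof. by apply: norm_le_coord; [exact: enorm_ge0|move=> i; exact: coord_le_enorm]. Qed.

Lemma enorm_continuous : continuous (@enorm R n).
Proof.
move=> x; apply: (@continuous_comp _ _ _ nsq Num.sqrt); last exact: sqrt_continuous.
exact: (Ck_continuous (Ck_nsq 0)).
Qed.

Lemma mball : measurable B. Proof. exact: measurable_unit_ball. Qed.

Lemma ball_subset_cube : B `<=` cube 1.
Proof. by move=> x xB i; apply: le_trans (coord_le_enorm x i) (ltW xB). Qed.

Lemma ball_fin : (mu B < +oo)%E.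
Proof.
apply: le_lt_trans (cube_fin (n := n) (@ler01 R)).
exact: (le_measure mu (mem_set mball) (mem_set (measurable_cube 1)) ball_subset_cube).
Qed.

Lemma compact_closed_ball (c : R) : compact [set x : 'rV[R]_n | enorm x <= c].
Proof.
apply: bounded_closed_compact.
  exists c; split; first exact: num_real.
  move=> M cM x /= xc; apply: ltW; apply: le_lt_trans cM; apply: le_trans xc.
  exact: norm_le_enorm.
rewrite (_ : [set x | _] = (@enorm R n) @^-1` [set t | t <= c]) //.
apply: preimage_closed; last exact: closed_le.
by move=> x _; exact: enorm_continuous.
Qed.

Lemma continuous_ball_bounded f : continuous f -> exists2 M : R, 0 <= M &
  forall x, enorm x <= 1 -> `|f x| <= M.
Proof.
move=> fc; have [M M0 fM] := continuous_bounded fc (@compact_closed_ball 1).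
by exists M => // x x1; exact: fM.
Qed.

Lemma ball_bounded_integrable f (M : R) : measurable_fun B f ->
  (forall x, B x -> `|f x| <= M) -> mu.-integrable B (EFin \o f).
Proof. exact: bounded_integrable mball ball_fin. Qed.

Lemma continuous_ball_integrable f : continuous f -> mu.-integrable B (EFin \o f).
Proof.
move=> fc; have [M _ fM] := continuous_ball_bounded fc.
apply: (@ball_bounded_integrable _ M); last by move=> x /ltW/fM.
by apply: measurable_funTS; exact: continuous_measurable_rV.
Qed.

Lemma near_nsq_gt x (c : R) : c < nsq x -> \forall y \near x, c < nsq y.
Proof.
move=> cx; have H : nbhs x [set y | c < nsq y].
  exact: (cvgr_gt (nsq x) (Ck_continuous (Ck_nsq 0) x) c cx).
exact: H.
Qed.

Lemma partial_eq_far f g j x (r : R) : (forall y, r <= nsq y -> f y = g y) ->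
  r < nsq x -> partial j f x = partial j g x.
Proof.
move=> fg rx; apply: near_eq_derive.
by apply: filterS (near_nsq_gt rx) => y /ltW; exact: fg.
Qed.

(** As f vanishes near the sphere and beyond, the integral is one over the whole space, where f has
    compact support. *)
Lemma ball_div j f (r : R) : r < 1 -> Ck 1 f -> (forall x, r <= nsq x -> f x = 0) ->
  \int[mu]_(x in B) partial j f x = 0.
Proof.
move=> r1 f1 f0.
have p0 x : r < nsq x -> partial j f x = 0.
  by move=> rx; rewrite (@partial_eq_far _ (cst 0) _ _ r) ?partial_cst.
rewrite /Rintegral (_ : integral _ _ _ = 0%E) //.
rewrite integral_mkcond -[RHS](@integral_partial0 R n j f 1 ltr01).
- apply: eq_integral => x _; rewrite patchE; case: ifPn => //.
  rewrite notin_setE => /unit_ballE/negP; rewrite -leNgt => x1.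
  by rewrite p0 //; exact: lt_le_trans x1.
- by move=> x; exact: Ck_derivable f1.
- exact: (Ck_continuous (Ck_partial j f1)).
- move=> x [i xi]; apply: f0; apply: (le_trans (ltW r1)).
  by rewrite (le_trans _ (coord_sqr_le x i)) // -real_normK ?num_real // exprn_ege1.
Qed.

End ball.

Section Rintegral_extra.
Context d (T : measurableType d) (R : realType) (mu : {measure set T -> \bar R}) (D : set T).
Hypothesis mD : measurable D.

Lemma integrable_fin_sum (I : Type) (r : seq I) (P : pred I) (F : I -> T -> R) :
  (forall i, P i -> mu.-integrable D (EFin \o F i)) ->
  mu.-integrable D (EFin \o (fun x => \sum_(i <- r | P i) F i x)).
Proof.
move=> Fi; elim: r => [|i r IH].
  by under eq_fun do rewrite big_nil; apply: integrable0.
case Pi : (P i); under eq_fun do rewrite big_cons Pi; last by [].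
exact: (integrableD mD (Fi i Pi) IH).
Qed.

Lemma Rintegral_fin_sum (I : Type) (r : seq I) (P : pred I) (F : I -> T -> R) :
  (forall i, P i -> mu.-integrable D (EFin \o F i)) ->
  \int[mu]_(x in D) (\sum_(i <- r | P i) F i x) =
  \sum_(i <- r | P i) \int[mu]_(x in D) F i x.
Proof.
move=> Fi; elim: r => [|i r IH].
  rewrite big_nil; under eq_Rintegral do rewrite big_nil.
  by rewrite /Rintegral integral0.
rewrite big_cons; under eq_Rintegral do rewrite big_cons; case Pi : (P i) => //.
rewrite -IH -RintegralD //; first exact: Fi.
exact: integrable_fin_sum.
Qed.

End Rintegral_extra.

(** * A null Lagrangian *)

Section lagrangian.
Context {R : realType} {n : nat}.

(** The minors have size p = [q.+1]; [c] and [g] stand for the values of phi and of its gradient,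
    and the replaced copy of A is the one that supplies row [ord0]. *)
Definition lag q (c : R) (g u : 'rV[R]_n) (A : 'M[R]_n) : R :=
  c * mdisc (fun _ : 'I_q.+1 => A) +
  mdisc (fun a : 'I_q.+1 => if a == ord0 then u^T *m g else A).

Lemma lagE q c g u A : lag q c g u A =
  \sum_(s : 'S_q.+1) \sum_(f : {ffun 'I_q.+1 -> 'I_n}) (-1) ^+ s *
    (c * \prod_a A (f a) (f (s a)) + u 0 (f ord0) * g 0 (f (s ord0)) *
      \prod_(a < q) A (f (lift ord0 a)) (f (s (lift ord0 a)))).
Proof.
rewrite /lag !mdiscE mulr_sumr -big_split /=; apply: eq_bigr => s _.
rewrite mulrCA -mulrDr mulr_sumr -big_split mulr_sumr /=; apply: eq_bigr => f _.
congr (_ * (_ + _)); rewrite big_ord_recl eqxx; congr (_ * _).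
by rewrite !mxE big_ord1 mxE.
Qed.

Definition jac (U : 'rV[R]_n -> 'rV[R]_n) (x : 'rV[R]_n) : 'M[R]_n :=
  \matrix_(i, k) partial k (component U i) x.

Definition grad (phi : 'rV[R]_n -> R) (x : 'rV[R]_n) : 'rV[R]_n :=
  \row_k partial k phi x.

Lemma is_derive_prod q (F : 'I_q -> 'rV[R]_n -> R) (dF : 'I_q -> R) x v :
  (forall a, is_derive x v (F a) (dF a)) ->
  is_derive x v (fun y => \prod_a F a y)
    (\sum_l dF l * \prod_(a | a != l) F a x).
Proof.
elim: q F dF => [|q IH] F dF Fd.
  rewrite big_ord0 (_ : (fun y => _) = cst 1); first exact: is_derive_cst.
  by apply/funext => y; rewrite big_ord0.
rewrite (_ : (fun y => _) = F ord0 * (fun y => \prod_(a < q) F (lift ord0 a) y)); last first.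
  by apply/funext => y; rewrite big_ord_recl.
have := is_deriveM (Fd ord0) (IH _ _ (fun a => Fd (lift ord0 a))).
move=> /is_derive_eq; apply.
rewrite [RHS]big_ord_recl addrC; congr (_ + _).
  rewrite [LHS]mulrC; congr (_ * _).
  rewrite [RHS]big_mkcond big_ord_recl eqxx /= mul1r.
  by apply: eq_bigr => a _.
rewrite [LHS]mulr_sumr; apply: eq_bigr => l _; rewrite mulrCA; congr (_ * _).
by rewrite [RHS]big_mkcond big_ord_recl /= [in LHS]big_mkcond /=; congr (_ * _).
Qed.

Section flux.
Variables (q : nat) (phi : 'rV[R]_n -> R).
Hypothesis phi1 : Ck 1 phi.
Implicit Types (U : 'rV[R]_n -> 'rV[R]_n) (s : 'S_q.+1) (f : {ffun 'I_q.+1 -> 'I_n}).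

(** One antiderivative is taken: [U] itself stands in place of its derivative in the factor [ord0].
    The Lagrangian is the signed sum of the derivatives of [phi * flux s f U] in the directions
    [f (s ord0)]. *)
Definition flux s f U x : R := component U (f ord0) x *
  \prod_(a < q) partial (f (s (lift ord0 a))) (component U (f (lift ord0 a))) x.

Lemma Ck_flux s f U : (forall i, Ck 2 (component U i)) -> Ck 1 (flux s f U).
Proof.
move=> U2; apply: CkM; first exact: CkW.
by apply: Ck_prod => a _; exact: Ck_partial.
Qed.

(** The term of the product rule in which factor l is differentiated a second time. *)
Let second s f U l x : R :=
  partial (f (s ord0)) (partial (f (s (lift ord0 l))) (component U (f (lift ord0 l)))) x *
  \prod_(a < q | a != l) partial (f (s (lift ord0 a))) (component U (f (lift ord0 a))) x.

Lemma partial_flux s f U x : (forall i, Ck 2 (component U i)) ->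
  partial (f (s ord0)) (fun y => phi y * flux s f U y) x =
  (phi x * \prod_a (jac U x) (f a) (f (s a)) +
   U x 0 (f ord0) * grad phi x 0 (f (s ord0)) *
     \prod_(a < q) (jac U x) (f (lift ord0 a)) (f (s (lift ord0 a)))) +
  phi x * U x 0 (f ord0) * \sum_l second s f U l x.
Proof.
move=> U2; set k := f (s ord0).
have dU i : is_derive x (delta_mx 0 k) (component U i) (partial k (component U i) x).
  exact: (Ck_is_derive k x (U2 i)).
have dP := is_derive_prod (fun a : 'I_q => Ck_is_derive k x (Ck_partial (f (s (lift ord0 a)))
  (U2 (f (lift ord0 a))))).
have [_] := is_deriveM (Ck_is_derive k x phi1) (is_deriveM (dU (f ord0)) dP).
rewrite /partial => ->; rewrite /GRing.scale /= big_ord_recl /jac !mxE -/k.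
under [in RHS]eq_bigr do rewrite mxE.
rewrite /second -/k /component /partial !fctE /=.
set P := \prod_(_ < q) _; set S := \sum_(_ < q) _; ring.
Qed.

(** Composing s with the transposition of [ord0] and [lift ord0 l] changes its sign and merely
    exchanges the two derivatives that fall on one component. By symmetry of second derivatives the
    sum is its own opposite. *)
Lemma second_alt f U x l : (forall i, Ck 2 (component U i)) ->
  \sum_(s : 'S_q.+1) (-1) ^+ s * second s f U l x = 0.
Proof.
move=> U2; pose t : 'S_q.+1 := tperm ord0 (lift ord0 l).
set S := \sum_s _.
suff : S = - S by move=> /eqP; rewrite -addr_eq0 -mulr2n mulrn_eq0 /= => /eqP.
rewrite {1}/S (reindex_inj (mulgI t)) /= -sumrN; apply: eq_bigr => s _.
rewrite odd_permM odd_tperm neq_lift signr_addb expr1 mulN1r mulNr; congr (- (_ * _)).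
have ta a : a != l -> (t * s)%g (lift ord0 a) = s (lift ord0 a).
  by move=> al; rewrite permM tpermD // ?neq_lift // (inj_eq lift_inj) eq_sym.
have t0 : (t * s)%g ord0 = s (lift ord0 l) by rewrite permM tpermL.
have tl : (t * s)%g (lift ord0 l) = s ord0 by rewrite permM tpermR.
pose g a := component U (f (lift ord0 a)).
have e1 : partial (f ((t * s)%g ord0)) (partial (f ((t * s)%g (lift ord0 l))) (g l)) x =
    partial (f (s ord0)) (partial (f (s (lift ord0 l))) (g l)) x.
  by rewrite t0 tl; exact: (@partial_sym R n (g l) _ _ x (U2 _)).
have e2 : \prod_(a < q | a != l) partial (f ((t * s)%g (lift ord0 a))) (g a) x =
    \prod_(a < q | a != l) partial (f (s (lift ord0 a))) (g a) x.
  by apply: eq_bigr => a al; rewrite ta.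
exact: (congr2 *%R e1 e2).
Qed.

Lemma lag_flux U x : (forall i, Ck 2 (component U i)) ->
  lag q (phi x) (grad phi x) (U x) (jac U x) =
  \sum_(s : 'S_q.+1) \sum_(f : {ffun 'I_q.+1 -> 'I_n}) (-1) ^+ s *
    partial (f (s ord0)) (fun y => phi y * flux s f U y) x.
Proof.
move=> U2; rewrite lagE.
under [RHS]eq_bigr do under eq_bigr do rewrite partial_flux // mulrDr.
under [RHS]eq_bigr do rewrite big_split /=.
rewrite big_split /= -[LHS]addr0; congr (_ + _).
rewrite exchange_big /= big1 // => f _.
under eq_bigr do rewrite mulrCA mulr_sumr.
rewrite -mulr_sumr exchange_big /= big1 ?mulr0 // => l _.
exact: second_alt.
Qed.

(** The Lagrangian is a sum of derivatives of fluxes, and near the sphere the flux of U agrees with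
    that of the identity; the derivative of the difference has integral 0. *)
Lemma lag_integral U (r : R) : r < 1 -> (forall i, Ck 2 (component U i)) ->
  (forall x, r <= nsq x -> U x = x) ->
  \int[lebesgue_rV]_(x in unit_ball) lag q (phi x) (grad phi x) (U x) (jac U x) =
  \int[lebesgue_rV]_(x in unit_ball) lag q (phi x) (grad phi x) x (jac id x).
Proof.
move=> r1 U2 Ux.
have id2 i : Ck 2 (component (id : 'rV[R]_n -> 'rV[R]_n) i) by exact: Ck_coord.
have H V : (forall i, Ck 2 (component V i)) ->
    \int[lebesgue_rV]_(x in unit_ball) lag q (phi x) (grad phi x) (V x) (jac V x) =
    \sum_(s : 'S_q.+1) \sum_(f : {ffun 'I_q.+1 -> 'I_n}) (-1) ^+ s *
    \int[lebesgue_rV]_(x in unit_ball) partial (f (s ord0)) (fun y => phi y * flux s f V y) x.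
  move=> V2; under eq_Rintegral do rewrite lag_flux //.
  have ci s f : continuous (partial (f (s ord0)) (fun y => phi y * flux s f V y)).
    by apply: (@Ck_continuous _ _ 0); apply: Ck_partial; apply: CkM => //; exact: Ck_flux.
  have ii s f := continuous_ball_integrable (ci s f).
  have ii' s f : lebesgue_rV.-integrable unit_ball (EFin \o (fun x => (-1) ^+ s *
      partial (f (s ord0)) (fun y => phi y * flux s f V y) x)).
    by apply: continuous_ball_integrable; exact: (@Ck_continuous _ _ 0 _ (CkZ _ (ci s f : Ck 0 _))).
  rewrite Rintegral_fin_sum; last 2 first.
    - exact: mball.
    - by move=> s _; apply: integrable_fin_sum => //; exact: mball.
  apply: eq_bigr => s _; rewrite Rintegral_fin_sum //; last exact: mball.
  by apply: eq_bigr => f _; rewrite RintegralZl //; exact: mball.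
apply: (etrans (H _ U2)); apply: (etrans _ (esym (H id id2))).
suff E s f :
    \int[lebesgue_rV]_(x in unit_ball) partial (f (s ord0)) (fun y => phi y * flux s f U y) x =
    \int[lebesgue_rV]_(x in unit_ball) partial (f (s ord0)) (fun y => phi y * flux s f id y) x.
  apply: eq_bigr => s _; apply: eq_bigr => f _.
  exact: (congr1 ( *%R ((-1) ^+ s)) (E s f)).
set k := f (s ord0).
pose F V y := phi y * flux s f V y.
have F1 V : (forall i, Ck 2 (component V i)) -> Ck 1 (F V).
  by move=> V2; apply: CkM => //; exact: Ck_flux.
have Fi V : (forall i, Ck 2 (component V i)) ->
    lebesgue_rV.-integrable unit_ball (EFin \o partial k (F V)).
  move=> V2; apply: continuous_ball_integrable.
  by apply: (@Ck_continuous _ _ 0); apply: Ck_partial; exact: F1.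
apply/eqP; rewrite -subr_eq0; apply/eqP.
rewrite -RintegralB //; last 3 first.
- exact: mball.
- exact: Fi.
- exact: Fi.
have F1' := CkB (F1 _ U2) (F1 _ id2).
(* The derivatives of U and of the identity are known to agree only where nsq x > r, hence the
   slightly larger radius. *)
pose r' := (r + 1) / 2.
have rr : r < r' by rewrite /r'; lra.
rewrite -[RHS](@ball_div R n k (fun y => F U y - F id y) r') //.
- apply: eq_Rintegral => x _; rewrite partialB //; apply: Ck_derivable; exact: F1.
- by rewrite /r'; lra.
- move=> x rx; rewrite /F -mulrBr /flux.
  have rx' : r < nsq x by apply: lt_le_trans rx.
  have -> : component U (f ord0) x = component id (f ord0) x.
    by rewrite /component Ux // ltW.
  rewrite -mulrBr (_ : _ - _ = 0) ?mulr0 //; apply/eqP; rewrite subr_eq0; apply/eqP.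
  apply: eq_bigr => a _; apply: (partial_eq_far _ _ rx') => y ry.
  by rewrite /component Ux.
Qed.

End flux.
End lagrangian.

(** * Differences of products *)

Section product_bounds.
Context {R : realType}.

(** Factors are exchanged one at a time; the sum of the resulting bounds x y^i (x + y)^j with i + j
    = p - 1 telescopes. *)
Lemma prod_close p (a b : 'I_p -> R) (x y : R) : 0 <= x -> 0 <= y ->
  (forall m, `|a m - b m| <= x) -> (forall m, `|b m| <= y) ->
  `|\prod_m a m - \prod_m b m| <= (x + y) ^+ p - y ^+ p.
Proof.
move=> x0 y0; elim: p a b => [|p IH] a b ab by_.
  by rewrite !big_ord0 !expr0 !subrr normr0.
have ay m : `|a m| <= x + y.
  by rewrite -[a m](subrK (b m)) (le_trans (ler_normD _ _)) // lerD.
have py : `|\prod_(m < p) a (lift ord0 m)| <= (x + y) ^+ p.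
  rewrite normr_prod -[p in leRHS]card_ord -prodr_const.
  by apply: ler_prod => i _; rewrite normr_ge0 ay.
rewrite !big_ord_recl.
set P := \prod_(_ < p) _; set Q := \prod_(_ < p) _.
rewrite (_ : _ - _ = (a ord0 - b ord0) * P + b ord0 * (P - Q)); last by ring.
apply: (le_trans (ler_normD _ _)); rewrite !normrM.
have h1 : `|a ord0 - b ord0| * `|P| <= x * (x + y) ^+ p by apply: ler_pM.
have h2 : `|b ord0| * `|P - Q| <= y * ((x + y) ^+ p - y ^+ p).
  by apply: ler_pM => //; exact: (IH (fun m => a (lift ord0 m)) (fun m => b (lift ord0 m))).
apply: (le_trans (lerD h1 h2)).
by rewrite !exprS le_eqVlt; apply/orP; left; apply/eqP; ring.
Qed.

(** By convexity on [0, 1], (1 + t)^p lies below its chord 1 + t (2^p - 1). *)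
Lemma onem_expr_le (t : R) p : 0 <= t -> t <= 1 -> (1 + t) ^+ p <= 1 + t * 2 ^+ p.
Proof.
move=> t0 t1; apply: (@le_trans _ _ (1 + t * (2 ^+ p - 1))); last first.
  by rewrite lerD2l ler_wpM2l // lerBlDr lerDl.
elim: p => [|p IH]; first by rewrite !expr0 subrr mulr0 addr0.
rewrite exprS; apply: (le_trans (ler_wpM2l _ IH)); first by rewrite addr_ge0.
have h : 0 <= 2 ^+ p - 1 :> R by rewrite subr_ge0 exprn_ege1 // ler1n.
have : t * t * (2 ^+ p - 1) <= t * (2 ^+ p - 1) by rewrite ler_wpM2r // ler_piMr.
by rewrite exprS; set P := 2 ^+ p; lra.
Qed.

(** If x <= t y, the left side is at most ((1 + t)^p - 1) y^p, and t is chosen so small that this is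
    at most e y^p. Otherwise y <= x / t and everything is controlled by x^p. *)
Lemma pow_split p (e : R) : 0 < e -> exists2 C : R, 0 <= C &
  forall x y : R, 0 <= x -> 0 <= y -> (x + y) ^+ p - y ^+ p <= e * y ^+ p + C * x ^+ p.
Proof.
move=> e0; pose t := Num.min 1 (e / 2 ^+ p).
have p2 : 0 < 2 ^+ p :> R by rewrite exprn_gt0.
have t0 : 0 < t by rewrite lt_min ltr01 divr_gt0.
have t1 : t <= 1 by rewrite ge_min lexx.
have te : t * 2 ^+ p <= e by rewrite -ler_pdivlMr // ge_min lexx orbT.
have it0 : 0 <= t^-1 by rewrite invr_ge0 ltW.
exists ((1 + t^-1) ^+ p) => [|x y x0 y0]; first by rewrite exprn_ge0 // addr_ge0.
have xp : 0 <= x ^+ p by rewrite exprn_ge0.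
have yp : 0 <= y ^+ p by rewrite exprn_ge0.
have [xy|yx] := leP x (t * y).
  have : (x + y) ^+ p <= (1 + t) ^+ p * y ^+ p.
    have ty : 0 <= (1 + t) * y by rewrite mulr_ge0 // addr_ge0 // ltW.
    by rewrite -exprMn lerXn2r ?nnegrE ?addr_ge0 //; lra.
  move/le_trans => /(_ _ (ler_wpM2r yp (onem_expr_le p (ltW t0) t1))) h.
  have : t * 2 ^+ p * y ^+ p <= e * y ^+ p by rewrite ler_wpM2r.
  have : 0 <= (1 + t^-1) ^+ p * x ^+ p by rewrite mulr_ge0 // exprn_ge0 // addr_ge0.
  by move: h; rewrite mulrDl mul1r; lra.
have yx' : y <= t^-1 * x by rewrite mulrC ler_pdivlMr // mulrC ltW.
have : (x + y) ^+ p <= (1 + t^-1) ^+ p * x ^+ p.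
  have tx : 0 <= (1 + t^-1) * x by rewrite mulr_ge0 // addr_ge0.
  by rewrite -exprMn lerXn2r ?nnegrE ?addr_ge0 //; lra.
have : 0 <= e * y ^+ p by rewrite mulr_ge0 // ltW.
lra.
Qed.

Lemma bigmax_expr_le p (F : 'I_p.+1 -> R) : (forall m, 0 <= F m) ->
  0 <= \big[Num.max/0]_m F m /\
  (\big[Num.max/0]_m F m) ^+ p.+1 <= \sum_m F m ^+ p.+1.
Proof.
move=> F0; have S0 : 0 <= \sum_m F m ^+ p.+1 by apply: sumr_ge0 => m _; rewrite exprn_ge0.
apply: (big_ind (fun z => 0 <= z /\ z ^+ p.+1 <= \sum_m F m ^+ p.+1)).
- by rewrite expr0n /=.
- by move=> x y [x0 xS] [y0 yS]; rewrite /Num.max; case: ifP.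
- move=> m _; split=> //; rewrite (bigD1 m) //= lerDl.
  by apply: sumr_ge0 => k _; rewrite exprn_ge0.
Qed.

(** Once integrated, this does the work of Hoelder's inequality: a product of p functions depends
    continuously in L^1 on its factors in L^p. *)
Lemma prod_close_sum p (e : R) : 0 < e -> exists2 C : R, 0 <= C &
  forall a b : 'I_p.+1 -> R, `|\prod_m a m - \prod_m b m| <=
    e * \sum_m `|b m| ^+ p.+1 + C * \sum_m `|a m - b m| ^+ p.+1.
Proof.
move=> e0; have [C C0 H] := pow_split p.+1 e0; exists C => // a b.
have [x0 xS] := bigmax_expr_le (fun m => normr_ge0 (a m - b m)).
have [y0 yS] := bigmax_expr_le (fun m => normr_ge0 (b m)).
set x := \big[_/_]_ _ _ in x0 xS; set y := \big[_/_]_ _ _ in y0 yS.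
apply: (le_trans (prod_close x0 y0 _ _)).
- by move=> m; exact: (le_bigmax _ (fun m => `|a m - b m|)).
- by move=> m; exact: (le_bigmax _ (fun m => `|b m|)).
apply: (le_trans (H _ _ x0 y0)); apply: lerD; rewrite ler_wpM2l //; exact: ltW.
Qed.

Lemma prod_le_sum p (b : 'I_p.+1 -> R) : `|\prod_m b m| <= \sum_m `|b m| ^+ p.+1.
Proof.
have [y0 yS] := bigmax_expr_le (fun m => normr_ge0 (b m)).
move: y0 yS (fun m => le_bigmax (0 : R) (fun m => `|b m|) m).
move: (\big[Num.max/0]_m `|b m|) => y y0 yS yb.
apply: le_trans yS; rewrite normr_prod -[X in _ ^+ X]card_ord -prodr_const.
by apply: ler_prod => i _; rewrite normr_ge0 yb.
Qed.

Lemma exprD_le p (a b : R) : 0 <= a -> 0 <= b ->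
  (a + b) ^+ p <= 2 ^+ p * (a ^+ p + b ^+ p).
Proof.
move=> a0 b0; have ap : 0 <= a ^+ p by rewrite exprn_ge0.
have bp : 0 <= b ^+ p by rewrite exprn_ge0.
have p2 : 0 <= 2 ^+ p :> R by rewrite exprn_ge0.
have [ab|ba] := leP a b.
  apply: (@le_trans _ _ ((2 * b) ^+ p)); last first.
    by rewrite exprMn ler_wpM2l // lerDr.
  by rewrite lerXn2r ?nnegrE ?addr_ge0 ?mulr_ge0 //; lra.
apply: (@le_trans _ _ ((2 * a) ^+ p)); last first.
  by rewrite exprMn ler_wpM2l // lerDl.
by rewrite lerXn2r ?nnegrE ?addr_ge0 ?mulr_ge0 //; lra.
Qed.

Lemma cvg_fin_sum (I : Type) (r : seq I) (P : pred I) (f : I -> nat -> R) (l : I -> R) :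
  (forall i, P i -> f i k @[k --> \oo] --> l i) ->
  \sum_(i <- r | P i) f i k @[k --> \oo] --> \sum_(i <- r | P i) l i.
Proof.
move=> fl; elim: r => [|i r IH].
  by under eq_fun do rewrite big_nil; rewrite big_nil; exact: cvg_cst.
rewrite big_cons; under eq_fun do rewrite big_cons; case Pi : (P i) => //.
by apply: cvgD => //; exact: fl.
Qed.

End product_bounds.

(** * Convergence in L^p of the ball *)

Section Lp.
Context {R : realType} {n : nat}.
Local Notation mu := (@lebesgue_rV R n).
Local Notation B := (@unit_ball R n).
Implicit Types (f g c : 'rV[R]_n -> R) (p : nat).

Lemma measurable_norm_expr p f : measurable_fun B f ->
  measurable_fun B (fun x => `|f x| ^+ p).
Proof. by move=> mf; apply: measurable_funX; exact: measurableT_comp. Qed.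

Lemma Lp_ball_integrable p f : Lp_ball p f ->
  mu.-integrable B (EFin \o (fun x => `|f x| ^+ p)).
Proof.
move=> [mf fi]; apply/integrableP; split.
  by apply/measurable_EFinP; exact: measurable_norm_expr.
by under eq_integral do rewrite /= ger0_norm ?exprn_ge0 //.
Qed.

(** The p-th power of the norm, without the root; the factor 2^p in [rnpD] is the price for the
    missing triangle inequality. *)
Definition rnp p f : R := \int[mu]_(x in B) `|f x| ^+ p.

Lemma rnpE p f : Lp_ball p f ->
  (\int[mu]_(x in B) (`|f x| ^+ p)%:E = (rnp p f)%:E)%E.
Proof.
move=> [mf fi]; rewrite /rnp /Rintegral fineK // ge0_fin_numE //.
by apply: integral_ge0 => x _; rewrite lee_fin exprn_ge0.
Qed.

Lemma rnp_ge0 p f : 0 <= rnp p f.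
Proof. by apply: Rintegral_ge0 => x _; rewrite exprn_ge0. Qed.

Lemma Lp_ball_dom p f h : measurable_fun B f ->
  mu.-integrable B (EFin \o h) -> (forall x, B x -> `|f x| ^+ p <= h x) -> Lp_ball p f.
Proof.
move=> mf hi fh; split => //.
have [mh hfin] := integrableP _ _ _ hi.
apply: le_lt_trans hfin; apply: ge0_le_integral => //.
- exact: mball.
- by apply/measurable_EFinP; exact: measurable_norm_expr.
- exact: measurableT_comp.
- by move=> x xB; rewrite /= lee_fin (le_trans (fh x xB)) // ler_norm.
Qed.

Lemma Lp_ball_continuous p f : continuous f -> Lp_ball p f.
Proof.
move=> fc; have [M M0 fM] := continuous_ball_bounded fc.
apply: (@Lp_ball_dom _ _ (cst (M ^+ p))).
- by apply: measurable_funTS; exact: continuous_measurable_rV.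
- by apply: continuous_ball_integrable; exact: cst_continuous.
- by move=> x /ltW/fM fx; rewrite lerXn2r ?nnegrE.
Qed.

Lemma Lp_ballD p f g : Lp_ball p f -> Lp_ball p g -> Lp_ball p (fun x => f x + g x).
Proof.
move=> fp gp; have fi := Lp_ball_integrable fp; have gi := Lp_ball_integrable gp.
apply: (@Lp_ball_dom _ _ (fun x => 2 ^+ p * (`|f x| ^+ p + `|g x| ^+ p))).
- by apply: measurable_funD; [exact: fp.1|exact: gp.1].
- exact: (integrableZl mball (2 ^+ p) (integrableD mball fi gi)).
- move=> x _; apply: le_trans (exprD_le _ _ _) => //.
  by rewrite lerXn2r ?nnegrE ?addr_ge0 // ler_normD.
Qed.

Lemma Lp_ballM p c f (M : R) : measurable_fun B c -> (forall x, B x -> `|c x| <= M) ->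
  Lp_ball p f -> Lp_ball p (fun x => c x * f x).
Proof.
move=> mc cM fp; have fi := Lp_ball_integrable fp.
apply: (@Lp_ball_dom _ _ (fun x => M ^+ p * `|f x| ^+ p)).
- by apply: measurable_funM => //; exact: fp.1.
- exact: (integrableZl mball (M ^+ p) fi).
- move=> x xB; rewrite normrM exprMn ler_wpM2r ?exprn_ge0 //.
  by rewrite lerXn2r ?nnegrE ?cM // (le_trans _ (cM x xB)).
Qed.

Lemma Lp_ballN p f : Lp_ball p f -> Lp_ball p (fun x => - f x).
Proof.
move=> fp; apply: (@Lp_ball_dom _ _ (fun x => `|f x| ^+ p)).
- by apply: measurableT_comp => //; exact: fp.1.
- exact: Lp_ball_integrable.
- by move=> x _; rewrite normrN.
Qed.

Lemma Lp_ballB p f g : Lp_ball p f -> Lp_ball p g -> Lp_ball p (fun x => f x - g x).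
Proof. by move=> fp /Lp_ballN; exact: Lp_ballD. Qed.

Lemma rnp_le p f g : Lp_ball p f -> Lp_ball p g ->
  (forall x, B x -> `|f x| <= `|g x|) -> rnp p f <= rnp p g.
Proof.
move=> fp gp fg; apply: le_Rintegral; rewrite ?mball //.
- exact: mball.
- exact: Lp_ball_integrable.
- exact: Lp_ball_integrable.
- by move=> x xB; rewrite lerXn2r ?nnegrE // fg.
Qed.

Lemma rnpD p f g : Lp_ball p f -> Lp_ball p g ->
  rnp p (fun x => f x + g x) <= 2 ^+ p * (rnp p f + rnp p g).
Proof.
move=> fp gp; have fi := Lp_ball_integrable fp; have gi := Lp_ball_integrable gp.
have fgi := Lp_ball_integrable (Lp_ballD fp gp).
rewrite -(RintegralD mball fi gi) -(RintegralZl _ mball); last exact: (integrableD mball fi gi).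
apply: le_Rintegral => //; first exact: mball.
  exact: (integrableZl mball (2 ^+ p) (integrableD mball fi gi)).
move=> x _; apply: le_trans (exprD_le _ _ _) => //.
by rewrite lerXn2r ?nnegrE ?addr_ge0 // ler_normD.
Qed.

Lemma Lp_cvgE p (f_ : nat -> 'rV[R]_n -> R) f :
  (forall k, Lp_ball p (f_ k)) -> Lp_ball p f ->
  Lp_cvg mu B p f_ f <-> (fun k => rnp p (fun x => f_ k x - f x)) @ \oo --> (0 : R).
Proof.
move=> fkp fp; rewrite /Lp_cvg.
rewrite (_ : (fun k => _) = EFin \o (fun k => rnp p (fun x => f_ k x - f x))).
  split; first exact: fine_cvg.
  by move=> h; apply: cvg_EFin => //; near=> k.
by apply/funext => k /=; rewrite rnpE //; exact: Lp_ballB.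
Unshelve. all: by end_near. Qed.

Lemma Lp_prod_integrable p (F : 'I_p.+1 -> 'rV[R]_n -> R) c (M : R) :
  measurable_fun B c -> (forall x, B x -> `|c x| <= M) ->
  (forall m, Lp_ball p.+1 (F m)) ->
  mu.-integrable B (EFin \o (fun x => c x * \prod_m F m x)).
Proof.
move=> mc cM Fp.
have mP : measurable_fun B (fun x => \prod_m F m x).
  by apply: measurable_prod => m _; exact: (Fp m).1.
have Si : mu.-integrable B (EFin \o (fun x => \sum_m `|F m x| ^+ p.+1)).
  by apply: (integrable_fin_sum mball) => m _; exact: Lp_ball_integrable.
apply: (le_integrable mball _ _ (integrableZl mball M Si)).
  by apply/measurable_EFinP; exact: measurable_funM.
move=> x xB; rewrite /= lee_fin normrM.
apply: le_trans (ler_norm _); apply: ler_pM => //; [exact: cM|exact: prod_le_sum].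
Qed.

Lemma Lp_prod_cvg p (Fk : nat -> 'I_p.+1 -> 'rV[R]_n -> R) (F : 'I_p.+1 -> 'rV[R]_n -> R)
    c (M : R) :
  measurable_fun B c -> (forall x, B x -> `|c x| <= M) ->
  (forall k m, Lp_ball p.+1 (Fk k m)) -> (forall m, Lp_ball p.+1 (F m)) ->
  (forall m, Lp_cvg mu B p.+1 (fun k => Fk k m) (F m)) ->
  (fun k => \int[mu]_(x in B) (c x * \prod_m Fk k m x)) @ \oo -->
    \int[mu]_(x in B) (c x * \prod_m F m x).
Proof.
move=> mc cM Fkp Fp FkF.
pose S := \sum_m rnp p.+1 (F m).
pose D k := \sum_m rnp p.+1 (fun x => Fk k m x - F m x).
have S0 : 0 <= S by apply: sumr_ge0 => m _; exact: rnp_ge0.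
have D0 : D @ \oo --> (0 : R).
  rewrite -[X in _ --> X](_ : \sum_(m < p.+1) (0 : R) = 0); last by rewrite big1.
  apply: cvg_fin_sum => m _; apply/(Lp_cvgE _ (Fp m)) => //; exact: (fun k => Fkp k m).
have [M' M'0 cM'] : exists2 M' : R, 0 <= M' & forall x, B x -> `|c x| <= M'.
  by exists `|M| => // x xB; rewrite (le_trans (cM x xB)) // ler_norm.
apply/cvgrPdist_le => /= e e0.
(* Chosen so that the part of the error that does not depend on k stays below e / 2; the added 1
   keeps the denominators positive. *)
pose e1 := e / (2 * (M' + 1) * (S + 1)).
have M1 : 0 < M' + 1 by rewrite ltr_wpDl.
have S1 : 0 < S + 1 by rewrite ltr_wpDl.
have e10 : 0 < e1 by rewrite divr_gt0 // !mulr_gt0.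
have [C C0 H] := prod_close_sum p e10.
have key k : `|\int[mu]_(x in B) (c x * \prod_m F m x) -
    \int[mu]_(x in B) (c x * \prod_m Fk k m x)| <= M' * (e1 * S + C * D k).
  have Fi := Lp_prod_integrable mc cM Fp.
  have Fki := Lp_prod_integrable mc cM (Fkp k).
  have Si : mu.-integrable B (EFin \o (fun x => \sum_m `|F m x| ^+ p.+1)).
    by apply: (integrable_fin_sum mball) => m _; exact: Lp_ball_integrable.
  have Di : mu.-integrable B (EFin \o (fun x => \sum_m `|Fk k m x - F m x| ^+ p.+1)).
    by apply: (integrable_fin_sum mball) => m _; apply: Lp_ball_integrable; exact: Lp_ballB.
  have -> : S = \int[mu]_(x in B) (\sum_m `|F m x| ^+ p.+1).
    by rewrite (Rintegral_fin_sum mball) // => m _; exact: Lp_ball_integrable.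
  have -> : D k = \int[mu]_(x in B) (\sum_m `|Fk k m x - F m x| ^+ p.+1).
    by rewrite (Rintegral_fin_sum mball) // => m _; apply: Lp_ball_integrable; exact: Lp_ballB.
  have Si' := integrableZl mball e1 Si; have Di' := integrableZl mball C Di.
  rewrite -(RintegralZl _ mball Si) -(RintegralZl _ mball Di) -(RintegralD mball Si' Di').
  rewrite -(RintegralZl _ mball (integrableD mball Si' Di')) distrC.
  rewrite -(RintegralB mball Fki Fi).
  apply: le_trans (le_normr_Rintegral mball (integrableB mball Fki Fi)) _.
  apply: le_Rintegral; first exact: mball.
  - by have := integrable_norm (integrableB mball Fki Fi).
  - exact: (integrableZl mball M' (integrableD mball Si' Di')).
  - move=> x xB; rewrite -mulrBr normrM; apply: ler_pM => //; first exact: cM'.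
have MC : 0 < e / (2 * (M' + 1) * (C + 1)).
  by rewrite divr_gt0 // !mulr_gt0 // ltr_wpDl.
near=> k; apply: (le_trans (key k)).
have Dk : D k <= e / (2 * (M' + 1) * (C + 1)).
  rewrite (le_trans (ler_norm _)) // -[D k]subr0 distrC.
  by near: k; move/cvgrPdist_le : D0; apply.
have Dk0 : 0 <= D k by apply: sumr_ge0 => m _; exact: rnp_ge0.
have C1 : 0 < C + 1 by rewrite ltr_wpDl.
have h1 : (M' + 1) * (e1 * (S + 1)) = e / 2.
  by rewrite /e1; field; rewrite !gt_eqF.
have h2 : (M' + 1) * ((C + 1) * (e / (2 * (M' + 1) * (C + 1)))) = e / 2.
  by field; rewrite !gt_eqF.
apply: (@le_trans _ _ ((M' + 1) * (e1 * (S + 1) + (C + 1) * (e / (2 * (M' + 1) * (C + 1)))))).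
  apply: ler_pM => //.
  - by rewrite addr_ge0 // mulr_ge0 // ltW.
  - by rewrite lerDl.
  - apply: lerD; first by rewrite ler_wpM2l ?(ltW e10) // lerDl.
    by apply: ler_pM => //; rewrite lerDl.
by rewrite mulrDr h1 h2 -splitr.
Unshelve. all: by end_near. Qed.

End Lp.

(** * The fundamental lemma of the calculus of variations *)

Section quadrants.
Context {R : realType} {n : nat}.

Definition quadrant (b : 'rV[R]_n) : set 'rV[R]_n := [set x | forall i, x 0 i < b 0 i].

Lemma measurable_quadrant b : measurable (quadrant b).
Proof.
apply: (@measurable_coord_set _ _ (fun i => [set t | t < b 0 i])) => i.
by rewrite (_ : [set _ | _] = `]-oo, b 0 i[%classic).
Qed.

Lemma quadrantI : setI_closed (range quadrant).
Proof.
move=> _ _ [b _ <-] [c _ <-]; exists (\row_i Num.min (b 0 i) (c 0 i)) => //.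
apply/seteqP; split => x /= h.
  by split => i; have := h i; rewrite mxE lt_min => /andP[].
by move=> i; rewrite mxE lt_min h.1 h.2.
Qed.

(** A half-space x_i < b is the union over N of the quadrants with bound b in coordinate i and N in
    all others. With [quadrantI] this provides the pi-system for the induction on measurable sets
    below. *)
Lemma measurable_rV_quadrants :
  (@measurable _ 'rV[R]_n) = <<s range quadrant >>.
Proof.
apply/seteqP; split; last first.
  apply: smallest_sub; first exact: sigma_algebra_measurable.
  by move=> _ [b _ <-]; exact: measurable_quadrant.
apply: smallest_sub; first exact: smallest_sigma_algebra.
rewrite -bigcup_seq => A [i _ [Y mY <-]]; rewrite setTI.
have sG := smallest_sigma_algebra setT (range quadrant).
suff H : <<s @RGenInftyO.G R >> `<=` [set Y : set R | <<s range quadrant >>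
    ((fun x : 'rV[R]_n => x 0 i) @^-1` Y)].
  by apply: H; exact: (eq_rect _ (fun S : set (set R) => S Y) mY _ (RGenInftyO.measurableE R)).
apply: smallest_sub.
  split.
  - by rewrite /= preimage_set0; case: sG.
  - move=> Z /= sZ; rewrite setTD preimage_setC -setTD.
    by case: sG => _ + _; exact.
  - move=> F sF; rewrite /= preimage_bigcup.
    by case: sG => _ _; exact.
move=> _ [b ->] /=.
rewrite (_ : _ @^-1` _ = \bigcup_N quadrant (\row_j if j == i then b else N%:R)).
  case: sG => _ _; apply => N; apply: sub_sigma_algebra.
  by exists (\row_j if j == i then b else N%:R).
apply/seteqP; split => x /=; rewrite in_itv /=.
  move=> xb; exists (Num.truncn `|x|).+1 => //= j; rewrite mxE; case: eqVneq => [->//|_].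
  apply: le_lt_trans (truncnS_gt _); apply: le_trans (ler_norm _) (coord_le_norm _ _).
by move=> [N _ /(_ i)]; rewrite mxE eqxx.
Qed.

End quadrants.

Section fundamental_lemma.
Context {R : realType} {n : nat}.
Local Notation mu := (@lebesgue_rV R n).
Local Notation B := (@unit_ball R n).

Definition obox (a b : 'rV[R]_n) : set 'rV[R]_n := [set x | forall i, a 0 i < x 0 i < b 0 i].
Definition cbox (a b : 'rV[R]_n) : set 'rV[R]_n := [set x | forall i, a 0 i <= x 0 i <= b 0 i].

Lemma measurable_obox a b : measurable (obox a b).
Proof.
apply: (@measurable_coord_set _ _ (fun i => [set t | a 0 i < t < b 0 i])) => i.
by rewrite (_ : [set _ | _] = `]a 0 i, b 0 i[%classic).
Qed.

Lemma compact_cbox a b : compact (cbox a b).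
Proof.
rewrite (_ : cbox a b = [set v : 'rV[R]_n | forall i, `[a 0 i, b 0 i]%classic (v ord0 i)]).
  by apply: (@rV_compact _ _ (fun i => `[a 0 i, b 0 i]%classic)) => i; exact: segment_compact.
by apply/seteqP; split => x /= h i; have := h i; rewrite /= in_itv.
Qed.

Lemma closed_cbox a b : closed (cbox a b).
Proof. by apply: compact_closed; [exact: norm_hausdorff|exact: compact_cbox]. Qed.

Lemma obox_sub_cbox a b : obox a b `<=` cbox a b.
Proof. by move=> x h i; have /andP[/ltW -> /ltW ->] := h i. Qed.

(** As m grows, these smooth functions supported in the closed box tend to the indicator of the open
    box. *)
Definition box_cutoff (a b : 'rV[R]_n) (m : nat) (x : 'rV[R]_n) : R :=
  \prod_i (sstep (m%:R * (x 0 i - a 0 i)) * sstep (m%:R * (b 0 i - x 0 i))).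

Lemma Ck_box_cutoff a b m k : Ck k (box_cutoff a b m).
Proof.
apply: Ck_prod => i _; apply: CkM; apply: Ck_sstep; apply: CkZ; apply: CkB;
  by [exact: Ck_coord|exact: Ck_cst].
Qed.

Lemma box_cutoff_out a b m x : ~ obox a b x -> box_cutoff a b m x = 0.
Proof.
move=> /existsNP[i /negP]; rewrite negb_and -!leNgt => h.
rewrite /box_cutoff (bigD1 i) //=; case/orP: h => h.
  by rewrite sstep0 ?mul0r // mulr_ge0_le0 // subr_le0.
by rewrite [X in _ * X * _]sstep0 ?mulr0 ?mul0r // mulr_ge0_le0 // subr_le0.
Qed.

Lemma box_cutoff_01 a b m x : 0 <= box_cutoff a b m x <= 1.
Proof.
rewrite /box_cutoff prodr_ge0 /=; last by move=> i _; rewrite mulr_ge0 ?sstep_ge0.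
apply: prodr_ile1 => i; rewrite mulr_ge0 ?sstep_ge0 //=.
by rewrite mulr_ile1 ?sstep_ge0 ?sstep_le1.
Qed.

Lemma box_cutoff_cvg a b x : (fun m => box_cutoff a b m x) @ \oo -->
  ((x \in obox a b)%:R : R).
Proof.
case: (boolP (x \in obox a b)) => xo; last first.
  rewrite (_ : (fun m => _) = cst 0); first exact: cvg_cst.
  by apply/funext => m; rewrite box_cutoff_out //; move: xo; rewrite notin_setE.
have {}xo := set_mem xo.
have one_near i : \forall m \near \oo,
    sstep (m%:R * (x 0 i - a 0 i)) * sstep (m%:R * (b 0 i - x 0 i)) = 1.
  have /andP[ax xb] := xo i.
  have E (c : R) : 0 < c -> \forall m \near \oo, sstep (m%:R * c) = 1.
    move=> c0; near=> m; apply: sstep1; rewrite -ler_pdivrMr // mul1r.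
    by near: m; exact: nbhs_infty_ger.
  have E1 : \forall m \near \oo, sstep (m%:R * (x 0 i - a 0 i)) = 1.
    by apply: E; rewrite subr_gt0.
  have E2 : \forall m \near \oo, sstep (m%:R * (b 0 i - x 0 i)) = 1.
    by apply: E; rewrite subr_gt0.
  by apply: filterS2 E1 E2 => m -> ->; rewrite mulr1.
apply: cvg_near_cst; have H := filter_forall eventually_filter one_near.
by apply: filterS H => m h; rewrite /box_cutoff big1.
Unshelve. all: by end_near. Qed.

Lemma test_box_cutoff a b m : cbox a b `<=` B -> test_function (box_cutoff a b m).
Proof.
move=> abB.
have sub : closure [set x | box_cutoff a b m x != 0] `<=` cbox a b.
  apply: (subset_trans _ (@closed_cbox a b)); apply: closureS => x /= /eqP x0.
  by apply: obox_sub_cbox; apply: contrapT => /(@box_cutoff_out a b m).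
split.
- by move=> k; exact: Ck_box_cutoff.
- by apply: (subclosed_compact _ (@compact_cbox a b)) => //; exact: closed_closure.
- exact: subset_trans abB.
Qed.

(** The cutoffs of the box are test functions bounded by 1; dominated convergence, with |h| on the
    compact closed box as bound, passes to the indicator. *)
Lemma box_integral0 h a b : locally_integrable_ball h ->
  (forall phi, test_function phi -> \int[mu]_(x in B) (h x * phi x) = 0) ->
  cbox a b `<=` B -> (\int[mu]_(x in obox a b) (h x)%:E = 0)%E.
Proof.
move=> [mh hi] h0 abB.
have mc : measurable (cbox a b).
  by rewrite -[cbox a b]setCK; apply: measurableC; apply: open_measurable_rV;
    rewrite openC; exact: closed_cbox.
have hK : mu.-integrable (cbox a b) (EFin \o h).
  apply/integrableP; split; last exact: hi abB (@compact_cbox a b).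
  by apply/measurable_EFinP; exact: (measurable_funS mball abB mh).
have hB : mu.-integrable B ((EFin \o h) \_ (cbox a b)).
  by apply: (integrableS measurableT mball) => //; exact: ((integrable_mkcond (EFin \o h) mc).1 hK).
have mphi m : measurable_fun B (box_cutoff a b m).
  by apply: measurable_funTS; apply: continuous_measurable_rV; exact: (Ck_continuous (Ck_box_cutoff a b m 0)).
have mhphi m : measurable_fun B (EFin \o (fun x => h x * box_cutoff a b m x)).
  by apply/measurable_EFinP; exact: measurable_funM.
have dom m x : B x -> (`|(h x * box_cutoff a b m x)%:E| <= `|((EFin \o h) \_ (cbox a b)) x|)%E.
  move=> xB; rewrite patchE; case: ifPn => xc.
    have /andP[c0 c1] := box_cutoff_01 a b m x.
    by rewrite /= lee_fin normrM (ger0_norm c0) ler_piMr.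
  rewrite box_cutoff_out ?mulr0 /= ?normr0 // => /obox_sub_cbox.
  by move: xc; rewrite notin_setE.
have int0 m : (\int[mu]_(x in B) (h x * box_cutoff a b m x)%:E = 0)%E.
  have hpi : mu.-integrable B (EFin \o (fun x => h x * box_cutoff a b m x)).
    by apply: (le_integrable mball (mhphi m) _ hB) => x xB; exact: dom.
  rewrite -[LHS]fineK; last exact: (integrable_fin_num mball hpi).
  by have := h0 _ (test_box_cutoff m abB); rewrite /Rintegral => ->.
have := @dominated_convergence _ _ R mu B mball
  (fun m x => (h x * box_cutoff a b m x)%:E) (fun x => (h x * (x \in obox a b)%:R)%:E)
  (fun x => `|((EFin \o h) \_ (cbox a b)) x|%E) mhphi.
case.
- apply/measurable_EFinP; apply: measurable_funM => //.
  rewrite (_ : (fun x => _) = \1_(obox a b)); last by apply/funext => x; rewrite indicE.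
  exact: measurable_indic (measurable_obox a b).
- apply: aeW => x xB; apply: cvg_EFin; first by near=> m.
  by apply: cvgM; [exact: cvg_cst|exact: box_cutoff_cvg].
- exact: integrable_abse.
- by apply: aeW => x m xB; exact: dom.
move=> _ _.
rewrite (_ : (fun m => _) = cst 0%E); last by apply/funext => m; exact: int0.
move=> /(cvg_unique _ (cvg_cst _)) => /(_ (@ereal_hausdorff R)) E.
apply: (etrans _ (esym E)).
rewrite -{1}(setIidr (subset_trans (@obox_sub_cbox a b) abB)) integral_mkcondr; apply: eq_integral => x _; rewrite patchE.
by case: ifPn => _; rewrite ?mulr1 ?mulr0.
Unshelve. all: by end_near. Qed.

(** The measurable sets E for which the integral of h over E meeting the box vanishes form a Dynkin
    class. It contains the quadrants, because a quadrant cuts the box in another box. *)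
Lemma box_ae0 h a b : locally_integrable_ball h ->
  (forall phi, test_function phi -> \int[mu]_(x in B) (h x * phi x) = 0) ->
  cbox a b `<=` B -> ae_eq mu (obox a b) (EFin \o h) (cst 0%E).
Proof.
move=> hl h0 abB; set Q := obox a b.
have QB : Q `<=` B by apply: subset_trans abB; exact: obox_sub_cbox.
have mQ : measurable Q := measurable_obox a b.
have hQ : mu.-integrable Q (EFin \o h).
  apply/integrableP; split; first by apply/measurable_EFinP; exact: (measurable_funS mball QB hl.1).
  apply: le_lt_trans (hl.2 _ abB (@compact_cbox a b)).
  apply: ge0_subset_integral => //.
  - by rewrite -[cbox a b]setCK; apply: measurableC; apply: open_measurable_rV;
      rewrite openC; exact: closed_cbox.
  - apply/measurable_EFinP; apply: measurableT_comp => //.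
    exact: (measurable_funS mball abB hl.1).
  - exact: obox_sub_cbox.
have hE E : measurable E -> mu.-integrable (E `&` Q) (EFin \o h).
  by move=> mE; apply: integrableS hQ => //; exact: measurableI.
suff key (E : set 'rV[R]_n) : measurable E -> (\int[mu]_(x in E `&` Q) (h x)%:E = 0)%E.
  apply: (integral_ae_eq mQ) => // E EQ mE.
  by have := key E mE; rewrite (setIidl EQ) integral0.
rewrite measurable_rV_quadrants.
move: E; apply: (dynkin_induction measurable_rV_quadrants quadrantI).
- rewrite setTI; exact: box_integral0.
- move=> _ [c _ <-].
  have -> : quadrant c `&` Q = obox a (\row_i Num.min (b 0 i) (c 0 i)).
    apply/seteqP; split => x /=.
      move=> [xc xQ] i; have /andP[ax xb] := xQ i.
      by rewrite mxE lt_min ax xb xc.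
    move=> xq; split => i; have := xq i; rewrite mxE lt_min => /andP[ax /andP[xb xc]] //.
    by rewrite ax xb.
  apply: box_integral0 => //; apply: subset_trans abB => x xc i.
  by have := xc i; rewrite mxE le_min => /andP[-> /andP[-> _]].
- move=> E mE E0.
  have := @integral_setU _ _ _ mu _ _ (EFin \o h) (measurableI _ _ mE mQ)
    (measurableI _ _ (measurableC mE) mQ).
  rewrite -setIUl setUv setTI (box_integral0 hl h0 abB) E0 add0e => <- //.
  + exact: (measurable_int _ hQ).
  + rewrite /disj_set; apply/eqP/seteqP; split => // x [[? _] [? _]] //.
- move=> F mF tF F0.
  rewrite setI_bigcupl integral_bigcup.
  + by apply: eseries0 => i _ _; exact: F0.
  + by apply: trivIset_setIr.
  + by move=> k; exact: measurableI.
  + by rewrite -setI_bigcupl; apply: hE; exact: bigcupT_measurable.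
Qed.

Lemma fundamental_lemma h : locally_integrable_ball h ->
  (forall phi, test_function phi -> \int[mu]_(x in B) (h x * phi x) = 0) ->
  {ae mu, forall x, B x -> h x = 0}.
Proof.
move=> hl h0.
pose lo (q : 'rV[rat]_n) k : 'rV[R]_n := \row_i (ratr (q 0 i) - k.+1%:R^-1).
pose hi (q : 'rV[rat]_n) k : 'rV[R]_n := \row_i (ratr (q 0 i) + k.+1%:R^-1).
(* The exceptional sets of the rational boxes whose closures lie in the ball: there are countably
   many, and their boxes cover the ball. *)
pose N m := if @unpickle ('rV[rat]_n * nat)%type m is Some qk then
  (if `[< cbox (lo qk.1 qk.2) (hi qk.1 qk.2) `<=` B >] then
    [set x | ~ (obox (lo qk.1 qk.2) (hi qk.1 qk.2) x -> h x = 0)] else set0) else set0.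
apply: (@negligibleS _ _ _ mu (\bigcup_m N m) _); last first.
  apply: negligible_bigcup => m; rewrite /N; case: unpickle => [[q k]|]; last exact: negligible_set0.
  case: asboolP => [qB|_]; last exact: negligible_set0.
  apply: negligibleS (box_ae0 hl h0 qB) => x /= + H; apply => xo.
  by have /(congr1 fine) := H xo.
move=> x /= /not_implyP[xB hx].
have oB : open B.
  rewrite (_ : B = (@enorm R n) @^-1` [set t | t < 1]) //.
  by apply: open_comp; [move=> y _; exact: enorm_continuous|exact: open_lt].
have /nbhs_ballP[e /= e0 eB] : nbhs x B by exact: open_nbhs_nbhs.
have [k ke] : exists k, k.+1%:R^-1 < e / 2.
  have e20 : 0 < e / 2 by rewrite divr_gt0.
  exists (Num.truncn (e / 2)^-1); rewrite -[ltRHS]invrK ltf_pV2 ?posrE ?invr_gt0 //.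
  exact: truncnS_gt.
have k0 : 0 < k.+1%:R^-1 :> R by rewrite invr_gt0.
have xi i : exists q, `|x 0 i - ratr q| < k.+1%:R^-1.
  have [q] := rat_in_itvoo (ltr_pwDr k0 (lexx (x 0 i))).
  rewrite in_itv /= => /andP[h1 h2]; exists q.
  by rewrite ltr_distlC; apply/andP; split => //; rewrite ltrBlDr (lt_trans h1) // ltrDl.
pose q := \row_i xchoose (xi i).
have qP i : `|x 0 i - ratr (q 0 i)| < k.+1%:R^-1 by rewrite mxE; exact: (xchooseP (xi i)).
exists (pickle (q, k)) => //; rewrite /N pickleK /=; case: asboolP => [_|]; last case.
  move=> /(_ _); apply: contra_not hx; apply => i.
  by have := qP i; rewrite ltr_distl [lo _ _ _ _]mxE [hi _ _ _ _]mxE.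
move=> y yq; apply: eB; rewrite -ball_normE /=.
apply: (@le_lt_trans _ _ (k.+1%:R^-1 + k.+1%:R^-1)).
  apply: norm_le_coord => [|i]; first by rewrite addr_ge0 // ltW.
  rewrite !mxE (_ : _ - _ = x 0 i - ratr (q 0 i) - (y 0 i - ratr (q 0 i))); last by ring.
  apply: (le_trans (ler_normB _ _)); apply: lerD; first exact: ltW.
  by have := yq i; rewrite [lo _ _ _ _]mxE [hi _ _ _ _]mxE ler_distl.
by rewrite -[e](divfK (_ : 2 != 0)) // mulr_natr mulr2n ltrD.
Qed.

End fundamental_lemma.

(** * Weak derivatives *)

Section weak_derivatives.
Context {R : realType} {n : nat}.
Local Notation mu := (@lebesgue_rV R n).
Local Notation B := (@unit_ball R n).
Implicit Types (f g h phi : 'rV[R]_n -> R) (p : nat) (j : 'I_n).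

(** If a > e, then (a / e)^p >= 1. On the ball, which has finite measure, this bounds the L^1 norm
    by a small constant plus a multiple of the integral of |f|^(p+1), so convergence in L^(p+1)
    gives convergence in L^1. *)
Lemma norm_le_expr (a e : R) p : 0 <= a -> 0 < e -> a <= e + e ^- p * a ^+ p.+1.
Proof.
move=> a0 e0; have ep : 0 <= e ^- p by rewrite invr_ge0 exprn_ge0 // ltW.
have [ae|ea] := leP a e.
  by rewrite (le_trans ae) // lerDl mulr_ge0 // exprn_ge0.
apply: (@le_trans _ _ (e ^- p * a ^+ p.+1)); last by rewrite lerDr ltW.
rewrite exprS mulrCA -exprVn -exprMn ler_peMr //.
by rewrite exprn_ege1 // mulrC ler_pdivlMr // mul1r ltW.
Qed.

Lemma integrable_cst_ball (c : R) : mu.-integrable B (EFin \o cst c).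
Proof. by apply: continuous_ball_integrable; exact: cst_continuous. Qed.

Lemma Lp_ball1 p f : Lp_ball p.+1 f -> Lp_ball 1 f.
Proof.
move=> fp; have fi := Lp_ball_integrable fp.
apply: (@Lp_ball_dom _ _ _ _ (fun x => 1 + `|f x| ^+ p.+1)); first exact: fp.1.
  exact: (integrableD mball (integrable_cst_ball 1) fi).
move=> x _; rewrite expr1; have := norm_le_expr p (normr_ge0 (f x)) ltr01.
by rewrite expr1n invr1 mul1r.
Qed.

Lemma rnp1_le p f (e : R) : 0 < e -> Lp_ball p.+1 f ->
  rnp 1 f <= e * fine (mu B) + e ^- p * rnp p.+1 f.
Proof.
move=> e0 fp; have fi := Lp_ball_integrable fp.
have f1 := Lp_ball_integrable (Lp_ball1 fp).
have ei := integrable_cst_ball e.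
have fi' := integrableZl mball (e ^- p) fi.
have -> : e * fine (mu B) = \int[mu]_(x in B) (cst e x).
  by rewrite Rintegral_cst //; exact: mball.
rewrite /rnp -(RintegralZl _ mball fi) -(RintegralD mball ei fi').
apply: le_Rintegral => //; first exact: mball.
  exact: (integrableD mball ei fi').
by move=> x _; rewrite expr1; exact: norm_le_expr.
Qed.

Lemma Lp_cvg1 p (f_ : nat -> 'rV[R]_n -> R) f :
  (forall k, Lp_ball p.+1 (f_ k)) -> Lp_ball p.+1 f ->
  Lp_cvg mu B p.+1 f_ f -> Lp_cvg mu B 1 f_ f.
Proof.
move=> fkp fp /(Lp_cvgE fkp fp) h.
apply/(Lp_cvgE (fun k => Lp_ball1 (fkp k)) (Lp_ball1 fp)).
have mB0 : 0 <= fine (mu B) by rewrite fine_ge0.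
apply/cvgrPdist_le => e e0.
pose e1 := e / (2 * (fine (mu B) + 1)).
have M0 : 0 < fine (mu B) + 1 by rewrite ltr_wpDl.
have e10 : 0 < e1 by rewrite divr_gt0 // mulr_gt0.
have e1p : 0 < e1 ^+ p by rewrite exprn_gt0.
have e2 : 0 < e / 2 * e1 ^+ p by rewrite mulr_gt0 // divr_gt0.
near=> k.
have hk : rnp p.+1 (fun x => f_ k x - f x) <= e / 2 * e1 ^+ p.
  apply: (le_trans (ler_norm _)); rewrite -[X in `|X|]subr0 distrC.
  by near: k; move/cvgrPdist_le : h; apply.
rewrite sub0r normrN ger0_norm ?rnp_ge0 //.
apply: (le_trans (rnp1_le e10 (Lp_ballB (fkp k) fp))).
have h1 : e1 * (fine (mu B) + 1) = e / 2 by rewrite /e1; field; rewrite !gt_eqF.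
have h2 : e1 * fine (mu B) <= e / 2 by rewrite -h1 ler_wpM2l ?(ltW e10) // lerDl.
have h3 : e1 ^- p * rnp p.+1 (fun x => f_ k x - f x) <= e / 2.
  by rewrite ler_pdivrMl // mulrC.
by rewrite [leRHS]splitr lerD.
Unshelve. all: by end_near. Qed.

Lemma locally_integrable_Lp1 f : Lp_ball 1 f -> locally_integrable_ball f.
Proof.
move=> [mf fi]; split => // K KB cK; apply: le_lt_trans fi.
have mK : measurable K.
  rewrite -[K]setCK; apply: measurableC; apply: open_measurable_rV; rewrite openC.
  by apply: compact_closed; [exact: norm_hausdorff|].
under [leRHS]eq_integral do rewrite expr1.
apply: ge0_subset_integral => //; first exact: mball.
by apply/measurable_EFinP; exact: measurableT_comp.
Qed.

Lemma test_bounds phi : test_function phi -> exists K : set 'rV[R]_n, exists M r : R,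
  [/\ compact K, K `<=` B, 0 <= M, r < 1 & [/\ forall x, `|phi x| <= M,
    (forall x, ~ K x -> phi x = 0) & forall x, r <= nsq x -> phi x = 0]].
Proof.
move=> [smphi cK KB]; set K := closure _ in cK KB.
have pc : continuous phi := Ck_continuous (smphi 0%N).
have out x : ~ K x -> phi x = 0.
  by move=> Kx; apply/eqP; apply: contra_notT Kx => px; exact: subset_closure.
have [M M0 HM] := continuous_bounded pc cK.
exists K; exists M.
have HM' x : `|phi x| <= M.
  by have [/HM//|/out ->] := pselect (K x); rewrite normr0.
have [K0|/set0P K0] := eqVneq K set0.
  exists 0; split => //; split => // x _; apply: out; rewrite K0; exact.
have [y Ky ymax] := @EVT_max_rV R n nsq K K0 cK (continuous_subspaceT (Ck_continuous (Ck_nsq 0))).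
have y1 : nsq y < 1 by apply/unit_ballE; apply: KB; exact: set_mem.
(* Strictly between 1 and the maximum of nsq over the support, attained at y inside the open
   ball. *)
exists ((nsq y + 1) / 2); split => //; first lra.
split => // x rx; apply: out => Kx.
have := ymax x (mem_set Kx); lra.
Qed.

Lemma test_integrable h phi : locally_integrable_ball h -> test_function phi ->
  mu.-integrable B (EFin \o (fun x => h x * phi x)).
Proof.
move=> [mh hi] tphi; have [K [M [r [cK KB M0 _ [HM out _]]]]] := test_bounds tphi.
have pc : continuous phi := Ck_continuous (let: And3 s _ _ := tphi in s 0%N).
have mK : measurable K.
  rewrite -[K]setCK; apply: measurableC; apply: open_measurable_rV; rewrite openC.
  by apply: compact_closed; [exact: norm_hausdorff|].
have hK : mu.-integrable K (EFin \o h).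
  apply/integrableP; split; last exact: hi.
  by apply/measurable_EFinP; exact: (measurable_funS mball KB mh).
have hB : mu.-integrable B ((EFin \o h) \_ K).
  by apply: (integrableS measurableT mball) => //; exact: ((integrable_mkcond (EFin \o h) mK).1 hK).
have hM := integrableZl mball M (integrable_abse hB).
apply: (le_integrable mball _ _ hM).
  apply/measurable_EFinP; apply: measurable_funM => //.
  by apply: measurable_funTS; exact: continuous_measurable_rV.
move=> x xB; rewrite /= patchE; case: ifPn => xK.
  rewrite /= lee_fin normrM mulrC; apply: le_trans (ler_norm _).
  by rewrite ler_wpM2r.
by rewrite out ?mulr0 ?normr0 ?abse_ge0 //; move: xK; rewrite notin_setE.
Qed.

Lemma parts f phi j : Ck 1 f -> test_function phi ->
  \int[mu]_(x in B) (f x * partial j phi x) = - \int[mu]_(x in B) (partial j f x * phi x).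
Proof.
move=> f1 tphi; have [K [M [r [_ _ _ r1 [_ _ pr]]]]] := test_bounds tphi.
have phi1 : Ck 1 phi by case: tphi => s _ _; exact: s.
have i1 : mu.-integrable B (EFin \o (fun x => f x * partial j phi x)).
  by apply: continuous_ball_integrable; apply: (@Ck_continuous _ _ 0); apply: CkM;
    [exact: CkW|exact: Ck_partial].
have i2 : mu.-integrable B (EFin \o (fun x => partial j f x * phi x)).
  by apply: continuous_ball_integrable; apply: (@Ck_continuous _ _ 0); apply: CkM;
    [exact: Ck_partial|exact: CkW].
apply/eqP; rewrite -addr_eq0 -(RintegralD mball i1 i2); apply/eqP.
rewrite -[RHS](@ball_div R n j (fun x => f x * phi x) r r1 (CkM f1 phi1)).
  apply: eq_Rintegral => x _; rewrite partialM; last 2 first.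
  - exact: Ck_derivable f1.
  - exact: Ck_derivable phi1.
  by rewrite [phi x * _]mulrC.
by move=> x rx; rewrite pr // mulr0.
Qed.

Lemma test_partial_bounded phi j : test_function phi ->
  measurable_fun B (partial j phi) /\
  exists2 M : R, 0 <= M & forall x, B x -> `|partial j phi x| <= M.
Proof.
move=> [s _ _]; have pc := Ck_continuous (Ck_partial j (s 1%N)).
split; first by apply: measurable_funTS; exact: continuous_measurable_rV.
have [M M0 HM] := continuous_ball_bounded pc.
by exists M => // x /ltW; exact: HM.
Qed.

Lemma test_bounded phi : test_function phi ->
  measurable_fun B phi /\ exists2 M : R, 0 <= M & forall x, B x -> `|phi x| <= M.
Proof.
move=> [s _ _]; have pc := Ck_continuous (s 0%N).
split; first by apply: measurable_funTS; exact: continuous_measurable_rV.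
have [M M0 HM] := continuous_ball_bounded pc.
by exists M => // x /ltW; exact: HM.
Qed.

Lemma Lp1_cvg_int (f_ : nat -> 'rV[R]_n -> R) f (c : 'rV[R]_n -> R) (M : R) :
  measurable_fun B c -> (forall x, B x -> `|c x| <= M) ->
  (forall k, Lp_ball 1 (f_ k)) -> Lp_ball 1 f -> Lp_cvg mu B 1 f_ f ->
  (fun k => \int[mu]_(x in B) (f_ k x * c x)) @ \oo --> \int[mu]_(x in B) (f x * c x).
Proof.
move=> mc cM fkp fp fkf.
have := @Lp_prod_cvg R n 0 (fun k _ => f_ k) (fun _ => f) c M mc cM
  (fun k _ => fkp k) (fun _ => fp) (fun _ => fkf).
under eq_fun do under eq_Rintegral do rewrite big_ord1 mulrC.
by under eq_Rintegral do rewrite big_ord1 mulrC.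
Qed.

(** Both sides of the integration by parts formula are continuous under L^1 convergence, because a
    test function and its derivatives are bounded. *)
Lemma weak_partial_limit (f_ : nat -> 'rV[R]_n -> R) f g j :
  (forall k, Ck 1 (f_ k)) -> Lp_ball 1 f -> Lp_ball 1 g ->
  Lp_cvg mu B 1 f_ f -> Lp_cvg mu B 1 (fun k => partial j (f_ k)) g ->
  is_weak_partial j f g.
Proof.
move=> fk1 fp gp fkf dfkg; split; [exact: locally_integrable_Lp1..|].
move=> phi tphi.
have [mp [M M0 HM]] := test_bounded tphi.
have [mdp [M' M'0 HM']] := test_partial_bounded j tphi.
have c1 := Lp1_cvg_int mdp HM' (fun k => Lp_ball_continuous 1 (Ck_continuous (fk1 k))) fp fkf.
have c2 := Lp1_cvg_int mp HM
  (fun k => Lp_ball_continuous 1 (Ck_continuous (Ck_partial j (fk1 k)))) gp dfkg.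
have E : (fun k => \int[mu]_(x in B) (f_ k x * partial j phi x)) =
    (fun k => - \int[mu]_(x in B) (partial j (f_ k) x * phi x)).
  by apply/funext => k; rewrite parts.
rewrite E in c1; apply: (cvg_unique _ c1); first exact: norm_hausdorff.
exact: cvgN.
Qed.

Lemma weak_partial_unique f g1 g2 j : is_weak_partial j f g1 -> is_weak_partial j f g2 ->
  {ae mu, forall x, B x -> g1 x = g2 x}.
Proof.
move=> [_ l1 w1] [_ l2 w2].
have l12 : locally_integrable_ball (fun x => g1 x - g2 x).
  split; first by apply: measurable_funB; [exact: l1.1|exact: l2.1].
  move=> K KB cK.
  have mK : measurable K.
    rewrite -[K]setCK; apply: measurableC; apply: open_measurable_rV; rewrite openC.
    by apply: compact_closed; [exact: norm_hausdorff|].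
  have i (g : 'rV[R]_n -> R) : locally_integrable_ball g -> mu.-integrable K (EFin \o g).
    move=> [mg gi]; apply/integrableP; split; last exact: gi.
    by apply/measurable_EFinP; exact: (measurable_funS mball KB mg).
  by have /integrableP[_] := integrableB mK (i _ l1) (i _ l2).
have := fundamental_lemma l12; case.
  move=> phi tphi; have i1 := test_integrable l1 tphi; have i2 := test_integrable l2 tphi.
  transitivity (\int[mu]_(x in B) (g1 x * phi x - g2 x * phi x)).
    by apply: eq_Rintegral => x _; rewrite mulrBl.
  rewrite (RintegralB mball i1 i2).
  by have := w2 _ tphi; rewrite w1 // => /oppr_inj ->; rewrite subrr.
move=> N [mN N0 sub]; exists N; split => // x /= h; apply: sub => /= h'; apply: h => xB.
by apply/eqP; rewrite -subr_eq0; apply/eqP; exact: h'.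
Qed.

Lemma weak_partialP f j : (exists g, is_weak_partial j f g) ->
  is_weak_partial j f (weak_partial j f).
Proof. by move=> [g H]; exact: (@xgetPex _ (fun=> 0) [set g | is_weak_partial j f g] (ex_intro _ g H)). Qed.

Lemma weak_partial_ae f g j : is_weak_partial j f g ->
  {ae mu, forall x, B x -> weak_partial j f x = g x}.
Proof.
move=> H; have Hw : is_weak_partial j f (weak_partial j f) by apply: weak_partialP; exists g.
exact: (weak_partial_unique Hw H).
Qed.

End weak_derivatives.

(** * Null Lagrangians and the constraint |u| = 1 in the limit *)

Section approximable_maps.
Context {R : realType} {n : nat}.
Local Notation mu := (@lebesgue_rV R n).
Local Notation B := (@unit_ball R n).
Implicit Types (u : 'rV[R]_n -> 'rV[R]_n) (A : 'rV[R]_n -> 'M[R]_n).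

(* Closeness to the identity near the sphere in the sense of W^{1,p}_0, with A
   playing the role of the weak Jacobian matrix of u. *)
Definition approximable p u A := exists U : nat -> 'rV[R]_n -> 'rV[R]_n,
  [/\ forall k i, Ck 2 (component (U k) i),
      forall k, exists2 r : R, r < 1 & forall x, r <= nsq x -> U k x = x,
      forall i, Lp_cvg mu B p (fun k => component (U k) i) (component u i)
    & forall i j, Lp_cvg mu B p (fun k => partial j (component (U k) i)) (fun x => A x i j)].

Lemma approximable1 p u A : (forall i, Lp_ball p.+1 (component u i)) ->
  (forall i j, Lp_ball p.+1 (fun x => A x i j)) ->
  approximable p.+1 u A -> approximable 1 u A.
Proof.
move=> up Ap [U [U2 Ur Uu UA]]; exists U; split => //.
- move=> i; apply: (Lp_cvg1 _ (up i) (Uu i)) => k.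
  by apply: Lp_ball_continuous; exact: (Ck_continuous (U2 k i)).
- move=> i j; apply: (Lp_cvg1 _ (Ap i j) (UA i j)) => k.
  by apply: Lp_ball_continuous; exact: (Ck_continuous (Ck_partial j (U2 k i))).
Qed.

Section lag_limit.
Variables (q : nat) (phi : 'rV[R]_n -> R).
Hypothesis phi1 : Ck 1 phi.

(** The [q.+1] factors of the second term of the Lagrangian, the component of u being factor [ord0].
    Both terms thus are products of [q.+1] functions in L^(q+1) with a bounded coefficient. *)
Let F u A (s : 'S_q.+1) (f : {ffun 'I_q.+1 -> 'I_n}) (a : 'I_q.+1) (x : 'rV[R]_n) : R :=
  if unlift ord0 a is Some b then A x (f (lift ord0 b)) (f (s (lift ord0 b)))
  else component u (f ord0) x.

Let lagF u A x : lag q (phi x) (grad phi x) (u x) (A x) =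
  \sum_(s : 'S_q.+1) \sum_(f : {ffun 'I_q.+1 -> 'I_n}) (-1) ^+ s *
    (phi x * (\prod_a A x (f a) (f (s a))) +
     partial (f (s ord0)) phi x * \prod_a F u A s f a x).
Proof.
rewrite lagE; apply: eq_bigr => s _; apply: eq_bigr => f _; congr (_ * (_ + _)).
rewrite big_ord_recl /F unlift_none /component mxE -mulrA mulrCA; congr (_ * (_ * _)).
by apply: eq_bigr => a _; rewrite liftK.
Qed.

Let bounded (f : 'rV[R]_n -> R) : continuous f -> measurable_fun B f /\
  exists M : R, forall x, B x -> `|f x| <= M.
Proof.
move=> fc; split; first by apply: measurable_funTS; exact: continuous_measurable_rV.
have [M M0 HM] := continuous_ball_bounded fc.
by exists M => x /ltW; exact: HM.
Qed.

Let FP u A s f a : (forall i, Lp_ball q.+1 (component u i)) ->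
  (forall i j, Lp_ball q.+1 (fun x => A x i j)) -> Lp_ball q.+1 (F u A s f a).
Proof. by move=> up Ap; rewrite /F; case: unliftP => [b _|_]. Qed.

Let lag_int u A : (forall i, Lp_ball q.+1 (component u i)) ->
  (forall i j, Lp_ball q.+1 (fun x => A x i j)) ->
  mu.-integrable B (EFin \o (fun x => lag q (phi x) (grad phi x) (u x) (A x))) /\
  \int[mu]_(x in B) lag q (phi x) (grad phi x) (u x) (A x) =
  \sum_(s : 'S_q.+1) \sum_(f : {ffun 'I_q.+1 -> 'I_n}) (-1) ^+ s *
    (\int[mu]_(x in B) (phi x * (\prod_a A x (f a) (f (s a)))) +
     \int[mu]_(x in B) (partial (f (s ord0)) phi x * \prod_a F u A s f a x)).
Proof.
move=> up Ap.
have [mphi [M HM]] := bounded (Ck_continuous phi1).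
have i1 (s : 'S_q.+1) (f : {ffun 'I_q.+1 -> 'I_n}) : mu.-integrable B (EFin \o (fun x => phi x * (\prod_a A x (f a) (f (s a))))).
  exact: (Lp_prod_integrable (F := fun a x => A x (f a) (f (s a))) mphi HM (fun m => Ap _ _)).
have i2 (s : 'S_q.+1) (f : {ffun 'I_q.+1 -> 'I_n}) : mu.-integrable B (EFin \o (fun x => partial (f (s ord0)) phi x * \prod_a F u A s f a x)).
  have [mp [M' HM']] := bounded (Ck_continuous (Ck_partial (f (s ord0)) phi1)).
  exact: (Lp_prod_integrable mp HM' (fun m => FP s f m up Ap)).
have i3 (s : 'S_q.+1) (f : {ffun 'I_q.+1 -> 'I_n}) := integrableD mball (i1 s f) (i2 s f).
have i4 (s : 'S_q.+1) (f : {ffun 'I_q.+1 -> 'I_n}) := integrableZl mball ((-1) ^+ s) (i3 s f).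
have E : (fun x => lag q (phi x) (grad phi x) (u x) (A x)) = (fun x =>
  \sum_(s : 'S_q.+1) \sum_(f : {ffun 'I_q.+1 -> 'I_n}) (-1) ^+ s *
    (phi x * (\prod_a A x (f a) (f (s a))) +
     partial (f (s ord0)) phi x * \prod_a F u A s f a x)).
  by apply/funext => x; exact: lagF.
have i5 (s : 'S_q.+1) : mu.-integrable B (EFin \o (fun x =>
  \sum_(f : {ffun 'I_q.+1 -> 'I_n}) (-1) ^+ s *
    (phi x * (\prod_a A x (f a) (f (s a))) +
     partial (f (s ord0)) phi x * \prod_a F u A s f a x))).
  apply: (integrable_fin_sum mball) => f _; exact: (i4 s f).
rewrite E; split; first by apply: (integrable_fin_sum mball) => s _; exact: i5.
rewrite (Rintegral_fin_sum mball); last by move=> s _; exact: i5.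
apply: eq_bigr => s _.
rewrite (Rintegral_fin_sum mball); last by move=> f _; exact: (i4 s f).
apply: eq_bigr => f _.
by rewrite (RintegralZl _ mball (i3 s f)) (RintegralD mball (i1 s f) (i2 s f)).
Qed.

Lemma lag_integrable u A : (forall i, Lp_ball q.+1 (component u i)) ->
  (forall i j, Lp_ball q.+1 (fun x => A x i j)) ->
  mu.-integrable B (EFin \o (fun x => lag q (phi x) (grad phi x) (u x) (A x))).
Proof. by move=> up Ap; case: (lag_int up Ap). Qed.

(** The integrals for the approximating maps do not depend on k, and each product in them converges
    by [Lp_prod_cvg]. *)
Lemma lag_limit u A : (forall i, Lp_ball q.+1 (component u i)) ->
  (forall i j, Lp_ball q.+1 (fun x => A x i j)) ->
  approximable q.+1 u A ->
  \int[mu]_(x in B) lag q (phi x) (grad phi x) (u x) (A x) =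
  \int[mu]_(x in B) lag q (phi x) (grad phi x) x (jac id x).
Proof.
move=> up Ap [U [U2 Ur Uu UA]].
have Up k i : Lp_ball q.+1 (component (U k) i).
  by apply: Lp_ball_continuous; exact: (Ck_continuous (U2 k i)).
have UAp k i j : Lp_ball q.+1 (fun x => jac (U k) x i j).
  rewrite (_ : (fun x => _) = partial j (component (U k) i)); last by apply/funext => x; rewrite mxE.
  by apply: Lp_ball_continuous; exact: (Ck_continuous (Ck_partial j (U2 k i))).
have UA' i j : Lp_cvg mu B q.+1 (fun k x => jac (U k) x i j) (fun x => A x i j).
  rewrite (_ : (fun k x => _) = fun k => partial j (component (U k) i)) //.
  by apply/funext => k; apply/funext => x; rewrite mxE.
have [_ IA] := lag_int up Ap.
have IU k := (lag_int (Up k) (UAp k)).2.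
have C : (fun k => \int[mu]_(x in B) lag q (phi x) (grad phi x) (U k x) (jac (U k) x)) @ \oo -->
    \int[mu]_(x in B) lag q (phi x) (grad phi x) (u x) (A x).
  rewrite IA; under eq_fun do rewrite IU.
  have [mphi [M HM]] := bounded (Ck_continuous phi1).
  apply: cvg_fin_sum => s _; apply: cvg_fin_sum => f _.
  apply: cvgM; first exact: cvg_cst.
  apply: cvgD.
    exact: (@Lp_prod_cvg R n q (fun k a x => jac (U k) x (f a) (f (s a)))
      (fun a x => A x (f a) (f (s a))) phi M mphi HM
      (fun k m => UAp k _ _) (fun m => Ap _ _) (fun m => UA' _ _)).
  have [mp [M' HM']] := bounded (Ck_continuous (Ck_partial (f (s ord0)) phi1)).
  apply: (@Lp_prod_cvg R n q (fun k a => F (U k) (jac (U k)) s f a) (F u A s f) _ M' mp HM'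
    (fun k m => FP s f m (Up k) (UAp k)) (fun m => FP s f m up Ap)) => m.
  by rewrite /F; case: unliftP.
have Ccst : (fun k => \int[mu]_(x in B) lag q (phi x) (grad phi x) (U k x) (jac (U k) x)) =
    cst (\int[mu]_(x in B) lag q (phi x) (grad phi x) x (jac id x)).
  apply/funext => k; have [r r1 Hr] := Ur k.
  exact: (@lag_integral _ _ _ _ phi1 (U k) r r1 (U2 k) Hr).
rewrite Ccst in C.
exact: (cvg_unique (@norm_hausdorff _ _) C (cvg_cst _)).
Qed.

End lag_limit.

Section orthogonality.
Implicit Types (f g a c : 'rV[R]_n -> R).

(** The difference c_k a_k - c a is compared with a fixed a_m close to a. Since a_m is continuous,
    it is bounded on the ball, and (c_k - c) a_m tends to 0; the other errors are bounded multiples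
    of a_k - a and a_m - a. *)
Lemma Lp1_cvg_bounded_mul (c_ a_ : nat -> 'rV[R]_n -> R) c a (M : R) :
  (forall k, measurable_fun B (c_ k)) -> measurable_fun B c ->
  (forall k x, B x -> `|c_ k x| <= M) -> (forall x, B x -> `|c x| <= M) ->
  Lp_cvg mu B 1 c_ c -> (forall k, continuous (a_ k)) -> Lp_ball 1 a ->
  Lp_cvg mu B 1 a_ a -> Lp_cvg mu B 1 (fun k x => c_ k x * a_ k x) (fun x => c x * a x).
Proof.
move=> mck mc ckM cM ckc ac ap aka.
have akp k : Lp_ball 1 (a_ k) by exact: Lp_ball_continuous.
have Mi : mu.-integrable B (EFin \o (fun x => M ^+ 1)) by exact: integrable_cst_ball.
have ckp k : Lp_ball 1 (c_ k).
  by apply: (Lp_ball_dom (mck k) Mi) => x xB; rewrite !expr1 ckM.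
have cp : Lp_ball 1 c by apply: (Lp_ball_dom mc Mi) => x xB; rewrite !expr1 cM.
have ckap k : Lp_ball 1 (fun x => c_ k x * a_ k x) by apply: (Lp_ballM (mck k) (ckM k)).
have cap : Lp_ball 1 (fun x => c x * a x) by apply: (Lp_ballM mc cM).
apply/(Lp_cvgE ckap cap).
move/(Lp_cvgE akp ap) : (aka) => aka'.
move/(Lp_cvgE ckp cp) : (ckc) => ckc'.
pose M1 := `|M| + 1.
have M10 : 0 < M1 by rewrite ltr_wpDl.
have MM1 : M <= M1 by rewrite (le_trans (ler_norm _)) // lerDl.
apply/cvgrPdist_le => e e0.
have e3 : 0 < e / (4 * M1) by rewrite divr_gt0 // mulr_gt0.
have [m Hm] : exists m, rnp 1 (fun x => a_ m x - a x) <= e / (4 * M1).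
  have [N _ HN] : \forall k \near \oo, `|0 - rnp 1 (fun x => a_ k x - a x)| <= e / (4 * M1).
    by move/cvgrPdist_le : aka'; apply.
  by exists N; have := HN N (leqnn N); rewrite /= sub0r normrN ger0_norm ?rnp_ge0.
have [N0 N00 HN0] := continuous_ball_bounded (ac m).
pose N := N0 + 1.
have Np : 0 < N by rewrite ltr_wpDl.
have e4 : 0 < e / (4 * N) by rewrite divr_gt0 // mulr_gt0.
near=> k.
have hk1 : rnp 1 (fun x => a_ k x - a x) <= e / (4 * M1).
  rewrite -[leLHS]ger0_norm ?rnp_ge0 // -normrN -sub0r.
  by near: k; move/cvgrPdist_le : aka'; apply.
have hk2 : rnp 1 (fun x => c_ k x - c x) <= e / (4 * N).
  rewrite -[leLHS]ger0_norm ?rnp_ge0 // -normrN -sub0r.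
  by near: k; move/cvgrPdist_le : ckc'; apply.
rewrite sub0r normrN ger0_norm ?rnp_ge0 //.
have j1 := Lp_ball_integrable (Lp_ballB (akp k) ap).
have j2 := Lp_ball_integrable (Lp_ballB (akp m) ap).
have j3 := Lp_ball_integrable (Lp_ballB (ckp k) cp).
have l1 := integrableZl mball M1 j1; have l2 := integrableZl mball (2 * M1) j2.
have l3 := integrableZl mball N j3.
apply: (@le_trans _ _ (M1 * rnp 1 (fun x => a_ k x - a x) +
   (2 * M1 * rnp 1 (fun x => a_ m x - a x) + N * rnp 1 (fun x => c_ k x - c x)))).
  rewrite -(RintegralZl _ mball j1) -(RintegralZl _ mball j2) -(RintegralZl _ mball j3).
  rewrite -(RintegralD mball l2 l3) -(RintegralD mball l1 (integrableD mball l2 l3)).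
  apply: le_Rintegral; first exact: mball.
  - exact: (Lp_ball_integrable (Lp_ballB (ckap k) cap)).
  - exact: (integrableD mball l1 (integrableD mball l2 l3)).
  - move=> x xB; rewrite !expr1.
    have h1 : `|c_ k x * (a_ k x - a x)| <= M1 * `|a_ k x - a x|.
      by rewrite normrM ler_wpM2r // (le_trans (ckM k x xB)).
    have cc : `|c_ k x - c x| <= 2 * M1.
      apply: (le_trans (ler_normB _ _)); rewrite mulr_natl mulr2n.
      by apply: lerD; [exact: le_trans (ckM k x xB) MM1|exact: le_trans (cM x xB) MM1].
    have h2 : `|(c_ k x - c x) * (a_ m x - a x)| <= 2 * M1 * `|a_ m x - a x|.
      by rewrite normrM ler_wpM2r.
    have h3 : `|(c_ k x - c x) * a_ m x| <= N * `|c_ k x - c x|.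
      rewrite normrM mulrC ler_wpM2r // (le_trans (HN0 x (ltW xB))) //.
      by rewrite lerDl.
    rewrite (_ : _ - _ = c_ k x * (a_ k x - a x) + ((c_ k x - c x) * a_ m x -
      (c_ k x - c x) * (a_ m x - a x))); last by ring.
    apply: (le_trans (ler_normD _ _)); apply: lerD => //.
    apply: (le_trans (ler_normB _ _)); rewrite addrC; exact: lerD.
have t1 : M1 * rnp 1 (fun x => a_ k x - a x) <= e / 4.
  by rewrite (le_trans (ler_wpM2l (ltW M10) hk1)) // le_eqVlt; apply/orP; left;
    apply/eqP; field; rewrite gt_eqF.
have t2 : 2 * M1 * rnp 1 (fun x => a_ m x - a x) <= e / 2.
  have M20 : 0 <= 2 * M1 by rewrite mulr_ge0 // ltW.
  by rewrite (le_trans (ler_wpM2l M20 Hm)) // le_eqVlt; apply/orP; left;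
    apply/eqP; field; rewrite gt_eqF.
have t3 : N * rnp 1 (fun x => c_ k x - c x) <= e / 4.
  by rewrite (le_trans (ler_wpM2l (ltW Np) hk2)) // le_eqVlt; apply/orP; left;
    apply/eqP; field; rewrite gt_eqF.
by lra.
Unshelve. all: by end_near. Qed.

Lemma Lp1_cvg_lipschitz (I : finType) (f_ : I -> nat -> 'rV[R]_n -> R) (f : I -> 'rV[R]_n -> R)
    (h_ : nat -> 'rV[R]_n -> R) h (C : R) :
  (forall i k, Lp_ball 1 (f_ i k)) -> (forall i, Lp_ball 1 (f i)) ->
  (forall i, Lp_cvg mu B 1 (f_ i) (f i)) ->
  (forall k, Lp_ball 1 (h_ k)) -> Lp_ball 1 h ->
  (forall k x, B x -> `|h_ k x - h x| <= C * \sum_i `|f_ i k x - f i x|) ->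
  Lp_cvg mu B 1 h_ h.
Proof.
move=> fkp fp fkf hkp hp H; apply/(Lp_cvgE hkp hp).
have j i k := Lp_ball_integrable (Lp_ballB (fkp i k) (fp i)).
have js k : mu.-integrable B (EFin \o (fun x => \sum_i `|f_ i k x - f i x| ^+ 1)).
  by apply: (integrable_fin_sum mball) => i _; exact: j.
have S0 : (fun k => C * \sum_i rnp 1 (fun x => f_ i k x - f i x)) @ \oo --> (0 : R).
  rewrite -[X in _ --> X](mulr0 C); apply: cvgM; first exact: cvg_cst.
  rewrite -[X in _ --> X](_ : \sum_(i : I) (0 : R) = 0); last by rewrite big1.
  by apply: cvg_fin_sum => i _; apply/(Lp_cvgE (fkp i) (fp i)).
apply: (squeeze_cvgr _ (cvg_cst 0) S0); near=> k; rewrite rnp_ge0 /=.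
rewrite -(Rintegral_fin_sum mball); last by move=> i _; exact: j.
rewrite -(RintegralZl _ mball (js k)); apply: le_Rintegral; first exact: mball.
- exact: (Lp_ball_integrable (Lp_ballB (hkp k) hp)).
- exact: (integrableZl mball C (js k)).
- by move=> x xB; rewrite expr1; under eq_bigr do rewrite expr1; exact: H.
Unshelve. all: by end_near. Qed.

(** A smooth Lipschitz function of y which is constant on the sphere. Its gradient y / [jb y] is
    bounded, unlike that of |y|^2, so the chain rule passes to L^1 limits although the
    approximations of u need not be bounded. *)
Let jb (y : 'rV[R]_n) : R := Num.sqrt (1 + nsq y).

Let jb1 y : 1 <= jb y.
Proof. by rewrite -[leLHS]sqrtr1 ler_sqrt ?addr_ge0 ?nsq_ge0 // lerDl nsq_ge0. Qed.

Let jb0 y : 0 < jb y. Proof. exact: lt_le_trans (jb1 y). Qed.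

Let jb2 y : jb y ^+ 2 = 1 + nsq y.
Proof. by rewrite sqr_sqrtr // addr_ge0 // nsq_ge0. Qed.

Let jbc (y : 'rV[R]_n) (i : 'I_n) : `|y 0 i| <= jb y.
Proof.
rewrite -[leLHS]sqrtr_sqr ler_sqrt ?addr_ge0 ?nsq_ge0 //.
by rewrite (le_trans (coord_sqr_le y i)) // lerDr.
Qed.

Let jb_lip (y z : 'rV[R]_n) : `|jb y - jb z| <= \sum_l `|y 0 l - z 0 l|.
Proof.
have s0 : 0 < jb y + jb z by rewrite addr_gt0.
rewrite -(ler_pM2r s0) -{1}[jb y + jb z]gtr0_norm // -normrM.
rewrite -subr_sqr !jb2 opprD addrACA subrr add0r /nsq -sumrB mulr_suml.
apply: (le_trans (ler_norm_sum _ _ _)); apply: ler_sum => l _.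
rewrite subr_sqr normrM ler_wpM2l //; apply: (le_trans (ler_normD _ _)).
by apply: lerD; exact: jbc.
Qed.

Let V_lip (i : 'I_n) (y z : 'rV[R]_n) : `|y 0 i / jb y - z 0 i / jb z| <= 2 * \sum_l `|y 0 l - z 0 l|.
Proof.
rewrite (_ : _ - _ = (y 0 i - z 0 i) / jb y + z 0 i / jb z * ((jb z - jb y) / jb y)); last first.
  by field; rewrite !gt_eqF.
have iy : `|(jb y)^-1| <= 1 by rewrite normfV gtr0_norm // invf_le1.
have S0 : 0 <= \sum_l `|y 0 l - z 0 l| by apply: sumr_ge0.
apply: (le_trans (ler_normD _ _)); rewrite mulr_natl mulr2n; apply: lerD.
  rewrite normrM -[leRHS]mulr1; apply: ler_pM => //.
  by rewrite (bigD1 i) //= lerDl sumr_ge0.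
rewrite normrM -[leRHS]mul1r; apply: ler_pM => //.
  by rewrite normrM normfV [`|jb z|]gtr0_norm // ler_pdivrMr // mul1r jbc.
rewrite normrM -[leRHS]mulr1; apply: ler_pM => //.
by rewrite distrC jb_lip.
Qed.

(** The chain rule for [jb] along the approximations shows that u A / [jb u] is the weak gradient of
    [jb u]. As |u| = 1, the latter function is the constant sqrt 2, so its weak gradient
    vanishes. *)
Lemma weak_jacobian_orthogonal u A :
  (forall i, Lp_ball 1 (component u i)) -> (forall i j, Lp_ball 1 (fun x => A x i j)) ->
  approximable 1 u A -> {ae mu, forall x, B x -> enorm (u x) = 1} ->
  {ae mu, forall x, B x -> u x *m A x = 0}.
Proof.
move=> up Ap [U [U2 _ Uu UA]] u1.
pose V i (y : 'rV[R]_n) := y 0 i / jb y.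
have Vb (i : 'I_n) (y : 'rV[R]_n) : `|V i y| <= 1.
  by rewrite /V normrM normfV [`|jb y|]gtr0_norm // ler_pdivrMr // mul1r jbc.
have jbE y : jb y = (1 + nsq y) `^ (2^-1).
  by rewrite powR12_sqrt // addr_ge0 // nsq_ge0.
have Up k i : Lp_ball 1 (component (U k) i).
  by apply: Lp_ball_continuous; exact: (Ck_continuous (U2 k i)).
have CkS k : Ck 2 (fun x => 1 + nsq (U k x)).
  by apply: CkD; [exact: Ck_cst|apply: Ck_sum => i _; apply: CkX; exact: (U2 k i)].
have S0 k x : 0 < 1 + nsq (U k x) by rewrite ltr_pwDl // nsq_ge0.
have CkG k : Ck 2 (fun x => jb (U k x)).
  by under eq_fun do rewrite jbE; apply: Ck_powR.
have CkV k i : Ck 2 (fun x => V i (U k x)).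
  apply: CkM; first exact: (U2 k i).
  rewrite (_ : (fun x => _) = fun x => jb (U k x) `^ (-1)); first exact: Ck_powR.
  by apply/funext => x; rewrite powR_inv1 // ltW.
have dG k j x : partial j (fun x => jb (U k x)) x =
    \sum_i V i (U k x) * partial j (component (U k) i) x.
  under [X in partial j X]eq_fun do rewrite jbE.
  rewrite partial_powR //; last exact: Ck_derivable (CkS k).
  have dsq i : is_derive x (delta_mx 0 j) (fun y => U k y 0 i ^+ 2)
      (2 * U k x 0 i * partial j (component (U k) i) x).
    have h : is_derive x (delta_mx 0 j) (component (U k) i) (partial j (component (U k) i) x).
      by apply: Ck_is_derive; exact: (U2 k i).
    by have := is_deriveX 2 h => /is_derive_eq; apply; rewrite expr1.
  have dn : partial j (fun y => 1 + nsq (U k y)) x =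
      \sum_i 2 * U k x 0 i * partial j (component (U k) i) x.
    have [_ E] := is_deriveD (is_derive_cst (1 : R) x (delta_mx 0 j)) (is_derive_sum dsq).
    rewrite add0r in E; rewrite -E /partial.
    have -> : (fun y => 1 + nsq (U k y)) = cst 1 + \sum_i (fun y => U k y 0 i ^+ 2).
      by apply/funext => y; rewrite [RHS]/= fct_sumE.
    by [].
  rewrite dn mulr_sumr; apply: eq_bigr => i _.
  rewrite (_ : 2^-1 - 1 = - 2^-1); last by lra.
  rewrite powRN -jbE /V /component; field; exact: lt0r_neq0.
have mu_u i : measurable_fun B (fun x => u x 0 i) by case: (up i).
have mG : measurable_fun B (fun x => jb (u x)).
  have mS : measurable_fun B (fun x => 1 + nsq (u x)).
    apply: measurable_funD; first exact: measurable_cst.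
    by apply: measurable_sum => i; apply: measurable_funX.
  exact: (measurableT_comp (continuous_measurable_fun (@sqrt_continuous R)) mS).
have mV i : measurable_fun B (fun x => V i (u x)).
  apply: measurable_funM => //.
  rewrite (_ : (fun x => _) = (@powR R ^~ (-1)) \o (fun x => jb (u x))); last first.
    by apply/funext => x /=; rewrite powR_inv1 // ltW.
  by apply: measurableT_comp => //; exact: measurable_powR.
have GkLp k : Lp_ball 1 (fun x => jb (U k x)).
  by apply: Lp_ball_continuous; exact: (Ck_continuous (CkG k)).
have jb_sum (y : 'rV[R]_n) : jb y <= 1 + \sum_l `|y 0 l|.
  have := jb_lip y 0; rewrite /jb {2}/nsq big1 ?addr0 ?sqrtr1; last by move=> i _; rewrite mxE expr0n.
  under eq_bigr do rewrite mxE subr0.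
  move=> h; rewrite [leRHS]addrC -lerBlDr; apply: le_trans h; exact: ler_norm.
have GLp : Lp_ball 1 (fun x => jb (u x)).
  have si : mu.-integrable B (EFin \o (fun x => \sum_l `|component u l x| ^+ 1)).
    by apply: (integrable_fin_sum mball) => l _; exact: Lp_ball_integrable.
  apply: (Lp_ball_dom mG (integrableD mball (integrable_cst_ball 1) si)) => x _.
  rewrite [leLHS]expr1 (ger0_norm (ltW (jb0 _))); apply: (le_trans (jb_sum _)); rewrite /= lerD2l.
  by under [leRHS]eq_bigr do rewrite expr1.
have VkLp k i : Lp_ball 1 (fun x => V i (U k x)).
  by apply: Lp_ball_continuous; exact: (Ck_continuous (CkV k i)).
have VLp i : Lp_ball 1 (fun x => V i (u x)).
  by apply: (Lp_ball_dom (mV i) (integrable_cst_ball 1)) => x _; rewrite expr1.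
have cG : Lp_cvg mu B 1 (fun k x => jb (U k x)) (fun x => jb (u x)).
  apply: (@Lp1_cvg_lipschitz _ (fun i k => component (U k) i) (component u) _ _ 1) => //.
  by move=> k x _; rewrite mul1r; exact: jb_lip.
have cV i : Lp_cvg mu B 1 (fun k x => V i (U k x)) (fun x => V i (u x)).
  apply: (@Lp1_cvg_lipschitz _ (fun i k => component (U k) i) (component u) _ _ 2) => //.
  by move=> k x _; exact: V_lip.
have VALp i j : Lp_ball 1 (fun x => V i (u x) * A x i j).
  by apply: (@Lp_ballM _ _ 1 _ _ 1).
have dUc k i j : continuous (partial j (component (U k) i)).
  exact: (Ck_continuous (Ck_partial j (U2 k i))).
have VUc k i j : continuous (fun x => V i (U k x) * partial j (component (U k) i) x).
  by apply: (@Ck_continuous _ _ 1); apply: CkM; [exact: CkW|exact: Ck_partial].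
have cVA i j : Lp_cvg mu B 1 (fun k x => V i (U k x) * partial j (component (U k) i) x)
    (fun x => V i (u x) * A x i j).
  apply: (@Lp1_cvg_bounded_mul _ _ _ _ 1) => // k.
  by apply: measurable_funTS; exact: continuous_measurable_rV (Ck_continuous (CkV k i)).
pose h j x := \sum_i V i (u x) * A x i j.
have hLp j : Lp_ball 1 (h j).
  have si : mu.-integrable B (EFin \o (fun x => \sum_i `|V i (u x) * A x i j| ^+ 1)).
    by apply: (integrable_fin_sum mball) => l _; exact: Lp_ball_integrable.
  apply: (Lp_ball_dom _ si) => [|x _].
    by apply: measurable_sum => i; case: (VALp i j).
  by rewrite expr1; under eq_bigr do rewrite expr1; exact: ler_norm_sum.
have ch j : Lp_cvg mu B 1 (fun k => partial j (fun x => jb (U k x))) (h j).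
  apply: (@Lp1_cvg_lipschitz _ (fun i k x => V i (U k x) * partial j (component (U k) i) x)
    (fun i x => V i (u x) * A x i j) _ _ 1) => //.
  - by move=> i k; exact: Lp_ball_continuous.
  - by move=> k; apply: Lp_ball_continuous; exact: (Ck_continuous (Ck_partial j (CkG k))).
  - by move=> k x _; rewrite mul1r dG /h -sumrB; exact: ler_norm_sum.
have wp j : is_weak_partial j (fun x => jb (u x)) (h j).
  by apply: (weak_partial_limit (f_ := fun k x => jb (U k x))) => // k; exact: CkW.
have h0 j : {ae mu, forall x, B x -> h j x = 0}.
  apply: fundamental_lemma; first exact: locally_integrable_Lp1.
  move=> phi tphi; have [_ _ /(_ _ tphi) W] := wp j.
  apply: oppr_inj; rewrite oppr0 -W.
  (* The constraint enters here: almost everywhere [jb (u x)] is sqrt 2, and a constant has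
     classical derivative 0. *)
  have E : \int[mu]_(x in B) (jb (u x) * partial j phi x) =
      \int[mu]_(x in B) (Num.sqrt 2 * partial j phi x).
    congr fine; apply: ae_eq_integral => //.
    - exact: mball.
    - apply/measurable_EFinP; apply: measurable_funM => //.
      by have [] := test_partial_bounded j tphi.
    - apply/measurable_EFinP; apply: measurable_funM => //.
      by have [] := test_partial_bounded j tphi.
    - case: u1 => N [mN N0 sub]; exists N; split => // x /= hx; apply: sub => /= ux.
      apply: hx => xB; congr EFin; rewrite /jb nsqE ux // expr1n.
      by rewrite (_ : 1 + 1 = 2).
  rewrite E parts //; last exact: Ck_cst.
  under eq_Rintegral do rewrite partial_cst mul0r.
  by rewrite /Rintegral integral0 oppr0.
have H : {ae mu, forall x, forall j, B x -> h j x = 0}.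
  exact: (@filter_forall _ _ (fun (j : 'I_n) (x : 'rV[R]_n) => B x -> h j x = 0) (almost_everywhere mu) _ h0).
have H2 : {ae mu, forall x, B x -> enorm (u x) = 1} by [].
apply: filterS2 H H2 => x Hx ux xB; apply/rowP => j; rewrite !mxE.
have := Hx j xB; rewrite /h; under eq_bigr do rewrite /V mulrAC.
by rewrite -mulr_suml => /eqP; rewrite mulf_eq0 invr_eq0 (gt_eqF (jb0 _)) orbF => /eqP.
Qed.

End orthogonality.
End approximable_maps.

(** * Dominated convergence and Fatou's lemma on the ball *)

Section ball_limits.
Context {R : realType} {n : nat}.
Local Notation mu := (@lebesgue_rV R n).
Local Notation B := (@unit_ball R n).
Implicit Types (f g : 'rV[R]_n -> R).

Lemma Rintegral_dominated_ae (f_ : nat -> 'rV[R]_n -> R) f g :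
  (forall k, measurable_fun B (f_ k)) -> measurable_fun B f ->
  {ae mu, forall x, B x -> f_ k x @[k --> \oo] --> f x} ->
  mu.-integrable B (EFin \o g) -> {ae mu, forall x, B x -> forall k, `|f_ k x| <= g x} ->
  mu.-integrable B (EFin \o f) /\
  (\int[mu]_(x in B) f_ k x) @[k --> \oo] --> (\int[mu]_(x in B) f x).
Proof.
move=> mf_ mf fcv gi fg.
have := @dominated_convergence _ _ R mu B mball (fun k x => (f_ k x)%:E) (EFin \o f) (EFin \o g).
case.
- by move=> k; exact/measurable_EFinP.
- exact/measurable_EFinP.
- apply: filterS fcv => x h xB; apply: cvg_EFin; first by near=> m.
  exact: h.
- by [].
- by apply: filterS fg => x h k xB; rewrite /= lee_fin; exact: h.
move=> fi _ C; split => //.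
apply: fine_cvg; rewrite (fineK (integrable_fin_num mball fi)); exact: C.
Unshelve. all: by end_near. Qed.

Lemma Rintegral_dominated (f_ : nat -> 'rV[R]_n -> R) f g :
  (forall k, measurable_fun B (f_ k)) -> measurable_fun B f ->
  {ae mu, forall x, B x -> f_ k x @[k --> \oo] --> f x} ->
  mu.-integrable B (EFin \o g) -> (forall k x, B x -> `|f_ k x| <= g x) ->
  mu.-integrable B (EFin \o f) /\
  (\int[mu]_(x in B) f_ k x) @[k --> \oo] --> (\int[mu]_(x in B) f x).
Proof.
move=> mf_ mf fcv gi fg; apply: (Rintegral_dominated_ae mf_ mf fcv gi).
by apply: aeW => x xB k; exact: fg.
Qed.

Lemma fatou_ball (f_ : nat -> 'rV[R]_n -> R) f (C : R) :
  (forall k, measurable_fun B (f_ k)) -> measurable_fun B f ->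
  (forall k x, B x -> 0 <= f_ k x) -> (forall x, B x -> 0 <= f x) ->
  {ae mu, forall x, B x -> f_ k x @[k --> \oo] --> f x} ->
  (forall k, mu.-integrable B (EFin \o f_ k)) ->
  (forall k, \int[mu]_(x in B) f_ k x <= C) ->
  mu.-integrable B (EFin \o f) /\ \int[mu]_(x in B) f x <= C.
Proof.
move=> mf_ mf f_0 f0 fcv fi fC.
have mE k : measurable_fun B (EFin \o f_ k) by exact/measurable_EFinP.
have me : measurable_fun B (fun x => limn_einf (fun k => (f_ k x)%:E)).
  have -> : (fun x => limn_einf (fun k => (f_ k x)%:E)) =
      (fun x => - limn_esup (fun k => - (f_ k x)%:E))%E.
    by apply/funext => x; rewrite -limn_einfN; congr limn_einf; apply/funext => k; exact: (esym (oppeK _)).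
  apply: measurableT_comp => //; apply: measurable_fun_limn_esup => k.
  by apply: measurableT_comp => //; exact: mE.
have H : (\int[mu]_(x in B) (f x)%:E <= C%:E)%E.
  have -> : (\int[mu]_(x in B) (f x)%:E = \int[mu]_(x in B) limn_einf (fun k => (f_ k x)%:E))%E.
    apply: ae_eq_integral; [exact: mball|exact/measurable_EFinP|exact: me|].
    apply: filterS fcv => x h xB.
    have H1 : (f_ k x)%:E @[k --> \oo] --> (f x)%:E by apply: cvg_EFin; [near=> k|exact: h].
    have H2 : cvgn (fun k => (f_ k x)%:E) by apply/cvg_ex; exists (f x)%:E.
    rewrite (is_cvg_limn_einfE H2); apply/esym; exact: (cvg_lim (@ereal_hausdorff R) H1).
  have f_E0 (k : nat) (x : 'rV[R]_n) : B x -> (0 <= (EFin \o f_ k) x)%E.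
    by move=> xB; rewrite lee_fin f_0.
  apply: (le_trans (fatou mu mball mE f_E0)).
  rewrite limn_einf_lim; apply: lime_le; first exact: is_cvg_einfs.
  near=> k; apply: (@le_trans _ _ (\int[mu]_(x in B) (f_ k x)%:E)%E).
    by apply: ereal_inf_lbound; exists k => /=.
  rewrite -(fineK (integrable_fin_num mball (fi k))) lee_fin; exact: fC.
have I : mu.-integrable B (EFin \o f).
  apply/integrableP; split; first exact/measurable_EFinP.
  apply: le_lt_trans (ltry C); apply: le_trans H; apply: ge0_le_integral => //.
  - exact: mball.
  - by apply: measurableT_comp => //; exact/measurable_EFinP.
  - exact/measurable_EFinP.
  - by move=> x xB; rewrite /= ger0_norm ?f0.
split => //; rewrite -lee_fin /Rintegral fineK //; exact: (integrable_fin_num mball I).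
Unshelve. all: by end_near. Qed.

End ball_limits.

(** * Traces and a Hardy inequality *)

Section sphere.
Context {R : realType} {m : nat}.
Local Notation n := m.+1.
Local Notation mu := (@lebesgue_rV R n).
Local Notation B := (@unit_ball R n).

Lemma lebesgue_rV_set0 : mu [set 0] = 0%E.
Proof.
have -> : [set 0] = [set x : 'rV[R]_n | forall i, (0 : 'rV[R]_n) 0 i <= x 0 i <= (0 : 'rV[R]_n) 0 i].
  apply/seteqP; split => [x -> i|x h]; first by rewrite lexx.
  apply/rowP => i; apply/le_anti; have /andP[h1 h2] := h i.
  by rewrite h1 h2.
rewrite lebesgue_rV_box; last by [].
by rewrite big_ord_recl subrr mul0r.
Qed.

Lemma enorm_eq0 (x : 'rV[R]_n) : enorm x = 0 -> x = 0.
Proof.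
move=> h; apply/rowP => i; rewrite mxE; apply/eqP; rewrite -normr_eq0 eq_le normr_ge0 andbT.
by rewrite -h coord_le_enorm.
Qed.

Lemma enorm0 : enorm (0 : 'rV[R]_n) = 0.
Proof. by rewrite /enorm big1 ?sqrtr0 // => i _; rewrite mxE expr0n. Qed.

Lemma enorm_radial (x : 'rV[R]_n) : x != 0 -> enorm (radial x) = 1.
Proof.
move=> x0; have e0 : enorm x != 0 by apply: contra_neq x0 => /enorm_eq0.
have ep : 0 < enorm x by rewrite lt_def e0 enorm_ge0.
rewrite /radial {1}/enorm; under eq_bigr do rewrite mxE exprMn.
rewrite -mulr_sumr -/(nsq x) nsqE -exprMn mulVf // expr1n sqrtr1; exact: erefl.
Qed.

(** The surface measure is n times the image under [radial] of Lebesgue measure on the ball, and n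
    >= 1. The origin, which [radial] does not send to the sphere, is negligible. *)
Lemma sphere_integral_ge (F : 'rV[R]_n -> \bar R) : measurable_fun setT F ->
  (forall x, 0%E <= F x)%E ->
  (\int[mu]_(x in B) F (radial x) <= \int[sphere_measure]_(x in unit_sphere) F x)%E.
Proof.
move=> mF F0.
have mS : measurable (@unit_sphere R n).
  rewrite (_ : unit_sphere = (@enorm R n) @^-1` [set 1]); last by [].
  rewrite -[X in measurable X]setTI; apply: measurable_enorm => //.
have mrS : measurable (@radial R n @^-1` unit_sphere).
  by rewrite -[X in measurable X]setTI; exact: measurable_radial.
pose m1 := mrestr mu (@measurable_unit_ball R n) : {measure set _ -> \bar R}.
pose m2 := measure_function_pushforward__canonical__measure_function_Measure
  m1 (@measurable_radial R n).
have -> : (\int[sphere_measure]_(x in unit_sphere) F x =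
  \int[mscale (NngNum (ler0n R n)) m2]_(x in unit_sphere) F x)%E.
  exact: eq_measure_integral.
rewrite ge0_integral_mscale //; last exact: measurable_funTS.
have -> : (\int[m2]_(x in unit_sphere) F x = \int[m1]_(x in @radial R n @^-1` unit_sphere) (F \o @radial R n) x)%E.
  apply: ge0_integral_pushforward => //; first exact: measurable_radial.
  exact: measurable_funTS.
have mFr : measurable_fun setT (F \o @radial R n).
  by apply: measurableT_comp => //; exact: measurable_radial.
have mI : measurable ((@radial R n @^-1` unit_sphere) `&` B) by apply: measurableI => //; exact: mball.
have I0 : (0 <= \int[m1]_(x in (@radial R n @^-1` unit_sphere) `&` B) (F \o @radial R n) x)%E.
  by apply: integral_ge0 => x _; exact: F0.
have s1 : (\int[m1]_(x in (@radial R n @^-1` unit_sphere) `&` B) (F \o @radial R n) x <=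
    \int[m1]_(x in @radial R n @^-1` unit_sphere) (F \o @radial R n) x)%E.
  apply: ge0_subset_integral => //; first exact: measurable_funTS.
  by move=> x _; exact: F0.
have s2 : (\int[m1]_(x in (@radial R n @^-1` unit_sphere) `&` B) (F \o @radial R n) x =
    \int[mu]_(x in (@radial R n @^-1` unit_sphere) `&` B) (F \o @radial R n) x)%E.
  apply: eq_measure_integral => A mA AS; rewrite /m1 /= /mrestr setIidl // => x /AS [].
  by [].
have s3 : (\int[mu]_(x in (@radial R n @^-1` unit_sphere) `&` B) (F \o @radial R n) x =
   \int[mu]_(x in B) F (radial x))%E.
  have D0 : mu [set 0] = 0%E := lebesgue_rV_set0.
  have m0 : measurable [set (0 : 'rV[R]_n)].
    have -> : [set (0 : 'rV[R]_n)] = (@enorm R n) @^-1` [set 0].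
      apply/seteqP; split => [x ->|x]; last exact: enorm_eq0.
      exact: enorm0.
    by rewrite -[X in measurable X]setTI; exact: measurable_enorm.
  rewrite integral_mkcondl.
  apply: ae_eq_integral; [exact: mball|..].
  - apply: measurable_funTS; apply/(measurable_restrictT _ mrS); exact: measurable_funTS.
  - exact: measurable_funTS.
  - exists [set (0 : 'rV[R]_n)]; split; [exact: m0|exact: D0|].
    move=> x h; apply: contrapT => /eqP x0; apply: h => xB.
    have xS : x \in @radial R n @^-1` unit_sphere by apply: mem_set; exact: (enorm_radial x0).
    rewrite /patch xS; exact: erefl.
rewrite -s3 -s2; apply: (le_trans s1).
rewrite -[leLHS]mul1e; apply: lee_wpmul2r; first exact: le_trans I0 s1.
by rewrite lee_fin ler1n.
Qed.

End sphere.

(** * Divergence theorem for fields vanishing on the sphere *)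

Section divergence.
Context {R : realType} {m : nat}.
Local Notation n := m.+1.
Local Notation mu := (@lebesgue_rV R n).
Local Notation B := (@unit_ball R n).
Implicit Types (f g : 'rV[R]_n -> R).

Lemma nsqZ (c : R) (x : 'rV[R]_n) : nsq (c *: x) = c ^+ 2 * nsq x.
Proof. by rewrite /nsq mulr_sumr; apply: eq_bigr => i _; rewrite mxE exprMn. Qed.

Lemma enormZ (c : R) (x : 'rV[R]_n) : 0 <= c -> enorm (c *: x) = c * enorm x.
Proof.
by move=> c0; rewrite /enorm -!/(nsq _) nsqZ sqrtrM ?sqr_ge0 // sqrtr_sqr ger0_norm.
Qed.

Lemma radialZ (c : R) (x : 'rV[R]_n) : 0 < c -> radial (c *: x) = radial x.
Proof.
move=> c0; rewrite /radial enormZ ?ltW // invfM scalerA mulrAC mulVf ?mul1r //.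
by rewrite gt_eqF.
Qed.

Lemma Ck_affine_nsq k (a b : R) : Ck k (fun x : 'rV[R]_n => a * nsq x + b).
Proof. by apply: CkD; [apply: CkM; [exact: Ck_cst|exact: Ck_nsq]|exact: Ck_cst]. Qed.

Lemma is_derive_nsq_comp (h dh : R -> R) (a b : R) j (x : 'rV[R]_n) :
  (forall t, is_derive t (1 : R) h (dh t)) ->
  is_derive x (delta_mx 0 j) (fun y => h (a * nsq y + b))
    (dh (a * nsq x + b) * (a * (2 * x 0 j))).
Proof.
move=> hd; have E : partial j (fun y : 'rV[R]_n => a * nsq y + b) x = a * (2 * x 0 j).
  rewrite partialD; [|exact: (Ck_derivable (CkM (Ck_cst 1 a) (Ck_nsq 1)))|exact: derivable_cst].
  rewrite partial_cst addr0 partialM; [|exact: derivable_cst|exact: (Ck_derivable (Ck_nsq 1))].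
  by rewrite partial_cst mulr0 addr0 partial_nsq.
by rewrite -E; exact: (is_derive_comp1 (hd _) (Ck_is_derive j x (Ck_affine_nsq 1 a b))).
Qed.

(** Mean value theorem along the ray from x to [radial x], where f vanishes. The distance 1 - |x| is
    at most 1 - |x|^2, and |x| >= 1/2 bounds the factor 1 / |x| - 1. *)
Lemma sphere_lipschitz f : Ck 1 f -> (forall x, nsq x = 1 -> f x = 0) ->
  exists2 C : R, 0 <= C & forall x, B x -> 4^-1 <= nsq x -> `|f x| <= C * (1 - nsq x).
Proof.
move=> f1 f0.
have bd j : exists M : R, 0 <= M /\ forall x, enorm x <= 1 -> `|partial j f x| <= M.
  by have [M M0 HM] := continuous_ball_bounded (Ck_continuous (Ck_partial j f1)); exists M.
have [M HM] := choice bd.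
exists (2 * \sum_j M j).
  by rewrite mulr_ge0 // sumr_ge0 // => j _; have [] := HM j.
move=> x xB x4; have x1 : enorm x < 1 := xB.
have r2 : 2^-1 <= enorm x.
  rewrite -(@ler_pXn2r _ 2) ?nnegrE ?enorm_ge0 ?invr_ge0 // -nsqE.
  by rewrite (le_trans _ x4) // le_eqVlt; apply/orP; left; apply/eqP; field.
have r0 : 0 < enorm x by apply: lt_le_trans r2; rewrite invr_gt0.
pose s := (enorm x)^-1 - 1.
have s0 : 0 <= s by rewrite subr_ge0 invf_ge1 // ltW.
have D t : is_derive t (1 : R) (fun s : R => f (s *: x + x)) (\sum_j x 0 j * partial j f (t *: x + x)).
  by apply/is_derive_lineP; exact: C1_is_derive.
have [c cs] := MVT0 s D.
have -> : s *: x + x = radial x.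
  by rewrite -[X in _ + X]scale1r -scalerDl subrK.
rewrite scale0r add0r f0; last first.
  by rewrite nsqE enorm_radial ?expr1n //; apply: contraTneq r0 => ->; rewrite enorm0 ltxx.
rewrite sub0r => E; rewrite -normrN E normrM.
rewrite (ger0_norm s0) in cs *.
have cx : enorm (c *: x + x) <= 1.
  have c1 : `|c + 1| <= (enorm x)^-1.
    apply: (le_trans (ler_normD _ _)); rewrite normr1 -lerBrDr; exact: cs.
  rewrite -[X in _ + X]scale1r -scalerDl /enorm -/(nsq _) nsqZ sqrtrM ?sqr_ge0 // sqrtr_sqr.
  by rewrite -ler_pdivlMr // div1r.
have h1 : `|\sum_j x 0 j * partial j f (c *: x + x)| <= \sum_j M j.
  apply: (le_trans (ler_norm_sum _ _ _)); apply: ler_sum => j _; rewrite normrM -[leRHS]mul1r.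
  apply: ler_pM => //; last by have [_] := HM j; apply.
  exact: le_trans (coord_le_enorm x j) (ltW x1).
have h2 : s <= 2 * (1 - nsq x).
  have : s * enorm x <= 2 * (1 - nsq x) * enorm x.
    rewrite /s mulrBl mulVf ?gt_eqF // mul1r nsqE; nra.
  by rewrite ler_pM2r.
rewrite [leRHS]mulrAC mulrC; apply: ler_pM => //.
Qed.

(** The cutoffs chi_k are 1 for 1 - nsq x >= 2 / a_k and 0 for 1 - nsq x <= 1 / a_k. Their gradients
    grow like a_k, but in the layer between f is O(1 / a_k), so the products stay bounded and
    dominated convergence applies. *)
Lemma ball_div0 j f : Ck 1 f -> (forall x, nsq x = 1 -> f x = 0) ->
  \int[mu]_(x in B) partial j f x = 0.
Proof.
move=> f1 f0; have [C C0 HC] := sphere_lipschitz f1 f0.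
have pc : continuous (partial j f) := Ck_continuous (Ck_partial j f1).
have [M M0 HM] := continuous_ball_bounded pc.
(* At least 3, so that the transition layer, where a_k (1 - nsq x) <= 2, lies in the region nsq x >=
   1/4 of [sphere_lipschitz]. *)
pose a (k : nat) : R := k.+3%:R.
pose chi k (x : 'rV[R]_n) := sstep (- a k * nsq x + (a k - 1)).
pose dchi k (x : 'rV[R]_n) := dsstep (- a k * nsq x + (a k - 1)) * (- a k * (2 * x 0 j)).
have a3 k : 3 <= a k by rewrite ler_nat.
have chi1 k : Ck 1 (chi k) by apply: Ck_sstep; exact: Ck_affine_nsq.
have E k x : partial j (fun y => chi k y * f y) x = chi k x * partial j f x + f x * dchi k x.
  rewrite partialM; [|exact: Ck_derivable (chi1 k)|exact: Ck_derivable f1].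
  by congr (_ + _ * _); have [_] := is_derive_nsq_comp (- a k) (a k - 1) j x is_derive_sstep.
have I k : \int[mu]_(x in B) partial j (fun y => chi k y * f y) x = 0.
  apply: (@ball_div _ _ _ _ (1 - (a k)^-1)).
  - by rewrite ltrBlDr ltrDl invr_gt0; have := a3 k; lra.
  - exact: CkM.
  - move=> x hx; rewrite /chi sstep0 ?mul0r //.
    have ap : 0 < a k by have := a3 k; lra.
    have : a k * (1 - (a k)^-1) <= a k * nsq x by rewrite ler_pM2l.
    rewrite mulrBr divff ?gt_eqF //; lra.
have bound k x : B x -> `|partial j (fun y => chi k y * f y) x| <= M + C * (16 * expR 4).
  move=> xB; have x1 := (unit_ballE x).1 xB; rewrite E; apply: (le_trans (ler_normD _ _)); apply: lerD.
    rewrite normrM -[leRHS]mul1r; apply: ler_pM => //.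
      by rewrite ger0_norm ?sstep_ge0 // sstep_le1.
    by apply: HM; exact: ltW xB.
  set t := - a k * nsq x + (a k - 1).
  have [tl|tl] := leP t 0.
    by rewrite /dchi dsstep_out ?mul0r ?mulr0 ?normr0 ?mulr_ge0 ?expR_ge0 //; left.
  have [tr|tr] := leP 1 t.
    by rewrite /dchi dsstep_out ?mul0r ?mulr0 ?normr0 ?mulr_ge0 ?expR_ge0 //; right.
  have a3k := a3 k.
  have ax : a k * (1 - nsq x) <= 2 by rewrite /t in tr; lra.
  have x4 : 4^-1 <= nsq x by nra.
  rewrite normrM; apply: (@le_trans _ _ (C * (1 - nsq x) * (4 * expR 4 * (2 * a k)))).
    apply: ler_pM => //; first exact: HC.
    rewrite /dchi normrM; apply: ler_pM => //; first exact: dsstep_le.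
    have xj : `|x 0 j| <= 1 by apply: le_trans (coord_le_enorm x j) (ltW xB).
    have ap : 0 <= a k by exact: ler0n.
    have h2 : a k * `|x 0 j| <= a k * 1 by rewrite ler_wpM2l.
    rewrite !normrM normrN (ger0_norm ap) (ger0_norm (ler0n R 2)); lra.
  rewrite -mulrA ler_wpM2l //.
  have e0 : 0 <= expR 4 :> R by exact: expR_ge0.
  have : expR 4 * (a k * (1 - nsq x)) <= expR 4 * 2 by rewrite ler_wpM2l.
  lra.
have pt x : B x -> partial j (fun y => chi k y * f y) x @[k --> \oo] --> partial j f x.
  move=> xB; have x1 := (unit_ballE x).1 xB; apply: cvg_near_cst.
  have x0 : 0 < 1 - nsq x by rewrite subr_gt0.
  exists (Num.Def.truncn (2 / (1 - nsq x))).+1 => // k /= hk.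
  have ak : 2 / (1 - nsq x) <= a k.
    apply: ltW; apply: (lt_le_trans (truncnS_gt _)).
    by rewrite ler_nat; apply: leq_trans hk _; rewrite !leqW.
  have t1 : 1 <= - a k * nsq x + (a k - 1) by rewrite ler_pdivrMr // in ak; lra.
  by rewrite E /chi /dchi sstep1 // dsstep_out; [rewrite mul0r mulr0 addr0 mul1r|right].
have cB k : measurable_fun B (partial j (fun y => chi k y * f y)).
  apply: measurable_funTS; apply: continuous_measurable_rV.
  by apply: (Ck_continuous (Ck_partial j (CkM (chi1 k) f1))).
have mp : measurable_fun B (partial j f) by apply: measurable_funTS; exact: continuous_measurable_rV.
have [_] := Rintegral_dominated cB mp (aeW _ pt) (integrable_cst_ball _) bound.
under eq_fun do rewrite I.
by move=> /(cvg_unique (@norm_hausdorff _ _) (cvg_cst (0 : R))) <-.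
Qed.

End divergence.

(** * Hardy inequality in a boundary layer *)

(** The algebra behind [hardy_layer], where b and th are the two bumps, t = |x|^2, W = |w|^p, H its
    smoothing, HR the value of H at [radial x], and T the radial derivative x . grad H. The
    assumption 1/2 <= t makes the coefficient 2 t b at least b, and half of the main term pays for
    the derivative term. *)
Lemma hardy_pointwise (R : realType) (N b th e t W H HR P Q T Z : R) :
  0 <= N -> 0 <= b -> b <= 2 -> 0 <= th -> th <= b -> 0 < e -> e <= 2^-1 ->
  2^-1 <= t -> t <= 1 -> W <= H -> 0 <= H -> 0 <= HR -> HR <= Z ->
  `|T| <= P -> 2 * e * P <= H + Q ->
  b * W <= 2 * ((N * (e * th) + 2 * t * b) * (H - HR) + e * th * T) +
           (4 * (N + 2) * Z + b * Q).
Proof.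
move=> N0 b0 b2 th0 thb e0 e2 t2 t1 WH H0 HR0 HRZ TP PQ.
have P0 : 0 <= P by apply: le_trans TP.
have eth0 : 0 <= e * th by apply: mulr_ge0 => //; exact: ltW.
have etb : e * th <= e * b by rewrite ler_pM2l.
have g1 : b * W <= b * H by rewrite ler_wpM2l.
have g2 : - (b * (H + Q) / 2) <= e * th * T.
  have : `|e * th * T| <= b * (H + Q) / 2.
    rewrite normrM (ger0_norm eth0); apply: (@le_trans _ _ (e * b * P)).
      by apply: ler_pM.
    have : b * (2 * e * P) <= b * (H + Q) by rewrite ler_wpM2l.
    by lra.
  by rewrite ler_norml => /andP[].
have g3 : (N * (e * th) + 2 * t * b) * HR <= 2 * (N + 2) * Z.
  have tb0 : 0 <= t * b by apply: mulr_ge0 => //; lra.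
  have Nth0 : 0 <= N * (e * th) by exact: mulr_ge0.
  apply: ler_pM => //; first by lra.
  have eth : e * th <= 1 * 2 by apply: ler_pM => //; lra.
  have : N * (e * th) <= N * 2 by rewrite ler_wpM2l //; lra.
  have : t * b <= 1 * 2 by apply: ler_pM => //; lra.
  by lra.
have g4 : b * H <= (N * (e * th) + 2 * t * b) * H.
  rewrite ler_wpM2r // -[leLHS]add0r; apply: lerD; first exact: mulr_ge0.
  by rewrite -[leLHS]mul1r ler_wpM2r //; lra.
rewrite mulrBr; set U := (_ + _) * H in g4 *; set V := (_ + _) * HR in g3 *.
by lra.
Qed.

Section hardy.
Context {R : realType} {m q : nat}.
Local Notation n := m.+1.
Local Notation p := q.+1.
Local Notation mu := (@lebesgue_rV R n).
Local Notation B := (@unit_ball R n).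
Implicit Types (f g : 'rV[R]_n -> R) (x : 'rV[R]_n).

Lemma mulX_le_addX (a c : R) : 0 <= a -> 0 <= c -> a ^+ q * c <= a ^+ p + c ^+ p.
Proof.
move=> a0 c0; have [ac|ca] := leP a c.
  apply: (@le_trans _ _ (c ^+ p)); last by rewrite lerDr exprn_ge0.
  by rewrite exprSr ler_wpM2r // lerXn2r.
apply: (@le_trans _ _ (a ^+ p)); last by rewrite lerDl exprn_ge0.
by rewrite exprSr ler_wpM2l ?exprn_ge0 // ltW.
Qed.

Let le42 : 4^-1 <= 2^-1 :> R. Proof. by lra. Qed.

(** Equal to 1 / |x| where nsq x >= 1/4; nearer to the origin the bump keeps the base positive, so
    that rho is smooth everywhere. *)
Let rho x : R := (nsq x + bump 0 (4^-1 - nsq x)) `^ (- 2^-1).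

Let rho_arg_gt0 x : 0 < nsq x + bump 0 (4^-1 - nsq x).
Proof.
have [h|h] := ltP (nsq x) 4^-1.
  by rewrite ltr_wpDl ?nsq_ge0 // bump_gt0 // subr_gt0.
by rewrite ltr_wpDr ?bump_ge0 // (lt_le_trans _ h) // invr_gt0.
Qed.

Let Ck_rho k : Ck k rho.
Proof.
apply: Ck_powR => //; apply: CkD; first exact: Ck_nsq.
by apply: Ck_bump; apply: CkB; [exact: Ck_cst|exact: Ck_nsq].
Qed.

Let rhoE x : 4^-1 <= nsq x -> rho x *: x = radial x.
Proof.
move=> h; rewrite /rho bump_npos ?subr_le0 // addr0 /radial powRN.
by rewrite powR12_sqrt ?nsq_ge0.
Qed.

Variable w : 'rV[R]_n -> R.
Hypothesis w1 : Ck 1 w.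
Variable d : R.
Hypotheses (d0 : 0 < d) (d1 : d <= 1).

(* Smoothing of [|w|]. *)
Let Y x : R := (w x ^+ 2 + d ^+ 2) `^ 2^-1.

Let Y_arg_gt0 x : 0 < w x ^+ 2 + d ^+ 2.
Proof. by rewrite ltr_wpDl ?sqr_ge0 // exprn_gt0. Qed.

Let Y1 : Ck 1 Y.
Proof. by apply: Ck_powR => //; apply: CkD; [exact: CkX|exact: Ck_cst]. Qed.

Let Y_gt0 x : 0 < Y x. Proof. exact: powR_gt0. Qed.

Let YE x : Y x = Num.sqrt (w x ^+ 2 + d ^+ 2).
Proof. by rewrite /Y powR12_sqrt // ltW. Qed.

Let w_le_Y x : `|w x| <= Y x.
Proof. by rewrite YE -[leLHS]sqrtr_sqr (ler_sqrt _ (ltW (Y_arg_gt0 x))) lerDl sqr_ge0. Qed.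

Let Y_le x : Y x <= `|w x| + d.
Proof.
have wd : 0 <= `|w x| + d by rewrite addr_ge0 // ltW.
rewrite YE -[leRHS](ger0_norm wd) -sqrtr_sqr ler_sqrt ?sqr_ge0 //.
rewrite sqrrD real_normK ?num_real // -addrA lerD2l lerDr.
by rewrite mulrn_wge0 // mulr_ge0 // (ltW d0).
Qed.

Let partialY j x : `|partial j Y x| <= `|partial j w x|.
Proof.
have dw : derivable w x (delta_mx 0 j) by exact: Ck_derivable w1.
have E : partial j (fun y => w y ^+ 2 + d ^+ 2) x = 2 * w x * partial j w x.
  rewrite partialD ?partial_cst ?addr0; [|exact: (Ck_derivable (CkX 2 w1))|exact: derivable_cst].
  by rewrite (_ : (fun y => w y ^+ 2) = (fun y => w y * w y)) // partialM // mulr2n; ring.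
rewrite /Y partial_powR //; last first.
  by apply: Ck_derivable; apply: CkD; [exact: (CkX 2 w1)|exact: Ck_cst].
rewrite E (_ : 2^-1 - 1 = - 2^-1); last by lra.
rewrite powRN -/(Y x) (_ : _ * _ = w x / Y x * partial j w x); last first.
  by field; exact: lt0r_neq0.
rewrite normrM -[leRHS]mul1r ler_wpM2r // normrM normfV (gtr0_norm (Y_gt0 x)).
by rewrite ler_pdivrMr // mul1r.
Qed.

Let H x : R := Y x ^+ p.

Let H1 : Ck 1 H. Proof. exact: CkX. Qed.

Let H_ge0 x : 0 <= H x. Proof. by rewrite exprn_ge0 // ltW. Qed.

Let partialH j x : `|partial j H x| <= p%:R * Y x ^+ q * `|partial j w x|.
Proof.
have dY : is_derive x (delta_mx 0 j) Y (partial j Y x) by exact: (Ck_is_derive j x Y1).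
have dH : is_derive x (delta_mx 0 j) H (p%:R * Y x ^+ q * partial j Y x).
  by have := is_deriveX p dY; rewrite exprfctE.
have [_] := dH; rewrite -/(partial j H x) => ->.
have c0 : 0 <= p%:R * Y x ^+ q by rewrite mulr_ge0 // exprn_ge0 // ltW.
by rewrite normrM (ger0_norm c0) ler_wpM2l // partialY.
Qed.

Let G x : R := H (rho x *: x).

Let G1 : Ck 1 G.
Proof.
apply: (@C1_comp _ _ _ H (fun x : 'rV[R]_n => rho x *: x)) => // i.
under eq_fun do rewrite mxE.
by apply: CkM; [exact: Ck_rho|exact: Ck_coord].
Qed.

Let GE x : 4^-1 <= nsq x -> G x = H (radial x).
Proof. by move=> h; exact: (congr1 H (rhoE h)). Qed.

(** Near such an x the function G is H composed with [radial], hence constant along rays. *)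
Let G_radial x : 2^-1 <= nsq x -> \sum_j x 0 j * partial j G x = 0.
Proof.
move=> x2; have [_ <-] := C1_is_derive x x G1.
have h : (fun h : R => h^-1 *: ((G \o shift x) (h *: x) - G x)) @ 0^' --> (0 : R).
  apply: cvg_near_cst; near=> h => /=.
  (* Small enough for (h + 1)^2 >= 3/4, which keeps the nearby points of the ray in the region nsq
     >= 1/4. *)
  have h10 : `|h| < 10^-1.
    by near: h; apply: dnbhs0_lt; rewrite invr_gt0.
  have /andP[ha hb] : - 10^-1 < h < 10^-1 by rewrite -ltr_norml.
  have c0 : 0 < h + 1 by lra.
  have -> : h *: x + x = (h + 1) *: x by rewrite scalerDl scale1r.
  have h1 : 4^-1 <= nsq ((h + 1) *: x).
    rewrite nsqZ; have : 3 / 4 <= (h + 1) ^+ 2 by nra.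
    by move: (nsq x) x2 => t; nra.
  have h2 : 4^-1 <= nsq x := le_trans le42 x2.
  by rewrite (GE h1) (GE h2) (radialZ _ c0) subrr scaler0.
exact: (cvg_lim (@norm_hausdorff _ _) h).
Unshelve. all: by end_near. Qed.

Variable e : R.
Hypotheses (e0 : 0 < e) (e2 : e <= 2^-1).

Let tau x : R := e^-1 * nsq x + (1 - e^-1).

Let Sw x : R := \sum_j `|partial j w x|.

(** The layer is tau > 0, that is nsq x > 1 - e, and tau = 1 on the sphere. The field e
    [bump 0 (tau x)] (H - G) x vanishes on the sphere, so its divergence has integral 0.
    Differentiating the bump cancels e and yields the main term 2 |x|^2 [bump 2 (tau x)] (H - G), G
    accounts for the boundary values, and Young's inequality applied to grad H leaves e^p |grad
    w|^p. *)
Lemma hardy_layer :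
  \int[mu]_(x in B) (bump 2 (tau x) * `|w x| ^+ p) <=
  4 * (n%:R + 2) * 2 ^+ p * \int[mu]_(x in B) (`|w (radial x)| ^+ p + d) +
  (2 * p%:R) ^+ p * e ^+ p * \int[mu]_(x in B) (bump 2 (tau x) * Sw x ^+ p).
Proof.
pose F j x := e * bump 0 (tau x) * (H x - G x) * x 0 j.
have tau1 : Ck 1 tau by exact: Ck_affine_nsq.
have b1 k : Ck 1 (fun x => bump k (tau x)) by exact: Ck_bump.
have F1 j : Ck 1 (F j).
  apply: CkM; last exact: Ck_coord.
  by apply: CkM; [apply: CkM; [exact: Ck_cst|exact: b1]|exact: CkB].
have F0 j x : nsq x = 1 -> F j x = 0.
  move=> x1; rewrite /F GE; last by rewrite x1; lra.
  by rewrite /radial /enorm -/(nsq x) x1 sqrtr1 invr1 scale1r subrr mulr0 mul0r.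
pose D x := \sum_j partial j (F j) x.
have pc j : continuous (partial j (F j)) := Ck_continuous (Ck_partial j (F1 j)).
have D0 : \int[mu]_(x in B) D x = 0.
  rewrite (Rintegral_fin_sum mball); last by move=> j _; exact: continuous_ball_integrable.
  by rewrite big1 // => j _; exact: (@ball_div0 _ _ _ _ (F1 j) (F0 j)).
have tauD j x : is_derive x (delta_mx 0 j) (fun y => bump 0 (tau y))
    (bump 2 (tau x) * (e^-1 * (2 * x 0 j))).
  apply: is_derive_nsq_comp => t.
  by have := is_derive_bump 0 t; rewrite mul0r subr0.
have field_id (c th hg b y dh dg : R) : c != 0 ->
    c * th * hg + y * (c * th * (dh - dg) + hg * (c * (b * (c^-1 * (2 * y))))) =
    c * th * hg + (2 * b * hg * y ^+ 2 + c * th * (y * dh - y * dg)) by move=> c0; field.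
have DE x : D x = (n%:R * (e * bump 0 (tau x)) + 2 * nsq x * bump 2 (tau x)) * (H x - G x) +
    e * bump 0 (tau x) * (\sum_j x 0 j * partial j H x - \sum_j x 0 j * partial j G x).
  have Ej j : partial j (F j) x = e * bump 0 (tau x) * (H x - G x) +
     (2 * bump 2 (tau x) * (H x - G x) * x 0 j ^+ 2 +
     e * bump 0 (tau x) * (x 0 j * partial j H x - x 0 j * partial j G x)).
    rewrite /F partialM; [|apply: Ck_derivable; apply: CkM; [apply: CkM; [exact: Ck_cst|exact: b1]|exact: CkB]|
      exact: (Ck_derivable (Ck_coord 1 j))].
    rewrite partial_coord eqxx mulr1 partialM; [|apply: Ck_derivable; apply: CkM; [exact: Ck_cst|exact: b1]|
      exact: (Ck_derivable (CkB H1 G1))].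
    rewrite partialB; [|exact: Ck_derivable H1|exact: Ck_derivable G1].
    rewrite partialM; [|exact: derivable_cst|exact: Ck_derivable (b1 0)].
    rewrite partial_cst mulr0 addr0.
    have [_ E] := tauD j x; rewrite [partial j (fun y => bump 0 (tau y)) x]E.
    exact: field_id (lt0r_neq0 e0).
  rewrite /D; under eq_bigr do rewrite Ej.
  rewrite !big_split /= -!mulr_sumr -sumrB sumr_const card_ord -/(nsq x) -mulr_natl; ring.
have pw x : B x -> bump 2 (tau x) * `|w x| ^+ p <=
    2 * D x + (4 * (n%:R + 2) * 2 ^+ p * (`|w (radial x)| ^+ p + d) +
    (2 * p%:R) ^+ p * e ^+ p * (bump 2 (tau x) * Sw x ^+ p)).
  move=> xB; have x1 := (unit_ballE x).1 xB.
  have R0 : 0 <= 4 * (n%:R + 2) * 2 ^+ p * (`|w (radial x)| ^+ p + d).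
    by rewrite mulr_ge0 ?mulr_ge0 ?addr_ge0 ?exprn_ge0 // ltW.
  have [t0|t0] := leP (tau x) 0.
    rewrite DE !bump_npos // !(mulr0, mul0r, add0r, addr0); exact: R0.
  have te : tau x <= 1.
    rewrite /tau; have : e^-1 * nsq x <= e^-1 * 1 by rewrite ler_wpM2l ?ltW // invr_gt0.
    by lra.
  have x2 : 2^-1 <= nsq x.
    have : 0 < e * tau x by rewrite mulr_gt0.
    have -> : e * tau x = nsq x - (1 - e).
      by rewrite /tau; move: (nsq x) => t; field; exact: lt0r_neq0.
    rewrite subr_gt0 => h; apply: ltW; apply: le_lt_trans h.
    by rewrite lerBrDr -lerBrDl (le_trans e2) // le_eqVlt; apply/orP; left; apply/eqP; field.
  have x4 : 4^-1 <= nsq x := le_trans le42 x2.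
  have -> : D x = (n%:R * (e * bump 0 (tau x)) + 2 * nsq x * bump 2 (tau x)) *
      (H x - H (radial x)) + e * bump 0 (tau x) * (\sum_j x 0 j * partial j H x).
    apply: (etrans (DE x)); apply: congr2; first by apply: congr1; exact: (congr1 (fun t => H x - t) (GE x4)).
    apply: congr1; apply: (etrans (congr1 (fun t => _ - t) (G_radial x2))); exact: subr0.
  set b := bump 2 (tau x); set th := bump 0 (tau x).
  have bp : 0 <= b by exact: bump_ge0.
  have b2 : b <= 2 by have := bump_le_fact 2 (tau x).
  have th0 : 0 <= th by exact: bump_ge0.
  have thb : th <= b.
    have -> : th = tau x * (tau x * b) by rewrite /b !bumpS.
    by rewrite mulrA ler_piMl // mulr_ile1 // ltW.
  have HS : `|\sum_j x 0 j * partial j H x| <= p%:R * Y x ^+ q * Sw x.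
    apply: (le_trans (ler_norm_sum _ _ _)); rewrite /Sw mulr_sumr; apply: ler_sum => j _.
    rewrite normrM -[leRHS]mul1r; apply: ler_pM => //.
    exact: le_trans (coord_le_enorm x j) (ltW xB).
  have S0 : 0 <= Sw x by apply: sumr_ge0.
  (* Young's inequality in the crude form [mulX_le_addX], with 2 p e times the gradient sum as
     second variable; this is where the factor (2 p)^p e^p arises. *)
  have yq : Y x ^+ q * (2 * p%:R * e * Sw x) <= H x + (2 * p%:R) ^+ p * e ^+ p * Sw x ^+ p.
    rewrite -!exprMn; apply: mulX_le_addX; first exact: ltW.
    by rewrite !mulr_ge0 // ltW.
  have HR : H (radial x) <= 2 ^+ p * (`|w (radial x)| ^+ p + d).
    apply: (@le_trans _ _ ((`|w (radial x)| + d) ^+ p)).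
      apply: lerXn2r (Y_le (radial x)); rewrite nnegrE; first exact: ltW.
      by apply: addr_ge0 => //; exact: ltW.
    apply: (le_trans (exprD_le _ _ (ltW d0))) => //.
    apply: ler_wpM2l; first exact: exprn_ge0.
    rewrite lerD2l exprS -[leRHS]mulr1; apply: ler_wpM2l; first exact: ltW.
    exact: (exprn_ile1 _ (ltW d0) d1).
  have wH : `|w x| ^+ p <= H x by apply: lerXn2r (w_le_Y x); rewrite nnegrE // ltW.
  rewrite -[X in _ + (X + _)]mulrA (mulrCA _ b).
  apply: (hardy_pointwise (P := p%:R * Y x ^+ q * Sw x)) => //; first exact: ltW.
  by apply: le_trans yq; rewrite le_eqVlt; apply/orP; left; apply/eqP; ring.
have wc : continuous w := Ck_continuous w1.
have Dc : continuous D.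
  by apply: (@Ck_continuous _ _ 0); apply: Ck_sum => j _; exact: pc.
have Swc : continuous Sw.
  apply: (@Ck_continuous _ _ 0); apply: Ck_sum => j _ x.
  apply: (@continuous_comp _ _ _ (partial j w) Num.norm); last exact: norm_continuous.
  exact: (Ck_continuous (Ck_partial j w1)).
have bc : continuous (fun x => bump 2 (tau x)) := Ck_continuous (b1 2%N).
have i1 : mu.-integrable B (EFin \o D) by exact: continuous_ball_integrable.
have i3 : mu.-integrable B (EFin \o (fun x => bump 2 (tau x) * Sw x ^+ p)).
  apply: continuous_ball_integrable; apply: (@Ck_continuous _ _ 0).
  by apply: CkM; [exact: bc|apply: CkX; exact: Swc].
have nwc : continuous (fun x => `|w x|).
  by move=> x; apply: (@continuous_comp _ _ _ w Num.norm); [exact: wc|exact: norm_continuous].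
have i0 : mu.-integrable B (EFin \o (fun x => bump 2 (tau x) * `|w x| ^+ p)).
  apply: continuous_ball_integrable; apply: (@Ck_continuous _ _ 0).
  by apply: CkM; [exact: bc|apply: CkX; exact: nwc].
have i2 : mu.-integrable B (EFin \o (fun x => `|w (radial x)| ^+ p + d)).
  have [M M0 HM] := continuous_ball_bounded wc.
  have iw : mu.-integrable B (EFin \o (fun x => `|w (radial x)| ^+ p)).
    apply: (@ball_bounded_integrable _ _ _ (M ^+ p)).
      apply: measurable_funTS; apply: measurable_funX; apply: measurableT_comp => //.
      apply: (measurableT_comp (continuous_measurable_rV wc)); exact: measurable_radial.
    move=> x _; rewrite normrX normr_id; apply: lerXn2r; rewrite ?nnegrE //; apply: HM.
    have [->|x0] := eqVneq x 0; first by rewrite /radial scaler0 enorm0.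
    by rewrite enorm_radial.
  exact: (integrableD mball iw (integrable_cst_ball d)).
have j1 := integrableZl mball 2 i1.
have j2 := integrableZl mball (4 * (n%:R + 2) * 2 ^+ p) i2.
have j3 := integrableZl mball ((2 * p%:R) ^+ p * e ^+ p) i3.
have j23 := integrableD mball j2 j3.
apply: (le_trans (le_Rintegral mball i0 (integrableD mball j1 j23) pw)).
rewrite (RintegralD mball j1 j23) (RintegralD mball j2 j3).
rewrite (RintegralZl _ mball i1) (RintegralZl _ mball i2) (RintegralZl _ mball i3).
by rewrite D0 mulr0 add0r.
Qed.

End hardy.

(** * Approximation of functions with zero trace *)

Section trace.
Context {R : realType} {m q : nat}.
Local Notation n := m.+1.
Local Notation p := q.+1.
Local Notation mu := (@lebesgue_rV R n).
Local Notation B := (@unit_ball R n).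
Implicit Types (f g v w z : 'rV[R]_n -> R) (x : 'rV[R]_n) (e : R).

Lemma expr_sum_le (I : Type) (r : seq I) (a : I -> R) : (forall i, 0 <= a i) ->
  (\sum_(i <- r) a i) ^+ p <= (2 ^+ p) ^+ size r * \sum_(i <- r) a i ^+ p.
Proof.
move=> a0; elim: r => [|i r IH]; first by rewrite !big_nil mulr0 expr0n.
rewrite !big_cons /= [X in _ <= X * _]exprS; set c := (2 ^+ p) ^+ size r in IH *.
have c1 : 1 <= c by apply: exprn_ege1; apply: exprn_ege1; lra.
have s0 : 0 <= \sum_(j <- r) a j by apply: sumr_ge0.
apply: (le_trans (exprD_le p (a0 i) s0)); rewrite -mulrA ler_wpM2l ?exprn_ge0 // mulrDr.
by apply: lerD => //; rewrite ler_peMl // exprn_ge0.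
Qed.

Let tau e x : R := e^-1 * nsq x + (1 - e^-1).

(** This is 1 for tau <= 1/2 and 0 for tau >= 3/4, so its gradient lives where [bump 2 (tau e x)],
    the weight in the Hardy inequality, is bounded below. *)
Let chi e x : R := sstep (- (4 / e) * nsq x + (4 / e - 1)).

(* Dominates [1 - chi], and equals [1] wherever [bump 2 (tau e)] is positive. *)
Let L e x : R := sstep (e^-1 * nsq x + (2 - e^-1)).

Let Ck_chi e k : Ck k (chi e).
Proof. by apply: Ck_sstep; exact: Ck_affine_nsq. Qed.

Let Lc e : continuous (L e).
Proof. by apply: (@Ck_continuous _ _ 0); apply: Ck_sstep; exact: Ck_affine_nsq. Qed.

Let chiE e x : chi e x = sstep (3 - 4 * tau e x).
Proof. by rewrite /chi /tau; congr sstep; ring. Qed.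

Let LE e x : L e x = sstep (1 + tau e x).
Proof. by rewrite /L /tau; congr sstep; ring. Qed.

Let L1 e x : 0 <= tau e x -> L e x = 1.
Proof. by move=> t0; rewrite LE sstep1 // lerDl. Qed.

Let chiL e x : `|1 - chi e x| <= L e x.
Proof.
rewrite ger0_norm; last by rewrite subr_ge0 sstep_le1.
have [t0|t0] := leP 0 (tau e x); first by rewrite L1 // gerBl sstep_ge0.
by rewrite chiE sstep1 ?subrr ?sstep_ge0 //; lra.
Qed.

Let LM e x : `|L e x| <= 1.
Proof. by rewrite ger0_norm ?sstep_ge0 // sstep_le1. Qed.

Let Lp_L e f : Lp_ball p f -> Lp_ball p (fun x => L e x * f x).
Proof.
apply: (Lp_ballM (M := 1)); first by apply: measurable_funTS; apply: continuous_measurable_rV; exact: Lc.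
by move=> x _; exact: LM.
Qed.

(** With layer width 1 / (k + 2), L vanishes at any given x in the ball for large k, and dominated
    convergence applies. *)
Let L_cvg0 f (e : R) : Lp_ball p f -> 0 < e -> \forall k \near \oo, rnp p (fun x => L k.+2%:R^-1 x * f x) <= e.
Proof.
move=> fp e0.
pose a (k : nat) : R := k.+2%:R^-1.
have pt (x : 'rV[R]_n) : B x -> `|L (a k) x * f x| ^+ p @[k --> \oo] --> (0 : R).
  move=> xB; have x1 := (unit_ballE x).1 xB; apply: cvg_near_cst.
  have x0 : 0 < 1 - nsq x by rewrite subr_gt0.
  exists (Num.Def.truncn (2 / (1 - nsq x))).+1 => // k /= hk.
  have ak : 2 / (1 - nsq x) <= k.+2%:R.
    apply: ltW; apply: (lt_le_trans (truncnS_gt _)).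
    by rewrite ler_nat; apply: leq_trans hk _; rewrite !leqW.
  rewrite /L invrK sstep0 ?mul0r ?normr0 ?expr0n //.
  by rewrite ler_pdivrMr // in ak; lra.
have bd (k : nat) (x : 'rV[R]_n) : B x -> `| `|L (a k) x * f x| ^+ p| <= `|f x| ^+ p.
  move=> xB; rewrite normrX normr_id normrM exprMn ler_piMl ?exprn_ge0 //.
  exact: (exprn_ile1 _ (normr_ge0 _) (LM _ _)).
have mk (k : nat) := measurable_norm_expr p (Lp_L (a k) fp).1.
have [_ C] := Rintegral_dominated mk (measurable_cst (0 : R)) (aeW _ pt) (Lp_ball_integrable fp) bd.
have I0 : \int[mu]_(x in B) cst (0 : R) x = 0 by rewrite /Rintegral integral0.
rewrite I0 in C.
exact: (cvgr_le _ C e e0).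
Qed.

Let dchi e j x : R := dsstep (- (4 / e) * nsq x + (4 / e - 1)) * (- (4 / e) * (2 * x 0 j)).

(** The factor 32 exp 4 is the bound 4 exp 4 of [dsstep] times 4 * 2 from the inner derivative; exp
    2 compensates for the lower bound exp (-2) of the bump. *)
Let K : R := (32 * expR 4) ^+ p * expR 2.

Let dchi_le e j x : 0 < e -> B x -> `|dchi e j x| ^+ p <= K * e ^- p * bump 2 (tau e x).
Proof.
move=> e0 xB; rewrite /dchi.
have -> : - (4 / e) * nsq x + (4 / e - 1) = 3 - 4 * tau e x by rewrite /tau; ring.
have K0 : 0 <= K * e ^- p by rewrite mulr_ge0 ?invr_ge0 ?mulr_ge0 ?exprn_ge0 ?expR_ge0 ?mulr_ge0 ?expR_ge0 // ltW.
have [tl|tl] := leP (3 - 4 * tau e x) 0.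
  by rewrite (dsstep_out (or_introl tl)) mul0r normr0 expr0n; exact: (mulr_ge0 K0 (bump_ge0 _ _)).
have [tr|tr] := leP 1 (3 - 4 * tau e x).
  by rewrite (dsstep_out (or_intror tr)) mul0r normr0 expr0n; exact: (mulr_ge0 K0 (bump_ge0 _ _)).
have t2 : 2^-1 < tau e x by lra.
have t1 : tau e x <= 1 by lra.
have tp : 0 < tau e x by lra.
have b1 : expR (- 2) <= bump 2 (tau e x).
  rewrite bump_pos // -[leLHS]mul1r; apply: ler_pM; [by []|exact: expR_ge0|..].
    by apply: exprn_ege1; rewrite invf_ge1.
  by rewrite ler_expR lerN2 -[leRHS]invrK lef_pV2 ?posrE ?invr_gt0 // ltW.
have xj : `|x 0 j| <= 1 by apply: le_trans (coord_le_enorm x j) (ltW xB).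
have h : `|dsstep (3 - 4 * tau e x) * (- (4 / e) * (2 * x 0 j))| <= 32 * expR 4 / e.
  have -> : 32 * expR 4 / e = 4 * expR 4 * (4 / e * (2 * 1)) by ring.
  have e4 : 0 <= 4 / e by rewrite divr_ge0 // ltW.
  rewrite normrM; apply: ler_pM => //; first exact: dsstep_le.
  by rewrite normrM normrN (ger0_norm e4) ler_wpM2l // normrM ger0_norm // ler_wpM2l.
apply: (@le_trans _ _ ((32 * expR 4 / e) ^+ p)).
  by apply: lerXn2r h; rewrite nnegrE // divr_ge0 ?mulr_ge0 ?expR_ge0 // ltW.
rewrite exprMn exprVn /K -!mulrA; apply: ler_wpM2l; first by rewrite exprn_ge0 // mulr_ge0 // expR_ge0.
rewrite mulrCA -[leLHS]mulr1; apply: ler_wpM2l; first by rewrite invr_ge0 exprn_ge0 // ltW.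
apply: (@le_trans _ _ (expR 2 * expR (- 2))); first by rewrite expRxMexpNx_1.
by apply: ler_wpM2l => //; exact: expR_ge0.
Qed.

Let Sw w x : R := \sum_j `|partial j w x|.

(** Where the bump is positive one has L = 1 and the bump is at most 2, so the gradient of w may be
    multiplied by L and then compared with G. *)
Let bump_Sw e w (G : 'I_n -> 'rV[R]_n -> R) : Ck 1 w -> (forall j, Lp_ball p (G j)) ->
  \int[mu]_(x in B) (bump 2 (tau e x) * Sw w x ^+ p) <=
  2 * (2 ^+ p) ^+ n * 2 ^+ p *
  \sum_j (rnp p (fun x => partial j w x - G j x) + rnp p (fun x => L e x * G j x)).
Proof.
move=> w1 Gp.
have pw j : Lp_ball p (partial j w).
  by apply: Lp_ball_continuous; exact: (Ck_continuous (Ck_partial j w1)).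
have Lw j := Lp_L e (pw j).
have c0 : 0 <= 2 * (2 ^+ p) ^+ n :> R by rewrite mulr_ge0 // !exprn_ge0.
have iw : mu.-integrable B (EFin \o (fun x => \sum_j `|L e x * partial j w x| ^+ p)).
  by apply: (integrable_fin_sum mball) => j _; exact: Lp_ball_integrable.
have Swc : continuous (Sw w).
  apply: (@Ck_continuous _ _ 0); apply: Ck_sum => j _ x.
  apply: (@continuous_comp _ _ _ (partial j w) Num.norm); last exact: norm_continuous.
  exact: (Ck_continuous (Ck_partial j w1)).
have ib : mu.-integrable B (EFin \o (fun x => bump 2 (tau e x) * Sw w x ^+ p)).
  apply: continuous_ball_integrable; apply: (@Ck_continuous _ _ 0); apply: CkM; last by apply: CkX; exact: Swc.
  by apply: Ck_bump; exact: Ck_affine_nsq.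
apply: (@le_trans _ _ (\int[mu]_(x in B) (2 * (2 ^+ p) ^+ n * \sum_j `|L e x * partial j w x| ^+ p))).
  apply: (le_Rintegral mball ib (integrableZl mball _ iw)) => x xB.
  have [t0|t0] := leP (tau e x) 0.
    by rewrite bump_npos // mul0r mulr_ge0 // sumr_ge0 // => j _; exact: exprn_ge0.
  rewrite -mulrA; apply: ler_pM; [exact: bump_ge0|by apply: exprn_ge0; apply: sumr_ge0|exact: (bump_le_fact 2)|].
  rewrite (L1 (ltW t0)); under eq_bigr do rewrite mul1r.
  apply: (le_trans (expr_sum_le _ _)) => //.
  by rewrite -sum1_size sum1_card card_ord.
rewrite (RintegralZl _ mball iw) -mulrA; apply: ler_wpM2l => //.
rewrite (Rintegral_fin_sum mball); last by move=> j _; exact: Lp_ball_integrable.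
rewrite mulr_sumr; apply: ler_sum => j _.
have pG := Lp_ballB (pw j) (Gp j).
have h := rnpD (Lp_L e pG) (Lp_L e (Gp j)).
apply: (le_trans (le_trans _ h)).
  by rewrite le_eqVlt; apply/orP; left; apply/eqP; apply: eq_Rintegral => x _; rewrite mulrBr subrK.
apply: ler_wpM2l; first exact: exprn_ge0.
rewrite lerD2r; apply: rnp_le => //; first exact: Lp_L.
by move=> x xB; rewrite normrM ler_piMl.
Qed.

(** The factor e^-p from the gradient of the cutoff cancels the e^p of the Hardy inequality, so A
    does not depend on e. Only the boundary values of w and the smoothing parameter d carry the
    e-dependent constant A', and they can be made small after e is fixed. *)
Lemma cutoff_bound : exists2 A : R, 0 <= A & forall e, 0 < e -> e <= 2^-1 ->
  exists2 A' : R, 0 <= A' & forall w v (G : 'I_n -> 'rV[R]_n -> R) (d : R), Ck 2 w ->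
  Lp_ball p v -> (forall j, Lp_ball p (G j)) -> 0 < d -> d <= 1 ->
  let D := rnp p (fun x => w x - v x) + \sum_j rnp p (fun x => partial j w x - G j x) in
  let c := rnp p (fun x => L e x * v x) + \sum_j rnp p (fun x => L e x * G j x) in
  let E := A * (D + c) + A' * (rnp p (fun x => w (radial x)) + d) in
  [/\ rnp p (fun x => chi e x * w x - v x) <= E &
    forall j, rnp p (fun x => partial j (fun y => chi e y * w y) x - G j x) <= E].
Proof.
pose C1 : R := 4 * (n%:R + 2) * 2 ^+ p.
pose C2 : R := (2 * p%:R) ^+ p.
pose N : R := 2 * (2 ^+ p) ^+ n * 2 ^+ p.
pose V : R := fine (mu B).
have V0 : 0 <= V by apply: fine_ge0.
have P1 : 1 <= 2 ^+ p :> R by apply: exprn_ege1; lra.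
have P0 : 0 <= 2 ^+ p :> R by exact: exprn_ge0.
have K0 : 0 <= K by rewrite mulr_ge0 ?expR_ge0 // exprn_ge0 // mulr_ge0 // expR_ge0.
have C20 : 0 <= C2 by rewrite exprn_ge0 // mulr_ge0.
have C10 : 0 <= C1 by rewrite !mulr_ge0 ?addr_ge0.
have N0 : 0 <= N by rewrite !mulr_ge0 // exprn_ge0.
exists (2 ^+ p * (2 ^+ p * (1 + K * C2 * N))).
  by rewrite !mulr_ge0 // addr_ge0 // !mulr_ge0.
move=> e e0 e2; have ep : 0 <= e ^- p by rewrite invr_ge0 exprn_ge0 // ltW.
exists (2 ^+ p * (2 ^+ p * (K * e ^- p * C1 * (1 + V)))).
  by rewrite !mulr_ge0 // addr_ge0.
move=> w v G d w2 vp Gp d0 d1 D c E.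
have w1 : Ck 1 w by exact: CkW.
have wc : continuous w := Ck_continuous w1.
set S := rnp p (fun x => w (radial x)).
have ES : E = 2 ^+ p * (2 ^+ p * (1 + K * C2 * N)) * (D + c) +
  2 ^+ p * (2 ^+ p * (K * e ^- p * C1 * (1 + V))) * (S + d) by [].
clearbody E.
have S0 : 0 <= S by exact: rnp_ge0.
have Ds : 0 <= \sum_j rnp p (fun x => partial j w x - G j x) by apply: sumr_ge0 => j _; exact: rnp_ge0.
have cs : 0 <= \sum_j rnp p (fun x => L e x * G j x) by apply: sumr_ge0 => j _; exact: rnp_ge0.
have D0 : 0 <= D by rewrite addr_ge0 // rnp_ge0.
have c0 : 0 <= c by rewrite addr_ge0 // rnp_ge0.
have Dc0 : 0 <= D + c := addr_ge0 D0 c0.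
have Dw : rnp p (fun x => w x - v x) <= D by rewrite lerDl.
have cw : rnp p (fun x => L e x * v x) <= c by rewrite lerDl.
have Dj j : rnp p (fun x => partial j w x - G j x) <= D.
  rewrite /D (bigD1 j) //= addrCA lerDl addr_ge0 ?rnp_ge0 // sumr_ge0 // => i _; exact: rnp_ge0.
have cj j : rnp p (fun x => L e x * G j x) <= c.
  rewrite /c (bigD1 j) //= addrCA lerDl addr_ge0 ?rnp_ge0 // sumr_ge0 // => i _; exact: rnp_ge0.
have wp : Lp_ball p w by exact: Lp_ball_continuous.
have pwp j : Lp_ball p (partial j w).
  by apply: Lp_ball_continuous; exact: (Ck_continuous (Ck_partial j w1)).
have mchi : measurable_fun B (chi e).
  by apply: measurable_funTS; apply: continuous_measurable_rV; exact: (Ck_continuous (Ck_chi e 1)).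
have chi1 x : `|chi e x| <= 1 by rewrite ger0_norm ?sstep_ge0 // sstep_le1.
have Lchi f : Lp_ball p f -> Lp_ball p (fun x => chi e x * f x).
  by apply: (Lp_ballM (M := 1)) => // x _.
(* From chi f - g = chi (f - g) - (1 - chi) g, where 1 - chi is dominated by L. *)
have split_le f g : Lp_ball p f -> Lp_ball p g ->
    rnp p (fun x => chi e x * f x - g x) <= 2 ^+ p * (rnp p (fun x => f x - g x) + rnp p (fun x => L e x * g x)).
  move=> fp gp; have fg := Lp_ballB fp gp.
  have mL : Lp_ball p (fun x => (1 - chi e x) * g x).
    apply: (Lp_ballM (M := 1)) => //; last by move=> x _; apply: le_trans (chiL e x) _; exact: sstep_le1.
    by apply: measurable_funB.
  apply: (le_trans (le_trans _ (rnpD (Lchi _ fg) (Lp_ballN mL)))).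
    by rewrite le_eqVlt; apply/orP; left; apply/eqP; apply: eq_Rintegral => x _; congr (`|_| ^+ p); ring.
  apply: ler_wpM2l => //; apply: lerD; apply: rnp_le => //.
  - exact: Lchi.
  - by move=> x _; rewrite normrM ler_piMl.
  - exact: Lp_ballN.
  - exact: Lp_L.
  - move=> x _; rewrite normrN (normrM (1 - chi e x)) (normrM (L e x)); apply: ler_wpM2r => //; apply: le_trans (chiL e x) _.
    exact: ler_norm.
have E1 : 2 ^+ p * (D + c) <= E.
  rewrite ES -[leLHS]addr0; apply: lerD; last by rewrite !mulr_ge0 ?addr_ge0 // ltW.
  rewrite -mulrA; apply: (ler_wpM2l P0); apply: (ler_peMl Dc0).
  rewrite -[leLHS]mulr1; apply: ler_pM => //; rewrite lerDl; exact: (mulr_ge0 (mulr_ge0 K0 C20) N0).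
split.
  by apply: (le_trans (split_le _ _ wp vp)); apply: le_trans E1; apply: ler_wpM2l => //; exact: lerD.
move=> j.
have dE x : partial j (fun y => chi e y * w y) x = chi e x * partial j w x + dchi e j x * w x.
  rewrite partialM; [|exact: Ck_derivable (Ck_chi e 1)|exact: Ck_derivable w1].
  have [_ Ed] := is_derive_nsq_comp (- (4 / e)) (4 / e - 1) j x is_derive_sstep.
  by rewrite [partial j (chi e) x]Ed [w x * _]mulrC.
have cdc : continuous (fun x => dchi e j x * w x).
  have -> : (fun x => dchi e j x * w x) = (fun x => partial j (fun y => chi e y * w y) x - chi e x * partial j w x).
    by apply/funext => x; rewrite dE addrAC subrr add0r.
  apply: (@Ck_continuous _ _ 0); apply: CkB.
    by apply: (@Ck_partial _ _ 0); apply: CkM => //; exact: Ck_chi.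
  by apply: CkM; [exact: Ck_chi|exact: (Ck_continuous (Ck_partial j w1))].
have dLp : Lp_ball p (fun x => dchi e j x * w x) by exact: Lp_ball_continuous.
have bound : rnp p (fun x => dchi e j x * w x) <= K * e ^- p * C1 * (1 + V) * (S + d) + K * C2 * N * (D + c).
  have nwc : continuous (fun x => `|w x|).
    by move=> x; apply: (@continuous_comp _ _ _ w Num.norm); [exact: wc|exact: norm_continuous].
  have ib : mu.-integrable B (EFin \o (fun x => bump 2 (tau e x) * `|w x| ^+ p)).
    apply: continuous_ball_integrable; apply: (@Ck_continuous _ _ 0); apply: CkM; last by apply: CkX; exact: nwc.
    by apply: Ck_bump; exact: Ck_affine_nsq.
  have Ke : 0 <= K * e ^- p by rewrite mulr_ge0.
  apply: (@le_trans _ _ (K * e ^- p * \int[mu]_(x in B) (bump 2 (tau e x) * `|w x| ^+ p))).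
    rewrite -(RintegralZl _ mball ib).
    apply: (le_Rintegral mball (Lp_ball_integrable dLp) (integrableZl mball _ ib)) => x xB.
    by rewrite normrM exprMn mulrA; apply: ler_wpM2r; [exact: exprn_ge0|exact: dchi_le].
  have h1 : \int[mu]_(x in B) (bump 2 (tau e x) * `|w x| ^+ p) <=
      C1 * \int[mu]_(x in B) (`|w (radial x)| ^+ p + d) +
      C2 * e ^+ p * \int[mu]_(x in B) (bump 2 (tau e x) * Sw w x ^+ p).
    exact: (@hardy_layer R m q w w1 d d0 d1 e e0 e2).
  have h2 := @bump_Sw e w G w1 Gp.
  rewrite big_split in h2.
  have i2 : mu.-integrable B (EFin \o (fun x => `|w (radial x)| ^+ p)).
    have [M M0 HM] := continuous_ball_bounded wc.
    apply: (@ball_bounded_integrable _ _ _ (M ^+ p)).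
      apply: measurable_funTS; apply: measurable_funX; apply: measurableT_comp => //.
      apply: (measurableT_comp (continuous_measurable_rV wc)); exact: measurable_radial.
    move=> x _; rewrite normrX normr_id; apply: lerXn2r; rewrite ?nnegrE //; apply: HM.
    have [->|x0] := eqVneq x 0; first by rewrite /radial scaler0 enorm0.
    by rewrite enorm_radial.
  have Vd : \int[mu]_(x in B) d = d * V by rewrite /Rintegral (integral_cst _ mball) fineM // ge0_fin_numE // ball_fin.
  have SV : \int[mu]_(x in B) (`|w (radial x)| ^+ p + d) = S + d * V.
    by rewrite (RintegralD mball i2 (integrable_cst_ball d)) Vd.
  rewrite SV in h1.
  have h3 : \int[mu]_(x in B) (bump 2 (tau e x) * Sw w x ^+ p) <= N * (D + c).
    apply: (le_trans h2); apply: ler_wpM2l => //; apply: lerD.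
      by rewrite lerDr rnp_ge0.
    by rewrite lerDr rnp_ge0.
  apply: (le_trans (ler_wpM2l Ke h1)); rewrite mulrDr; apply: lerD.
    have -> : K * e ^- p * C1 * (1 + V) * (S + d) = K * e ^- p * (C1 * ((1 + V) * (S + d))) by ring.
    apply: (ler_wpM2l Ke); apply: (ler_wpM2l C10).
    have dV : 0 <= V * S by rewrite mulr_ge0.
    by rewrite mulrDl mul1r mulrDr [V * d]mulrC; lra.
  have -> : K * e ^- p * (C2 * e ^+ p * \int[mu]_(x in B) (bump 2 (tau e x) * Sw w x ^+ p)) =
     K * C2 * \int[mu]_(x in B) (bump 2 (tau e x) * Sw w x ^+ p).
    by field; rewrite expf_neq0 // gt_eqF.
  by rewrite -(mulrA (K * C2)); exact: (ler_wpM2l (mulr_ge0 K0 C20) h3).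
have fG := Lp_ballB (Lchi _ (pwp j)) (Gp j).
apply: (le_trans (le_trans _ (rnpD fG dLp))).
  by rewrite le_eqVlt; apply/orP; left; apply/eqP; apply: eq_Rintegral => x _; rewrite dE; congr (`|_| ^+ p); ring.
have h4 := split_le _ _ (pwp j) (Gp j).
have h5 : 2 ^+ p * (rnp p (fun x => partial j w x - G j x) + rnp p (fun x => L e x * G j x)) <= 2 ^+ p * (D + c).
  by apply: ler_wpM2l => //; exact: lerD.
have -> : E = 2 ^+ p * (2 ^+ p * (D + c) + 2 ^+ p * (K * e ^- p * C1 * (1 + V) * (S + d) + K * C2 * N * (D + c))).
  by rewrite ES; ring.
apply: ler_wpM2l => //; apply: lerD; first exact: le_trans h4 h5.
apply: (le_trans bound); rewrite ler_peMl //.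
by apply: addr_ge0; rewrite !mulr_ge0 // addr_ge0 // ltW.
Qed.

(** The width e of the layer is fixed so that v and G have little mass there; the index k and the
    parameter d are chosen afterwards, so that the boundary values of w_k beat the constant A'
    belonging to e. *)
Lemma zero_trace (w_ : nat -> 'rV[R]_n -> R) v (G : 'I_n -> 'rV[R]_n -> R) (eta : R) :
  (forall k, Ck 2 (w_ k)) -> Lp_ball p v -> (forall j, Lp_ball p (G j)) ->
  rnp p (fun x => w_ k x - v x) @[k --> \oo] --> (0 : R) ->
  (forall j, rnp p (fun x => partial j (w_ k) x - G j x) @[k --> \oo] --> (0 : R)) ->
  rnp p (fun x => w_ k (radial x)) @[k --> \oo] --> (0 : R) -> 0 < eta ->
  exists z, [/\ Ck 2 z, exists2 r : R, r < 1 & forall x, r <= nsq x -> z x = 0,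
    rnp p (fun x => z x - v x) <= eta &
    forall j, rnp p (fun x => partial j z x - G j x) <= eta].
Proof.
move=> w2 vp Gp wv wG wr eta0; have [A A0 HA] := cutoff_bound.
have A1 : 0 < A + 1 by rewrite ltr_wpDl.
have n0 : 0 < 1 + n%:R :> R by rewrite ltr_wpDr.
pose d0 := eta / (4 * (A + 1) * (1 + n%:R)).
have d00 : 0 < d0 by rewrite divr_gt0 // !mulr_gt0.
have sum_le (a : R) (b : 'I_n -> R) : a <= d0 -> (forall j, b j <= d0) -> a + \sum_j b j <= (1 + n%:R) * d0.
  move=> ha hb; rewrite mulrDl mul1r; apply: lerD => //.
  apply: (@le_trans _ _ (\sum_(j < n) d0)); first by apply: ler_sum => j _.
  by rewrite sumr_const card_ord mulr_natl.
(* The index k1 only fixes the layer width; the member of the sequence used is another index k. *)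
have [k1 [hk1 hk2]] : exists k : nat, rnp p (fun x => L k.+2%:R^-1 x * v x) <= d0 /\
    forall j, rnp p (fun x => L k.+2%:R^-1 x * G j x) <= d0.
  have H := filter_forall eventually_filter (fun j : 'I_n => L_cvg0 (Gp j) d00).
  by near \oo => k; exists k; split; near: k; [exact: L_cvg0|exact: H].
pose e : R := k1.+2%:R^-1.
have e0 : 0 < e by rewrite invr_gt0.
have e2 : e <= 2^-1 by rewrite lef_pV2 ?posrE // ler_nat.
have [A' A'0 HA'] := HA e e0 e2.
have A'1 : 0 < A' + 1 by rewrite ltr_wpDl.
pose d1 := eta / (4 * (A' + 1)).
have d10 : 0 < d1 by rewrite divr_gt0 // mulr_gt0.
have [k [hk3 hk4 hk5]] : exists k : nat, [/\ rnp p (fun x => w_ k x - v x) <= d0,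
    forall j, rnp p (fun x => partial j (w_ k) x - G j x) <= d0 & rnp p (fun x => w_ k (radial x)) <= d1].
  have H := filter_forall eventually_filter (fun j : 'I_n => cvgr_le _ (wG j) _ d00).
  by near \oo => k; exists k; split; near: k; [exact: (cvgr_le _ wv)|exact: H|exact: (cvgr_le _ wr)].
pose d := Num.min 1 d1.
have dp : 0 < d by rewrite lt_min ltr01.
have dle1 : d <= 1 by rewrite ge_min lexx.
have dled : d <= d1 by rewrite ge_min lexx orbT.
have [h1 h2] := HA' (w_ k) v G d (w2 k) vp Gp dp dle1.
have E_le : A * (rnp p (fun x => w_ k x - v x) + \sum_j rnp p (fun x => partial j (w_ k) x - G j x) +
    (rnp p (fun x => L e x * v x) + \sum_j rnp p (fun x => L e x * G j x))) +
    A' * (rnp p (fun x => w_ k (radial x)) + d) <= eta.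
  have s1 := sum_le _ _ hk3 hk4; have s2 := sum_le _ _ hk1 hk2.
  apply: (@le_trans _ _ (A * ((1 + n%:R) * d0 + (1 + n%:R) * d0) + A' * (d1 + d1))).
    by apply: lerD; apply: ler_wpM2l => //; exact: lerD.
  have f1 : (A + 1) * ((1 + n%:R) * d0 + (1 + n%:R) * d0) = eta / 2.
    by rewrite /d0; field; rewrite !lt0r_neq0.
  have f2 : (A' + 1) * (d1 + d1) = eta / 2 by rewrite /d1; field; rewrite lt0r_neq0.
  have f3 : 0 <= (1 + n%:R) * d0 by rewrite mulr_ge0 // ltW.
  move: ((1 + n%:R) * d0) f1 f3 => c f1 f3.
  have f4 : A * (c + c) <= eta / 2 by rewrite -f1 mulrDl lerDl; lra.
  have f5 : A' * (d1 + d1) <= eta / 2 by rewrite -f2 mulrDl lerDl; lra.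
  by move: (A * _) (A' * _) f4 f5 => a b; lra.
exists (fun x => chi e x * w_ k x); split.
- by apply: CkM; [exact: Ck_chi|exact: w2].
- exists (1 - e / 4); first by rewrite ltrBlDr ltrDl divr_gt0.
  move=> x hx; rewrite /chi sstep0 ?mul0r //.
  have : 4 / e * (1 - e / 4) <= 4 / e * nsq x by rewrite ler_wpM2l // divr_ge0 // ltW.
  have -> : 4 / e * (1 - e / 4) = 4 / e - 1 by field; exact: lt0r_neq0.
  by move: (nsq x) (4 / e) => s t; lra.
- exact: le_trans h1 E_le.
- by move=> j; exact: le_trans (h2 j) E_le.
Unshelve. all: by end_near. Qed.

(** Integrals over the sphere dominate those of radial extensions over the ball. They are extended
    reals, finite only for large k, hence the restriction to a neighbourhood of infinity. *)
Lemma trace_radial_cvg (f_ : nat -> 'rV[R]_n -> R) g : (forall k, continuous (f_ k)) -> continuous g ->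
  Lp_cvg sphere_measure unit_sphere p f_ g ->
  rnp p (fun x => f_ k (radial x) - g (radial x)) @[k --> \oo] --> (0 : R).
Proof.
move=> fc gc; rewrite /Lp_cvg => /fine_cvgP[fin cv].
apply: (squeeze_cvgr _ (cvg_cst (0 : R)) cv); near=> k; rewrite rnp_ge0 /=.
have fgc : continuous (fun x => f_ k x - g x).
  by apply: (@Ck_continuous _ _ 0); apply: CkB; [exact: fc|exact: gc].
have mF : measurable_fun setT (fun x => f_ k x - g x) := continuous_measurable_rV fgc.
have fgp : Lp_ball p (fun x => f_ k (radial x) - g (radial x)).
  have [M M0 HM] := continuous_ball_bounded fgc.
  apply: (Lp_ball_dom (h := cst (M ^+ p))).
  - apply: measurable_funTS; apply: (measurableT_comp mF); exact: measurable_radial.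
  - exact: integrable_cst_ball.
  - move=> x _; apply: lerXn2r; rewrite ?nnegrE //; apply: HM.
    have [->|x0] := eqVneq x 0; first by rewrite /radial scaler0 enorm0.
    by rewrite enorm_radial.
rewrite -lee_fin -(rnpE fgp) fineK; last by near: k.
apply: (sphere_integral_ge (F := fun x => (`|f_ k x - g x| ^+ p)%:E)).
  by apply/measurable_EFinP; apply: measurable_funX; exact: measurableT_comp.
by move=> x; rewrite lee_fin exprn_ge0.
Unshelve. all: by end_near. Qed.

(** Each component of u - x has zero trace: the sequence defining the trace of u, minus the
    coordinate, tends to 0 on the sphere. Approximations with tolerance 1 / (k + 1), vanishing near
    the sphere, are added to the identity. *)
Lemma trace_approximable (u : 'rV[R]_n -> 'rV[R]_n) :
  (forall i, Lp_ball p (component u i)) ->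
  (forall i j, Lp_ball p (weak_partial j (component u i))) ->
  (forall i, has_trace p (component u i) (component id i)) ->
  approximable p u (fun x => \matrix_(i, j) weak_partial j (component u i) x).
Proof.
move=> up Ap ut.
have Z0 (ki : nat * 'I_n) : exists z, [/\ Ck 2 z, exists2 r : R, r < 1 & forall x, r <= nsq x -> z x = 0,
    rnp p (fun x => z x - (component u ki.2 x - x 0 ki.2)) <= ki.1.+1%:R^-1 &
    forall j, rnp p (fun x => partial j z x - (weak_partial j (component u ki.2) x - (ki.2 == j)%:R)) <= ki.1.+1%:R^-1].
  case: ki => k i /=; have [f_ [fs fu fp ft]] := ut i.
  have fLp l : Lp_ball p (f_ l) by apply: Lp_ball_continuous; exact: (Ck_continuous (fs l 0%N)).
  have pLp j l : Lp_ball p (partial j (f_ l)).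
    by apply: Lp_ball_continuous; exact: (Ck_continuous (Ck_partial j (fs l 1%N))).
  have cp : Lp_ball p (fun x => x 0 i) by apply: Lp_ball_continuous; exact: (Ck_continuous (Ck_coord 0 i)).
  have dp (j : 'I_n) : Lp_ball p (cst (i == j)%:R : 'rV[R]_n -> R) by apply: Lp_ball_continuous; exact: cst_continuous.
  have fd l j x : partial j (fun y => f_ l y - y 0 i) x = partial j (f_ l) x - (i == j)%:R.
    rewrite partialB ?partial_coord //; first exact: (Ck_derivable (fs l 1%N)).
    exact: (Ck_derivable (Ck_coord 1 i)).
  apply: (@zero_trace (fun l x => f_ l x - x 0 i)).
  - by move=> l; apply: CkB; [exact: fs|exact: Ck_coord].
  - exact: Lp_ballB.
  - by move=> j; exact: (Lp_ballB (Ap i j) (dp j)).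
  - move/(Lp_cvgE fLp (up i)) : fu; apply: cvg_trans; apply: near_eq_cvg; near=> l.
    by apply: eq_Rintegral => x _; rewrite opprB addrA subrK.
  - move=> j; move/(Lp_cvgE (pLp j) (Ap i j)) : (fp j); apply: cvg_trans; apply: near_eq_cvg; near=> l.
    by apply: eq_Rintegral => x _; rewrite fd opprB addrA subrK.
  - exact: (trace_radial_cvg (fun l => Ck_continuous (fs l 0%N)) (Ck_continuous (Ck_coord 0 i)) ft).
  - by rewrite invr_gt0.
have [Z HZ] := choice Z0.
pose U k x : 'rV[R]_n := \row_i (x 0 i + Z (k, i) x).
have UE k i : component (U k) i = fun x => x 0 i + Z (k, i) x by apply/funext => x; rewrite /component mxE.
have U2 k i : Ck 2 (component (U k) i).
  by rewrite UE; apply: CkD; [exact: Ck_coord|have [] := HZ (k, i)].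
have hcv : (fun k : nat => k.+1%:R^-1 : R) @ \oo --> (0 : R) by exact: cvg_harmonic.
exists U; split => //.
- move=> k.
  (* One radius per component; their maximum serves for the whole map. *)
  have [r Hr] := choice (fun i : 'I_n => let: And4 _ (ex_intro2 r r1 rz) _ _ := HZ (k, i) in
     ex_intro (fun r : R => r < 1 /\ forall x, r <= nsq x -> Z (k, i) x = 0) r (conj r1 rz)).
  exists (\big[Num.max/0]_i r i).
    by apply: bigmax_lt => // i _; have [] := Hr i.
  move=> x hx; apply/rowP => i; rewrite mxE; have [_ ->] := Hr i; first by rewrite addr0.
  by apply: le_trans hx; exact: le_bigmax.
- move=> i; apply/(Lp_cvgE _ (up i)); first by move=> k; apply: Lp_ball_continuous; exact: (Ck_continuous (U2 k i)).
  apply: (squeeze_cvgr _ (cvg_cst (0 : R)) hcv); near=> k; rewrite rnp_ge0 /=.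
  have [_ _ h _] := HZ (k, i); apply: le_trans h; rewrite le_eqVlt; apply/orP; left; apply/eqP.
  by apply: eq_Rintegral => x _; rewrite UE /= opprB addrCA addrA.
- move=> i j; rewrite (_ : (fun x => _) = weak_partial j (component u i)); last by apply/funext => x; rewrite mxE.
  apply/(Lp_cvgE _ (Ap i j)).
    by move=> k; apply: Lp_ball_continuous; exact: (Ck_continuous (Ck_partial j (U2 k i))).
  apply: (squeeze_cvgr _ (cvg_cst (0 : R)) hcv); near=> k; rewrite rnp_ge0 /=.
  have [z2 _ _ h] := HZ (k, i); apply: le_trans (h j); rewrite le_eqVlt; apply/orP; left; apply/eqP.
  apply: eq_Rintegral => x _; rewrite UE partialD ?partial_coord.
  + by rewrite /= opprB addrCA addrA.
  + exact: (Ck_derivable (Ck_coord 1 i)).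
  + exact: Ck_derivable z2.
Unshelve. all: by end_near. Qed.

End trace.

(** * The radial map *)

Section radial_map.
Context {R : realType} {m : nat}.
Local Notation n := m.+1.
Local Notation mu := (@lebesgue_rV R n).
Local Notation B := (@unit_ball R n).
Implicit Types (x : 'rV[R]_n) (d : R).

Lemma ae_neq0 : {ae mu, forall x, B x -> x != 0}.
Proof.
exists [set (0 : 'rV[R]_n)]; split.
- have -> : [set (0 : 'rV[R]_n)] = (@enorm R n) @^-1` [set 0].
    by apply/seteqP; split => [x ->|x]; [exact: enorm0|exact: enorm_eq0].
  by rewrite -[X in measurable X]setTI; exact: measurable_enorm.
- exact: lebesgue_rV_set0.
- move=> x h; apply: contrapT => /eqP x0; apply: h => _; exact: x0.
Qed.

Lemma enorm_gt0 x : x != 0 -> 0 < enorm x.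
Proof.
by move=> x0; rewrite lt_def enorm_ge0 andbT; apply: contra_neq x0; exact: enorm_eq0.
Qed.

(* A positive approximation of [1 / enorm], equal to [1] on the sphere. *)
Definition soft_inv d x : R := ((1 - d) * nsq x + d) `^ (- 2^-1).
Local Notation T := soft_inv.

Section fixed_parameter.
Variable d : R.
Hypotheses (d0 : 0 < d) (d1 : d <= 2^-1).

Let S_gt0 x : 0 < (1 - d) * nsq x + d.
Proof. by apply: ltr_wpDl => //; apply: mulr_ge0; [have := d1; lra|exact: nsq_ge0]. Qed.

Lemma soft_inv_gt0 x : 0 < T d x. Proof. exact: powR_gt0. Qed.

Lemma Ck_soft_inv k : Ck k (T d).
Proof. by apply: Ck_powR => //; exact: Ck_affine_nsq. Qed.

Lemma soft_inv_sqr x : T d x ^+ 2 = ((1 - d) * nsq x + d)^-1.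
Proof.
rewrite -(powR_mulrn _ (ltW (soft_inv_gt0 x))) /soft_inv -powRrM (_ : - 2^-1 * 2%:R = -1); last by field.
by rewrite powR_inv1 // ltW.
Qed.

Lemma soft_inv_sphere x : nsq x = 1 -> T d x = 1.
Proof. by move=> x1; rewrite /soft_inv x1 mulr1 subrK powR1. Qed.

Lemma partial_soft_inv j x : partial j (T d) x = - (1 - d) * T d x ^+ 3 * x 0 j.
Proof.
rewrite /soft_inv partial_powR //; last by apply: Ck_derivable; exact: (Ck_affine_nsq 1).
have -> : partial j (fun y => (1 - d) * nsq y + d) x = (1 - d) * (2 * x 0 j).
  rewrite partialD; [|exact: (Ck_derivable (CkM (Ck_cst 1 (1 - d)) (Ck_nsq 1)))|exact: derivable_cst].
  rewrite partial_cst addr0 partialM; [|exact: derivable_cst|exact: (Ck_derivable (Ck_nsq 1))].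
  by rewrite partial_cst mulr0 addr0 partial_nsq.
rewrite (_ : _ `^ (- 2^-1 - 1) = T d x ^+ 3); first by rewrite -/(T d x); field.
rewrite powRD; last by apply/implyP => _; rewrite gt_eqF.
by rewrite -/(T d x) powR_inv1 ?ltW // -soft_inv_sqr -exprS.
Qed.

Lemma soft_inv_le x : B x -> x != 0 -> T d x <= (enorm x)^-1.
Proof.
move=> xB x0; have r0 := enorm_gt0 x0; have x1 := (unit_ballE x).1 xB.
rewrite -(@ler_pXn2r _ 2) ?nnegrE ?invr_ge0 ?enorm_ge0 ?(ltW (soft_inv_gt0 x)) //.
rewrite soft_inv_sqr exprVn -nsqE lef_pV2 ?posrE ?nsqE ?exprn_gt0 // -?nsqE //.
have : d * nsq x <= d * 1 by rewrite ler_wpM2l // ltW.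
by rewrite mulrBl mul1r; move: (d * nsq x) => t; lra.
Qed.

Lemma soft_inv_nsq x : (1 - d) * (T d x ^+ 2 * nsq x) <= 1.
Proof.
by rewrite soft_inv_sqr mulrCA mulrC ler_pdivrMr // mul1r lerDl ltW.
Qed.

(** With p = [q.+1], the field (T^p - 1) x vanishes on the sphere. Its divergence n (T^p - 1) - p (1
    - d) T^(p+2) |x|^2 is at least (n - p) T^p - n, since (1 - d) T^2 |x|^2 <= 1. The resulting
    bound is uniform in d. *)
Lemma soft_inv_bound q : q.+1%:R < n%:R :> R ->
  \int[mu]_(x in B) T d x ^+ q.+1 <= n%:R / (n%:R - q.+1%:R) * fine (mu B).
Proof.
move=> qn; set p := q.+1; pose F j x := (T d x ^+ p - 1) * x 0 j.
have TX k : Ck 1 (fun x => T d x ^+ k) by apply: CkX; exact: Ck_soft_inv.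
have F1 j : Ck 1 (F j).
  by apply: CkM; [apply: CkB; [exact: TX|exact: Ck_cst]|exact: Ck_coord].
have F0 j x : nsq x = 1 -> F j x = 0 by move=> x1; rewrite /F soft_inv_sphere // expr1n subrr mul0r.
have pc j : continuous (partial j (F j)) := Ck_continuous (Ck_partial j (F1 j)).
have D0 : \int[mu]_(x in B) (\sum_j partial j (F j) x) = 0.
  rewrite (Rintegral_fin_sum mball); last by move=> j _; exact: continuous_ball_integrable.
  by rewrite big1 // => j _; exact: (@ball_div0 _ _ _ _ (F1 j) (F0 j)).
have dF j x : partial j (F j) x = (T d x ^+ p - 1) - p%:R * (1 - d) * T d x ^+ p.+2 * x 0 j ^+ 2.
  rewrite /F partialM; [|exact: (Ck_derivable (CkB (TX p) (Ck_cst 1 1)))|exact: (Ck_derivable (Ck_coord 1 j))].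
  rewrite partial_coord eqxx mulr1 partialB; [|exact: Ck_derivable (TX p)|exact: derivable_cst].
  rewrite partial_cst subr0.
  have dT : is_derive x (delta_mx 0 j) (T d) (partial j (T d) x) := Ck_is_derive j x (Ck_soft_inv 1).
  have dTp : is_derive x (delta_mx 0 j) (fun y => T d y ^+ p) (p%:R * T d x ^+ q * partial j (T d) x).
    by have := is_deriveX p dT; rewrite exprfctE.
  have [_] := dTp; rewrite -/(partial j (fun y => T d y ^+ p) x) => ->.
  rewrite partial_soft_inv (_ : T d x ^+ p.+2 = T d x ^+ q * T d x ^+ 3); last by rewrite -exprD addn3.
  move: (T d x ^+ p) (T d x ^+ q) (T d x ^+ 3) (p%:R : R) => a b c e.
  by ring.
have pw x : B x -> (n%:R - p%:R) * T d x ^+ p <= \sum_j partial j (F j) x + n%:R.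
  move=> xB; under eq_bigr do rewrite dF.
  rewrite big_split /= sumr_const card_ord sumrN -mulr_sumr -/(nsq x).
  have h : p%:R * (1 - d) * T d x ^+ p.+2 * nsq x <= p%:R * T d x ^+ p.
    have -> : p%:R * (1 - d) * T d x ^+ p.+2 * nsq x =
        p%:R * (T d x ^+ p * ((1 - d) * (T d x ^+ 2 * nsq x))).
      rewrite -addn2 exprD; move: (T d x ^+ p) (T d x ^+ 2) (nsq x) (p%:R : R) => a b c e.
      by ring.
    apply: (ler_wpM2l (ler0n R p)).
    by apply: (ler_piMr (exprn_ge0 p (ltW (soft_inv_gt0 x)))); exact: soft_inv_nsq.
  rewrite -[(_ - 1) *+ n]mulr_natl; move: h; move: (p%:R * (1 - d) * _ * _) => t h.
  have -> : (n%:R - p%:R) * T d x ^+ p = n%:R * T d x ^+ p - p%:R * T d x ^+ p by ring.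
  by rewrite mulrBr mulr1; lra.
have np : 0 < n%:R - p%:R :> R by rewrite subr_gt0.
have iT : mu.-integrable B (EFin \o (fun x => T d x ^+ p)).
  by apply: continuous_ball_integrable; exact: Ck_continuous (TX p).
have iD : mu.-integrable B (EFin \o (fun x => \sum_j partial j (F j) x)).
  by apply: (integrable_fin_sum mball) => j _; exact: continuous_ball_integrable.
have := le_Rintegral mball (integrableZl mball (n%:R - p%:R) iT)
  (integrableD mball iD (integrable_cst_ball n%:R)) pw.
rewrite (RintegralZl _ mball iT) (RintegralD mball iD (integrable_cst_ball _)) D0 add0r.
rewrite (Rintegral_cst _ mball) => h.
by rewrite mulrAC ler_pdivlMr // mulrC.
Qed.

End fixed_parameter.

Let cvg_d : k.+2%:R^-1 @[k --> \oo] --> (0 : R).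
Proof.
have h : (fun k : nat => k.+1%:R^-1 : R) @ \oo --> (0 : R) by exact: cvg_harmonic.
apply: (squeeze_cvgr _ (cvg_cst (0 : R)) h); near=> k.
by rewrite invr_ge0 ler0n /= lef_pV2 ?posrE // ler_nat.
Unshelve. all: by end_near. Qed.

Lemma cvg_soft_inv x : x != 0 -> T k.+2%:R^-1 x @[k --> \oo] --> (enorm x)^-1.
Proof.
move=> x0; have r0 := enorm_gt0 x0.
have d0 := cvg_d.
have S : (1 - k.+2%:R^-1) * nsq x + k.+2%:R^-1 @[k --> \oo] --> nsq x.
  rewrite -[X in _ --> X]addr0 -[X in X + _]mul1r -[X in X * _ + _](subr0 1).
  apply: cvgD => //; apply: cvgM; last exact: cvg_cst.
  by apply: cvgB => //; exact: cvg_cst.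
have E (k : nat) : T k.+2%:R^-1 x = (Num.sqrt ((1 - k.+2%:R^-1) * nsq x + k.+2%:R^-1))^-1.
  rewrite /soft_inv powRN powR12_sqrt // addr_ge0 ?invr_ge0 // mulr_ge0 ?nsq_ge0 //.
  by rewrite subr_ge0 invf_le1 // ler1n.
under eq_fun do rewrite E.
apply: cvgV; first exact: lt0r_neq0.
by apply: (continuous_cvg _ _ S); exact: sqrt_continuous.
Qed.

Let dk0 (k : nat) : 0 < k.+2%:R^-1 :> R. Proof. by rewrite invr_gt0. Qed.

Let dk2 (k : nat) : k.+2%:R^-1 <= 2^-1 :> R.
Proof. by rewrite lef_pV2 ?posrE // ler_nat. Qed.

Lemma measurable_inv_enorm : measurable_fun setT (fun x : 'rV[R]_n => (enorm x)^-1).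
Proof.
rewrite (_ : (fun x => _) = (@powR R ^~ (-1)) \o (@enorm R n)); last first.
  by apply/funext => x /=; rewrite powR_inv1 ?enorm_ge0.
by apply: measurableT_comp; [exact: measurable_powR|exact: measurable_enorm].
Qed.

(** Fatou's lemma for the approximations of 1 / |x|, whose integrals are bounded uniformly because p
    < n. *)
Lemma Lp_inv_enorm q : (q.+1 <= m)%N -> Lp_ball q.+1 (fun x : 'rV[R]_n => (enorm x)^-1).
Proof.
move=> qm; have qn : q.+1%:R < n%:R :> R by rewrite ltr_nat.
have mi := measurable_funTS measurable_inv_enorm : measurable_fun B (fun x => (enorm x)^-1).
have Tc k : continuous (fun x => T k.+2%:R^-1 x ^+ q.+1).
  by apply: (@Ck_continuous _ _ 0); apply: CkX; exact: Ck_soft_inv.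
have ip (x : 'rV[R]_n) : 0 <= (enorm x)^-1 by rewrite invr_ge0 enorm_ge0.
have [I _] : mu.-integrable B (EFin \o (fun x => (enorm x)^-1 ^+ q.+1)) /\
    \int[mu]_(x in B) (enorm x)^-1 ^+ q.+1 <= n%:R / (n%:R - q.+1%:R) * fine (mu B).
  apply: (@fatou_ball _ _ (fun k x => T k.+2%:R^-1 x ^+ q.+1)).
  - by move=> k; apply: measurable_funTS; exact: continuous_measurable_rV.
  - exact: measurable_funX.
  - by move=> k x _; apply: exprn_ge0; apply: ltW; exact: soft_inv_gt0.
  - by move=> x _; exact: exprn_ge0.
  - apply: filterS ae_neq0 => x h xB.
    have C := cvg_soft_inv (h xB).
    exact: (cvg_comp _ _ C (@exprn_continuous R q.+1 _)).
  - by move=> k; exact: continuous_ball_integrable.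
  - by move=> k; exact: soft_inv_bound.
by apply: (Lp_ball_dom mi I) => x _; rewrite ger0_norm.
Qed.

Lemma Lp_cvg_dominated q (f_ : nat -> 'rV[R]_n -> R) (f g : 'rV[R]_n -> R) :
  (forall k, Lp_ball q.+1 (f_ k)) -> Lp_ball q.+1 f -> Lp_ball q.+1 g ->
  {ae mu, forall x, B x -> f_ k x @[k --> \oo] --> f x} ->
  {ae mu, forall x, B x -> forall k, `|f_ k x| <= g x} ->
  Lp_cvg mu B q.+1 f_ f.
Proof.
move=> fkp fp gp cf bf; apply/(Lp_cvgE fkp fp).
have sp : mu.-integrable B (EFin \o (fun x => 2 ^+ q.+1 * (`|g x| ^+ q.+1 + `|f x| ^+ q.+1))).
  exact: (integrableZl mball (2 ^+ q.+1) (integrableD mball (Lp_ball_integrable gp) (Lp_ball_integrable fp))).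
have mk (k : nat) := measurable_norm_expr q.+1 (Lp_ballB (fkp k) fp).1.
have [_ C] : mu.-integrable B (EFin \o cst (0 : R)) /\
   (\int[mu]_(x in B) `|f_ k x - f x| ^+ q.+1) @[k --> \oo] --> (\int[mu]_(x in B) cst (0 : R) x).
  apply: (Rintegral_dominated_ae mk (measurable_cst (0 : R)) _ sp).
    apply: filterS cf => x h xB; have C := h xB.
    rewrite -[X in _ --> X](_ : `|f x - f x| ^+ q.+1 = 0); last by rewrite subrr normr0 expr0n.
    have C' : `|f_ k x - f x| @[k --> \oo] --> `|f x - f x|.
      by apply: cvg_norm; apply: cvgB => //; exact: cvg_cst.
    exact: (cvg_comp _ _ C' (@exprn_continuous R q.+1 _)).
  apply: filterS bf => x h xB k; rewrite normrX normr_id.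
  apply: (@le_trans _ _ ((`|f_ k x| + `|f x|) ^+ q.+1)).
    by apply: lerXn2r; rewrite ?nnegrE ?addr_ge0 // ler_normB.
  apply: (le_trans (exprD_le _ _ _)) => //; apply: ler_wpM2l; first exact: exprn_ge0.
  apply: lerD => //; apply: lerXn2r; rewrite ?nnegrE //.
  exact: le_trans (h xB k) (ler_norm _).
have I0 : \int[mu]_(x in B) cst (0 : R) x = 0 by rewrite /Rintegral integral0.
by rewrite I0 in C.
Qed.

(* The Jacobian matrix of [radial] away from the origin. *)
Let a (i j : 'I_n) x : R := (enorm x)^-1 * ((i == j)%:R - radial x 0 i * radial x 0 j).

(** Smooth approximations of the components of [radial] that equal the coordinates on the sphere.
    They serve both for the weak derivatives and as the sequence defining the trace. *)
Let wk (k : nat) (i : 'I_n) x : R := T k.+2%:R^-1 x * x 0 i.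

Let Ck_wk l k i : Ck l (wk k i).
Proof. by apply: CkM; [exact: Ck_soft_inv|exact: Ck_coord]. Qed.

Let partial_wk k i j x : partial j (wk k i) x = T k.+2%:R^-1 x * (i == j)%:R -
  (1 - k.+2%:R^-1) * T k.+2%:R^-1 x * ((T k.+2%:R^-1 x * x 0 i) * (T k.+2%:R^-1 x * x 0 j)).
Proof.
rewrite /wk partialM; [|exact: (Ck_derivable (Ck_soft_inv (dk0 k) (dk2 k) 1))|exact: (Ck_derivable (Ck_coord 1 i))].
rewrite partial_coord partial_soft_inv //; move: (T _ x) (x 0 i) (x 0 j) => t y z.
by ring.
Qed.

Let radial_le1 x i : `|radial x 0 i| <= 1.
Proof.
have [->|x0] := eqVneq x 0; first by rewrite /radial scaler0 mxE normr0.
by rewrite -(enorm_radial x0); exact: coord_le_enorm.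
Qed.

Let wk_le k i x : B x -> x != 0 -> `|wk k i x| <= 1.
Proof.
move=> xB x0; have r0 := enorm_gt0 x0; have Tp := soft_inv_gt0 (dk0 k) (dk2 k) x.
rewrite /wk normrM gtr0_norm //; apply: (@le_trans _ _ ((enorm x)^-1 * enorm x)).
  by apply: ler_pM => //; [exact: ltW|exact: soft_inv_le|exact: coord_le_enorm].
by rewrite mulVf // gt_eqF.
Qed.

Let measurable_radial_coord i : measurable_fun B (fun x : 'rV[R]_n => radial x 0 i).
Proof.
apply: measurable_funTS; apply: (measurableT_comp (measurable_coord i)); exact: measurable_radial.
Qed.

Let Lp_radial q i : Lp_ball q.+1 (component (@radial R n) i).
Proof.
apply: (Lp_ball_dom (measurable_radial_coord i) (integrable_cst_ball 1)) => x _.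
by apply: exprn_ile1.
Qed.

Let Lp_a q i j : (q.+1 <= m)%N -> Lp_ball q.+1 (a i j).
Proof.
move=> qm; have h := Lp_inv_enorm qm.
have -> : a i j = fun x => ((i == j)%:R - radial x 0 i * radial x 0 j) * (enorm x)^-1.
  by apply/funext => x; rewrite /a mulrC.
apply: (Lp_ballM (M := 2) _ _ h).
  by apply: measurable_funB => //; apply: measurable_funM; exact: measurable_radial_coord.
move=> x _; apply: (le_trans (ler_normB _ _)); rewrite -[2]/(1 + 1 : R); apply: lerD.
  by case: eqP => _; rewrite ?normr1 ?normr0.
by rewrite normrM -[leRHS]mul1r; apply: ler_pM.
Qed.

Let wk_cvg q i : Lp_cvg mu B q.+1 (fun k => wk k i) (component (@radial R n) i).
Proof.
apply: (@Lp_cvg_dominated _ _ _ (cst 1)) => //.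
- by move=> k; apply: Lp_ball_continuous; exact: (Ck_continuous (Ck_wk 0 k i)).
- by apply: Lp_ball_continuous; exact: cst_continuous.
- apply: filterS ae_neq0 => x h xB; rewrite /component /radial mxE.
  by apply: cvgM; [exact: cvg_soft_inv (h xB)|exact: cvg_cst].
- by apply: filterS ae_neq0 => x h xB k; exact: wk_le (h xB).
Qed.

Let partial_wk_cvg q i j : (q.+1 <= m)%N ->
  Lp_cvg mu B q.+1 (fun k => partial j (wk k i)) (a i j).
Proof.
move=> qm; have h := Lp_inv_enorm qm.
have h2 : Lp_ball q.+1 (fun x => 2 * (enorm x)^-1).
  by apply: (Lp_ballM (c := cst 2) (M := 2)) => // x _; rewrite ger0_norm.
apply: (Lp_cvg_dominated _ (Lp_a i j qm) h2).
- by move=> k; apply: Lp_ball_continuous; exact: (Ck_continuous (Ck_partial j (Ck_wk 1 k i))).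
- apply: filterS ae_neq0 => x x0 xB; under eq_fun do rewrite partial_wk.
  have C := cvg_soft_inv (x0 xB).
  have d0 := cvg_d.
  have -> : a i j x = (enorm x)^-1 * (i == j)%:R - (1 - 0) * (enorm x)^-1 *
      (((enorm x)^-1 * x 0 i) * ((enorm x)^-1 * x 0 j)).
    by rewrite /a /radial !mxE; ring.
  apply: cvgB; first by apply: cvgM => //; exact: cvg_cst.
  apply: cvgM; first by apply: cvgM => //; apply: cvgB => //; exact: cvg_cst.
  by apply: cvgM; apply: cvgM => //; exact: cvg_cst.
- apply: filterS ae_neq0 => x x0 xB k; rewrite partial_wk.
  have Tp := soft_inv_gt0 (dk0 k) (dk2 k) x.
  have Tr := soft_inv_le (dk0 k) (dk2 k) xB (x0 xB).
  have wi := wk_le k i xB (x0 xB); have wj := wk_le k j xB (x0 xB).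
  apply: (@le_trans _ _ (2 * T k.+2%:R^-1 x)); last by rewrite ler_wpM2l.
  rewrite mulr_natl mulr2n; apply: (le_trans (ler_normB _ _)); apply: lerD.
    rewrite normrM (gtr0_norm Tp); apply: (ler_piMr (ltW Tp)).
    by case: eqP => _; rewrite ?normr1 ?normr0.
  have c0 : 0 <= 1 - k.+2%:R^-1 :> R by rewrite subr_ge0 invf_le1 // ler1n.
  have c1 : 1 - k.+2%:R^-1 <= 1 :> R by rewrite gerBl ltW.
  rewrite normrM normrM (ger0_norm c0) (gtr0_norm Tp) -[leRHS]mulr1; apply: ler_pM => //.
  + by rewrite mulr_ge0 // ltW.
  + by rewrite ler_piMl // ltW.
  + by rewrite normrM -[leRHS]mulr1; apply: ler_pM.
Qed.

Lemma radial_weak_partial i j : (1 <= m)%N ->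
  is_weak_partial j (component (@radial R n) i) (a i j).
Proof.
move=> m1; apply: (@weak_partial_limit _ _ (fun k => wk k i)).
- by move=> k; exact: Ck_wk.
- exact: Lp_radial.
- exact: Lp_a.
- exact: wk_cvg.
- exact: partial_wk_cvg.
Qed.

Lemma radial_admissible q : (q.+1 <= m)%N -> admissible q.+1 (@radial R n).
Proof.
move=> qm; have m1 : (1 <= m)%N by apply: leq_trans qm.
split; first split.
- move=> i; split => // j; exists (a i j); split; [exact: radial_weak_partial|exact: Lp_a].
- by apply: filterS ae_neq0 => x h xB; exact: enorm_radial (h xB).
move=> i; exists (fun k => wk k i); split.
- by move=> k l; exact: Ck_wk.
- exact: wk_cvg.
(* The trace condition refers to the chosen representative [weak_partial], known to agree with
   [a i j] only almost everywhere. *)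
- move=> j; have E := weak_partial_ae (radial_weak_partial i j m1).
  have Lw : Lp_ball q.+1 (weak_partial j (component (@radial R n) i)).
    have Hw := weak_partialP (ex_intro _ _ (radial_weak_partial i j m1)).
    have mw : measurable_fun B (weak_partial j (component (@radial R n) i)) by case: Hw => _ [].
    split => //; have [ma fa] := Lp_a i j qm.
    rewrite (@ae_eq_integral _ _ _ mu B (fun x => (`|a i j x| ^+ q.+1)%:E)) //.
    + exact: mball.
    + by apply/measurable_EFinP; exact: measurable_norm_expr.
    + by apply/measurable_EFinP; exact: measurable_norm_expr.
    + by apply: filterS E => x h xB; rewrite (h xB).
  have pk k : Lp_ball q.+1 (partial j (wk k i)).
    by apply: Lp_ball_continuous; exact: (Ck_continuous (Ck_partial j (Ck_wk 1 k i))).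
  have := partial_wk_cvg i j qm; rewrite /Lp_cvg; apply: cvg_trans; apply: near_eq_cvg; near=> k.
  apply: ae_eq_integral; [exact: mball|..].
  + by apply/measurable_EFinP; apply: measurable_norm_expr; exact: (Lp_ballB (pk k) (Lp_a i j qm)).1.
  + by apply/measurable_EFinP; apply: measurable_norm_expr; exact: (Lp_ballB (pk k) Lw).1.
  + by apply: filterS E => x h xB; rewrite (h xB).
- rewrite /Lp_cvg; apply: cvg_near_cst; near=> k; apply: integral0_eq => x xS.
  have x1 : nsq x = 1 by rewrite nsqE xS expr1n.
  by rewrite /wk soft_inv_sphere // mul1r subrr normr0 expr0n.
Unshelve. all: by end_near. Qed.

Lemma radial_jacobian : (1 <= m)%N ->
  {ae mu, forall x, B x -> [/\ x != 0, enorm (radial x) = 1 &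
    \matrix_(i, j) weak_partial j (component (@radial R n) i) x =
    (enorm x)^-1 *: (1%:M - (radial x)^T *m radial x)]}.
Proof.
move=> m1.
have H i j := weak_partial_ae (radial_weak_partial i j m1).
have H1 (i : 'I_n) : {ae mu, forall x, forall j : 'I_n, B x ->
    weak_partial j (component (@radial R n) i) x = a i j x}.
  exact: (@filter_forall _ _ (fun (j : 'I_n) (x : 'rV[R]_n) => B x ->
    weak_partial j (component (@radial R n) i) x = a i j x) (almost_everywhere mu) _ (H i)).
have H2 : {ae mu, forall x, forall i j : 'I_n, B x ->
    weak_partial j (component (@radial R n) i) x = a i j x}.
  exact: (@filter_forall _ _ (fun (i : 'I_n) (x : 'rV[R]_n) => forall j, B x ->
    weak_partial j (component (@radial R n) i) x = a i j x) (almost_everywhere mu) _ H1).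
apply: filterS2 H2 ae_neq0 => x h x0 xB; split; [exact: x0|exact: enorm_radial (x0 xB)|].
apply/matrixP => i j; rewrite !mxE (h i j xB) /a big_ord_recl big_ord0 addr0 !mxE.
by rewrite eq_sym.
Qed.

End radial_map.

(** * Minimality *)

Section pointwise.
Context {R : realType}.

(** The expression for q + 1 is a times the one for q plus a nonnegative multiple of g^q (g - a)^2;
    the same identity gives the equality case below. *)
Lemma weighted_amgm q (a g : R) : 0 <= a -> 0 <= g ->
  0 <= a ^+ q.+1 + q%:R * g ^+ q.+1 - q.+1%:R * g ^+ q * a.
Proof.
move=> a0 g0; elim: q => [|q IH]; first by rewrite mul0r addr0 expr0 expr1; lra.
have -> : a ^+ q.+2 + q.+1%:R * g ^+ q.+2 - q.+2%:R * g ^+ q.+1 * a =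
    a * (a ^+ q.+1 + q%:R * g ^+ q.+1 - q.+1%:R * g ^+ q * a) +
    q.+1%:R * (g ^+ q * (g - a) ^+ 2).
  by rewrite -!natr1 !exprS; move: (g ^+ q) (a ^+ q) (q%:R : R) => x y z; ring.
have h2 := mulr_ge0 (exprn_ge0 q g0) (sqr_ge0 (g - a)).
by rewrite addr_ge0 // ?(mulr_ge0 a0 IH) // mulr_ge0.
Qed.

Lemma weighted_amgm_eq q (a g : R) : 0 < a -> 0 <= g ->
  a ^+ q.+2 + q.+1%:R * g ^+ q.+2 - q.+2%:R * g ^+ q.+1 * a = 0 -> g = a.
Proof.
move=> a0 g0 E; have W := weighted_amgm q (ltW a0) g0.
have F : a * (a ^+ q.+1 + q%:R * g ^+ q.+1 - q.+1%:R * g ^+ q * a) +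
    q.+1%:R * (g ^+ q * (g - a) ^+ 2) = 0.
  rewrite -E -!natr1 !exprS; move: (g ^+ q) (a ^+ q) (q%:R : R) => x y z; ring.
have h1 := mulr_ge0 (ltW a0) W.
have h2 : 0 <= q.+1%:R * (g ^+ q * (g - a) ^+ 2).
  by apply: mulr_ge0 => //; apply: mulr_ge0; [exact: exprn_ge0|exact: sqr_ge0].
move/eqP : F; rewrite paddr_eq0 // => /andP[_].
rewrite mulf_eq0 pnatr_eq0 /= mulf_eq0 => /orP[|]; last by rewrite sqrf_eq0 subr_eq0 => /eqP.
rewrite expf_eq0 => /andP[_ /eqP gE]; move: E.
rewrite gE !expr0n /= !mulr0 mul0r addr0 subr0 => /eqP.
by rewrite expf_eq0 /= gt_eqF.
Qed.

(* In the application [r] is the distance to the origin, [a] and [g] are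
   multiples of the gradient norms of [radial] and [u], and [D] and [t] are
   the two terms of the null Lagrangian. *)
Definition deficit (q : nat) (Kq r g t : R) : R :=
  Kq * r * r^-1 ^+ q - t - Kq * (q%:R / q.+1%:R) * r ^+ 2 * (r^-1 ^+ q.+1 - g ^+ q.+1).

(** Splits the deficit into two nonnegative parts: the slack in the bound for the flux term t, and
    the slack in the inequality of the means between 1 / r and g. *)
Lemma deficitE q (Kq r g t : R) : 0 < r -> deficit q Kq r g t =
  (Kq * r * g ^+ q - t) + Kq * r ^+ 2 / q.+1%:R *
    (r^-1 ^+ q.+1 + q%:R * g ^+ q.+1 - q.+1%:R * g ^+ q * r^-1).
Proof.
move=> r0; have q1 : q%:R + 1 != 0 :> R by rewrite natr1 pnatr_eq0.
rewrite /deficit !exprS -(@natr1 R q); move: (r^-1 ^+ q) (g ^+ q) => x y.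
by field; rewrite q1 gt_eqF.
Qed.

Lemma deficit_ge0 q (Kq r g t : R) : 0 < r -> 0 <= g -> 0 <= Kq -> t <= Kq * r * g ^+ q ->
  0 <= deficit q Kq r g t.
Proof.
move=> r0 g0 K0 tle; rewrite deficitE //; apply: addr_ge0; first by rewrite subr_ge0.
apply: mulr_ge0; last by apply: weighted_amgm => //; rewrite invr_ge0 ltW.
by rewrite divr_ge0 // mulr_ge0 // sqr_ge0.
Qed.

Lemma deficit_eq0 q (Kq r g t : R) : 0 < r -> 0 <= g -> 0 < Kq -> t <= Kq * r * g ^+ q ->
  deficit q Kq r g t = 0 -> t = Kq * r * g ^+ q /\ ((0 < q)%N -> g = r^-1).
Proof.
move=> r0 g0 K0 tle; rewrite deficitE // => E.
have h1 : 0 <= Kq * r * g ^+ q - t by rewrite subr_ge0.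
have c0 : 0 < Kq * r ^+ 2 / q.+1%:R by rewrite divr_gt0 // mulr_gt0 // exprn_gt0.
have ri : 0 < r^-1 by rewrite invr_gt0.
have h2 := mulr_ge0 (ltW c0) (weighted_amgm q (ltW ri) g0).
move/eqP : E; rewrite paddr_eq0 // => /andP[/eqP e1 e2]; split; first by lra.
case: q {tle h1 h2 e1} c0 e2 => // q c0; rewrite mulf_eq0 (gt_eqF c0) /= => /eqP e _.
exact: weighted_amgm_eq e.
Qed.

(** Pointwise difference of the Lagrangians of u and of [radial], estimated by g^p - r^-p. The
    degree q term is eliminated through the deficit, and psi may be lowered to rho in front of it
    because the deficit is nonnegative; rho will be independent of the regularization. *)
Lemma lagrangian_gap q (K Kq r g D t phi psi rho al : R) : 0 < r -> 0 <= g -> 0 <= Kq ->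
  0 <= phi -> rho <= psi -> 0 <= psi -> 0 <= al -> D <= K * g ^+ q.+1 -> t <= Kq * r * g ^+ q ->
  (phi * D + al * psi * t) - (phi * (K * r^-1 ^+ q.+1) + al * psi * (Kq * r * r^-1 ^+ q)) +
    al * rho * deficit q Kq r g t <=
  (K * phi + al * (Kq * (q%:R / q.+1%:R)) * (psi * r ^+ 2)) * (g ^+ q.+1 - r^-1 ^+ q.+1).
Proof.
move=> r0 g0 K0 phi0 rp psi0 al0 DK tK.
have s0 := deficit_ge0 r0 g0 K0 tK.
have h1 : phi * D <= phi * (K * g ^+ q.+1) by rewrite ler_wpM2l.
have h2 : al * rho * deficit q Kq r g t <= al * psi * deficit q Kq r g t.
  by apply: ler_wpM2r => //; exact: ler_wpM2l.
apply: (@le_trans _ _ ((phi * (K * g ^+ q.+1) + al * psi * t) - (phi * (K * r^-1 ^+ q.+1) +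
  al * psi * (Kq * r * r^-1 ^+ q)) + al * psi * deficit q Kq r g t)).
  by apply: lerD => //; apply: lerB => //; apply: lerD.
rewrite /deficit; move: (r^-1 ^+ q) (r^-1 ^+ q.+1) (g ^+ q.+1) (q%:R / q.+1%:R) => x y z c.
by rewrite le_eqVlt; apply/orP; left; apply/eqP; ring.
Qed.

Lemma mdisc1 n (M : 'I_1 -> 'M[R]_n) : mdisc M = \tr (M ord0).
Proof.
rewrite /mdisc /mxtrace (reindex (fun i : 'I_n => [ffun _ : 'I_1 => i])) /=; last first.
  exists (fun f : {ffun 'I_1 -> 'I_n} => f ord0) => [i _|f _]; first by rewrite ffunE.
  by apply/ffunP => i; rewrite ffunE (ord1 i).
by apply: eq_bigr => i _; rewrite det_mx11 mxE !ffunE.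
Qed.

Lemma frobenius_radial m (w : 'rV[R]_m.+1) (c : R) : enorm w = 1 ->
  \sum_i \sum_j (c *: (1%:M - w^T *m w)) i j ^+ 2 = m%:R * c ^+ 2.
Proof.
move=> w1; have w2 : \sum_i w 0 i ^+ 2 = 1 by rewrite -enorm_sqr w1 expr1n.
have E i j : (c *: (1%:M - w^T *m w)) i j ^+ 2 =
    c ^+ 2 * ((i == j)%:R - (i == j)%:R * (2 * w 0 i ^+ 2) + w 0 i ^+ 2 * w 0 j ^+ 2).
  rewrite !mxE big_ord1 !mxE; case: eqP => [->|_]; rewrite /=; ring.
under eq_bigr => i _ do under eq_bigr => j _ do rewrite E.
under eq_bigr => i _ do rewrite -mulr_sumr big_split /= -mulr_sumr w2 mulr1.
rewrite -mulr_sumr big_split /= w2 mulrC; congr (_ * _).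
have F i : \sum_(j < m.+1) ((i == j)%:R - (i == j)%:R * (2 * w 0 i ^+ 2)) = 1 - 2 * w 0 i ^+ 2 :> R.
  rewrite (bigD1 i) //= eqxx mul1r big1 ?addr0 // => j; rewrite eq_sym => /negbTE ->.
  by rewrite mul0r subr0.
under eq_bigr do rewrite F.
rewrite sumrB -mulr_sumr w2 sumr_const card_ord -natr1; ring.
Qed.

Lemma unit_vectors_eq n (u w : 'rV[R]_n) : enorm u = 1 -> enorm w = 1 ->
  \tr (u^T *m w) = 1 -> u = w.
Proof.
move=> u1 w1 tr; apply/eqP; rewrite -subr_eq0; apply/eqP.
have E : \sum_i (u 0 i - w 0 i) ^+ 2 = 0.
  have -> : \sum_i (u 0 i - w 0 i) ^+ 2 = \sum_i u 0 i ^+ 2 - 2 * \sum_i u 0 i * w 0 i + \sum_i w 0 i ^+ 2.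
    by rewrite mulr_sumr -sumrB -big_split; apply: eq_bigr => i _ /=; ring.
  rewrite -!enorm_sqr u1 w1 (_ : \sum_i u 0 i * w 0 i = 1); first by ring.
  rewrite -tr /mxtrace; apply: eq_bigr => i _.
  by rewrite mxE big_ord1 mxE.
apply/rowP => i; rewrite !mxE; apply/eqP; rewrite -sqrf_eq0; apply/eqP.
have := psumr_eq0P (fun i _ => sqr_ge0 (u 0 i - w 0 i)) E.
by apply.
Qed.

End pointwise.

(** * Integrals and relations valid almost everywhere *)

Section ae_integrals.
Context {R : realType} {n : nat}.
Local Notation mu := (@lebesgue_rV R n).
Local Notation B := (@unit_ball R n).
Implicit Types (f g : 'rV[R]_n -> R).

Lemma Rintegral_ae_ge0 f : mu.-integrable B (EFin \o f) ->
  {ae mu, forall x, B x -> 0 <= f x} -> 0 <= \int[mu]_(x in B) f x.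
Proof.
move=> fi f0; have mf := integrableP _ _ _ fi.
have -> : \int[mu]_(x in B) f x = \int[mu]_(x in B) `|f x|.
  congr fine; apply: ae_eq_integral; [exact: mball|exact: mf.1|..].
    by have := mf.1; move/measurable_EFinP => h; apply/measurable_EFinP; exact: measurableT_comp.
  by apply: filterS f0 => x h xB; rewrite ger0_norm // h.
by apply: Rintegral_ge0.
Qed.

Lemma ae_le_Rintegral f g : mu.-integrable B (EFin \o f) -> mu.-integrable B (EFin \o g) ->
  {ae mu, forall x, B x -> f x <= g x} -> \int[mu]_(x in B) f x <= \int[mu]_(x in B) g x.
Proof.
move=> fi gi fg; rewrite -subr_ge0 -(RintegralB mball gi fi).
apply: Rintegral_ae_ge0; first exact: (integrableB mball gi fi).
by apply: filterS fg => x h xB; rewrite subr_ge0 h.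
Qed.

Lemma Rintegral_ae_eq0 f : mu.-integrable B (EFin \o f) ->
  {ae mu, forall x, B x -> 0 <= f x} -> \int[mu]_(x in B) f x <= 0 ->
  {ae mu, forall x, B x -> f x = 0}.
Proof.
move=> fi f0 fle; have mf := (integrableP _ _ _ fi).1.
have E : \int[mu]_(x in B) f x = 0 by apply/le_anti; rewrite fle Rintegral_ae_ge0.
have Ei : (\int[mu]_(x in B) (f x)%:E = 0)%E.
  by rewrite -(fineK (integrable_fin_num mball fi)); congr EFin; exact: E.
have Ea : (\int[mu]_(x in B) `|(EFin \o f) x| = 0)%E.
  rewrite -Ei; apply: ae_eq_integral; [exact: mball|exact: measurableT_comp|exact: mf|].
  by apply: filterS f0 => x h xB; rewrite /= ger0_norm // h.
have := (ae_eq_integral_abs mu mball mf).1 Ea.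
by apply: filterS => x h xB; have [] := h xB.
Qed.

Lemma Lp_ball_ae p f g : measurable_fun B f -> Lp_ball p g ->
  {ae mu, forall x, B x -> f x = g x} -> Lp_ball p f.
Proof.
move=> mf [mg gf] E; split => //.
rewrite (@ae_eq_integral _ _ _ mu B (fun x => (`|g x| ^+ p)%:E)) //.
- exact: mball.
- by apply/measurable_EFinP; exact: measurable_norm_expr.
- by apply/measurable_EFinP; exact: measurable_norm_expr.
- by apply: filterS E => x h xB; rewrite (h xB).
Qed.

Lemma sobolev_weak_partial p f j : sobolev p f ->
  Lp_ball p (weak_partial j f) /\ is_weak_partial j f (weak_partial j f).
Proof.
move=> [fp /(_ j)[g [wg gp]]]; have Hw := weak_partialP (ex_intro _ _ wg); split => //.
have mw : measurable_fun B (weak_partial j f) by case: Hw => _ [].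
exact: (Lp_ball_ae mw gp (weak_partial_ae wg)).
Qed.

Lemma Lp_ball_sum p (I : Type) (r : seq I) (F : I -> 'rV[R]_n -> R) :
  (forall i, Lp_ball p (F i)) -> Lp_ball p (fun x => \sum_(i <- r) F i x).
Proof.
move=> Fp; elim: r => [|i r IH].
  under eq_fun do rewrite big_nil.
  by apply: Lp_ball_continuous; exact: cst_continuous.
by under eq_fun do rewrite big_cons; exact: Lp_ballD.
Qed.

(** Integration against test functions does not see null sets, so a weak derivative depends only on
    the class of the function. *)
Lemma is_weak_partial_ae j f f' g : locally_integrable_ball f' ->
  {ae mu, forall x, B x -> f x = f' x} -> is_weak_partial j f g -> is_weak_partial j f' g.
Proof.
move=> lf' ff' [lf lg H]; split => // phi tphi; rewrite -(H phi tphi).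
have [mp _] := test_partial_bounded j tphi.
congr fine; apply: ae_eq_integral; [exact: mball|..].
- by apply/measurable_EFinP; apply: measurable_funM => //; exact: lf'.1.
- by apply/measurable_EFinP; apply: measurable_funM => //; exact: lf.1.
- by apply: filterS ff' => x h xB; rewrite (h xB).
Qed.

End ae_integrals.

(** * Comparison of energies *)

Section minimality.
Context {R : realType} {m : nat}.
Local Notation n := m.+1.
Local Notation mu := (@lebesgue_rV R n).
Local Notation B := (@unit_ball R n).
Implicit Types (u : 'rV[R]_n -> 'rV[R]_n) (x : 'rV[R]_n).

Lemma integrable_bounded_mul (c f : 'rV[R]_n -> R) (M : R) : measurable_fun B c ->
  (forall x, B x -> `|c x| <= M) -> mu.-integrable B (EFin \o f) ->
  mu.-integrable B (EFin \o (fun x => c x * f x)).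
Proof.
move=> mc cM fi; have [mf _] := integrableP _ _ _ fi.
apply: (le_integrable mball _ _ (integrableZl mball M fi)).
  by apply/measurable_EFinP; apply: measurable_funM => //; exact/measurable_EFinP.
move=> x xB; rewrite /= lee_fin !normrM; apply: ler_wpM2r => //.
exact: le_trans (cM x xB) (ler_norm _).
Qed.

Definition weak_jacobian u x : 'M[R]_n := \matrix_(i, j) weak_partial j (component u i) x.

(** Normalized so that the Jacobian has squared norm m g^2, the value for g times a projection of
    rank m = n - 1; for [radial] this makes g equal to 1 / |x|. *)
Definition scaled_gradient u x : R := gradient_norm u x / Num.sqrt m%:R.

Lemma admissible_facts q u : admissible q.+1 u ->
  [/\ forall i, Lp_ball q.+1 (component u i),
      forall i j, Lp_ball q.+1 (fun x => weak_jacobian u x i j),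
      approximable q.+1 u (weak_jacobian u) &
      {ae mu, forall x, B x -> enorm (u x) = 1 /\ u x *m weak_jacobian u x = 0}].
Proof.
move=> [[us u1] ut]; have up i : Lp_ball q.+1 (component u i) by case: (us i).
have wp i j := (sobolev_weak_partial j (us i)).1.
have Ap i j : Lp_ball q.+1 (fun x => weak_jacobian u x i j).
  rewrite (_ : (fun x => _) = weak_partial j (component u i)); first exact: wp.
  by apply/funext => x; rewrite mxE.
have ua : approximable q.+1 u (weak_jacobian u) by exact: trace_approximable.
split => //.
have H := weak_jacobian_orthogonal (fun i => Lp_ball1 (up i)) (fun i j => Lp_ball1 (Ap i j))
  (approximable1 up Ap ua) u1.
have H1 : {ae mu, forall x, B x -> enorm (u x) = 1} := u1.
by apply: filterS2 H H1 => x h1 h2 xB; split; [exact: h2|exact: h1].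
Qed.

Lemma measurable_powR_enorm (alpha : R) : measurable_fun setT (fun x => enorm x `^ alpha).
Proof. by apply: (measurableT_comp (measurable_powR alpha)); exact: measurable_enorm. Qed.

Lemma powR_enorm_le1 (alpha : R) x : 0 <= alpha -> B x -> `|enorm x `^ alpha| <= 1.
Proof.
move=> al0 xB; rewrite ger0_norm ?powR_ge0 //.
apply: (@le_trans _ _ (1 `^ alpha)); last by rewrite powR1.
by apply: ge0_ler_powR; rewrite ?nnegrE ?enorm_ge0 //; exact: ltW.
Qed.

Section positive_dimension.
Hypothesis m0 : (0 < m)%N.

Let sm_gt0 : 0 < Num.sqrt m%:R :> R. Proof. by rewrite sqrtr_gt0 ltr0n. Qed.

Lemma scaled_gradient_ge0 u x : 0 <= scaled_gradient u x.
Proof. by rewrite divr_ge0 // sqrtr_ge0. Qed.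

Lemma gradient_normE u x : gradient_norm u x = Num.sqrt m%:R * scaled_gradient u x.
Proof. by rewrite /scaled_gradient; field; exact: lt0r_neq0. Qed.

Lemma scaled_gradient_sqr u x :
  \sum_i \sum_j weak_jacobian u x i j ^+ 2 = m%:R * scaled_gradient u x ^+ 2.
Proof.
rewrite -[X in X * _](sqr_sqrtr (ler0n R m)) -exprMn -gradient_normE /gradient_norm.
rewrite sqr_sqrtr; last by apply: sumr_ge0 => i _; apply: sumr_ge0 => j _; exact: sqr_ge0.
by apply: eq_bigr => i _; apply: eq_bigr => j _; rewrite mxE.
Qed.

Lemma Lp_scaled_gradient p u : (forall i j, Lp_ball p (fun x => weak_jacobian u x i j)) ->
  Lp_ball p (scaled_gradient u).
Proof.
move=> Ap; have sp : Lp_ball p (fun x => \sum_i \sum_j `|weak_jacobian u x i j|).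
  apply: Lp_ball_sum => i; apply: Lp_ball_sum => j; have [mA fA] := Ap i j; split.
    exact: measurableT_comp.
  by under eq_integral do rewrite normr_id.
have mg : measurable_fun B (scaled_gradient u).
  apply: measurable_funM; last exact: measurable_cst.
  have mS : measurable_fun B (fun x => \sum_i \sum_j weak_partial j (component u i) x ^+ 2).
    apply: measurable_sum => i; apply: measurable_sum => j; apply: measurable_funX.
    have [mA _] := Ap i j; rewrite (_ : weak_partial j _ = (fun x => weak_jacobian u x i j)) //.
    by apply/funext => x; rewrite mxE.
  exact: (measurableT_comp (continuous_measurable_fun (@sqrt_continuous R)) mS).
apply: (Lp_ball_dom mg (Lp_ball_integrable sp)) => x xB.
have S0 : 0 <= \sum_i \sum_j `|weak_jacobian u x i j|.
  by apply: sumr_ge0 => i _; apply: sumr_ge0.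
apply: lerXn2r; rewrite ?nnegrE // ger0_norm ?scaled_gradient_ge0 // ger0_norm //.
have s1 : 1 <= Num.sqrt m%:R :> R by rewrite -[leLHS]sqrtr1 ler_sqrt ?ler1n.
rewrite /scaled_gradient ler_pdivrMr //; apply: (@le_trans _ _ (\sum_i \sum_j `|weak_jacobian u x i j|)); last by rewrite ler_peMr.
rewrite /gradient_norm -[leRHS](ger0_norm S0) -sqrtr_sqr; apply: ler_wsqrtr.
have sq (I : finType) (b : I -> R) : (forall i, 0 <= b i) -> \sum_i b i ^+ 2 <= (\sum_i b i) ^+ 2.
  move=> b0; rewrite [leRHS]expr2 mulr_suml; apply: ler_sum => i _; rewrite expr2 ler_wpM2l //.
  by rewrite (bigD1 i) //= lerDl sumr_ge0.
apply: (@le_trans _ _ (\sum_i (\sum_j `|weak_jacobian u x i j|) ^+ 2)); last first.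
  by apply: sq => i; exact: sumr_ge0.
apply: ler_sum => i _; apply: le_trans (sq _ _ _); last by [].
by apply: ler_sum => j _; rewrite mxE real_normK ?num_real.
Qed.

Lemma mdiscZ q (c : R) (M A : 'M[R]_n) :
  mdisc (fun a : 'I_q.+1 => if a == ord0 then c *: M else A) =
  c * mdisc (fun a : 'I_q.+1 => if a == ord0 then M else A).
Proof.
rewrite /mdisc mulr_sumr; apply: eq_bigr => f _.
rewrite -[RHS]addr0 -[X in _ + X](mul0r (\det (\matrix_(a, b) (if a == ord0 then M else A) (f a) (f b)))).
apply: (determinant_multilinear (i0 := ord0)).
- by apply/rowP => b; rewrite !mxE mul0r addr0.
- by apply/matrixP => a b; rewrite !mxE.
- by apply/matrixP => a b; rewrite !mxE.
Qed.

Section exponent.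
Variable q : nat.
Hypothesis qm : (q < m)%N.
Local Notation p := q.+1.
Local Notation Kp := ((m ^_ p)%:R : R).
Local Notation Kq := ((m ^_ q)%:R : R).
Local Notation g := scaled_gradient.

Definition volume_term u x : R := mdisc (fun _ : 'I_p => weak_jacobian u x).
(** The second term of the Lagrangian with x in place of grad phi, which is a multiple of x for a
    radial weight. *)
Definition flux_term u x : R :=
  mdisc (fun a : 'I_p => if a == ord0 then (u x)^T *m x else weak_jacobian u x).
Local Notation D := volume_term.
Local Notation t := flux_term.

Let Kp_gt0 : 0 < Kp. Proof. by rewrite ltr0n ffact_gt0. Qed.
Let Kq_gt0 : 0 < Kq. Proof. by rewrite ltr0n ffact_gt0 ltnW. Qed.

Lemma lag_split u (c k : R) x :
  lag q c (k *: x) (u x) (weak_jacobian u x) = c * D u x + k * t u x.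
Proof. by rewrite /lag -scalemxAr mdiscZ. Qed.

Let radial_scale x : x != 0 -> x = enorm x *: radial x.
Proof.
move=> x0; rewrite /radial scalerA divff ?scale1r //; apply: lt0r_neq0; exact: enorm_gt0.
Qed.

Lemma flux_radial u x : x != 0 -> t u x = enorm x *
  mdisc (fun a : 'I_p => if a == ord0 then (u x)^T *m radial x else weak_jacobian u x).
Proof. by move=> x0; rewrite -mdiscZ scalemxAr -radial_scale. Qed.

Lemma term_bounds u x : x != 0 -> enorm (u x) = 1 -> u x *m weak_jacobian u x = 0 ->
  D u x <= Kp * g u x ^+ p /\ t u x <= Kq * enorm x * g u x ^+ q.
Proof.
move=> x0 u1 uA; have s := scaled_gradient_sqr u x; have g0 := scaled_gradient_ge0 u x.
split; first exact: (mdisc_ub m0 u1 uA g0 s p).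
rewrite flux_radial // [_ * enorm x]mulrC -mulrA; apply: ler_wpM2l; first exact: enorm_ge0.
exact: (mdisc_ub1 m0 u1 uA g0 s q (enorm_radial x0)).
Qed.

Lemma radial_values : {ae mu, forall x, B x -> [/\ x != 0, g (@radial R n) x = (enorm x)^-1,
  D (@radial R n) x = Kp * (enorm x)^-1 ^+ p & t (@radial R n) x = Kq * enorm x * (enorm x)^-1 ^+ q]}.
Proof.
have H := @radial_jacobian R m m0; apply: filterS H => x h xB.
have [x0 r1 E] := h xB; have ri : 0 <= (enorm x)^-1 by rewrite invr_ge0 enorm_ge0.
have E' : weak_jacobian (@radial R n) x = (enorm x)^-1 *: (1%:M - (radial x)^T *m radial x) := E.
split => //.
- have := scaled_gradient_sqr (@radial R n) x; rewrite E' (frobenius_radial _ r1).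
  move/mulfI; rewrite pnatr_eq0 -lt0n => /(_ m0) /esym /eqP.
  by rewrite eqrXn2 // ?scaled_gradient_ge0 // => /eqP.
- by rewrite /volume_term E' mdisc_radial.
- by rewrite flux_radial // E' mdisc_radial1 // mulrA [enorm x * _]mulrC.
Qed.

Lemma energyE (alpha : R) u : 0 <= alpha ->
  (forall i j, Lp_ball p (fun x => weak_jacobian u x i j)) ->
  mu.-integrable B (EFin \o (fun x => enorm x `^ alpha * g u x ^+ p)) /\
  energy p alpha u = (Num.sqrt m%:R ^+ p * \int[mu]_(x in B) (enorm x `^ alpha * g u x ^+ p))%:E.
Proof.
move=> al0 Ap; have gp := Lp_scaled_gradient Ap.
have gi : mu.-integrable B (EFin \o (fun x => g u x ^+ p)).
  have := Lp_ball_integrable gp; congr (mu.-integrable B (EFin \o _)); apply/funext => x.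
  by rewrite ger0_norm ?scaled_gradient_ge0.
have i := integrable_bounded_mul (measurable_funTS (measurable_powR_enorm alpha))
  (fun x xB => powR_enorm_le1 al0 xB) gi.
split=> //; rewrite -(RintegralZl _ mball i) /energy.
have j : mu.-integrable B (EFin \o (fun x => Num.sqrt m%:R ^+ p * (enorm x `^ alpha * g u x ^+ p))).
  exact: (integrableZl mball (Num.sqrt m%:R ^+ p) i).
rewrite /Rintegral; apply: (etrans _ (esym (fineK (integrable_fin_num mball j)))).
apply: eq_integral => x _; rewrite gradient_normE exprMn; apply: (congr1 EFin).
by rewrite mulrCA.
Qed.

Section weight.
Variables (alpha d : R).
Hypotheses (al0 : 0 <= alpha) (d0 : 0 < d) (d1 : d <= 1).

Definition weight x : R := (nsq x + d) `^ (alpha / 2).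
(** The radial factor in grad phi = alpha psi x, where phi is [weight] and psi this function. *)
Definition weight' x : R := weight x / (nsq x + d).
Local Notation phi := weight.
Local Notation psi := weight'.

Let S_gt0 x : 0 < nsq x + d. Proof. by rewrite ltr_wpDl // nsq_ge0. Qed.

Let Ck_S k : Ck k (fun x : 'rV[R]_n => nsq x + d).
Proof. by apply: CkD; [exact: Ck_nsq|exact: Ck_cst]. Qed.

Let Ck_phi : Ck 1 phi. Proof. by apply: Ck_powR. Qed.

Let Ck_psi : Ck 1 psi.
Proof.
apply: CkM; first exact: Ck_phi.
have -> : (fun x : 'rV[R]_n => (nsq x + d)^-1) = (fun x => (nsq x + d) `^ (-1)).
  by apply/funext => x; rewrite powR_inv1 // ltW.
exact: Ck_powR.
Qed.

Let grad_phi x : grad phi x = (alpha * psi x) *: x.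
Proof.
apply/rowP => j; rewrite !mxE.
apply: (etrans (partial_powR (alpha / 2) (S_gt0 x) (Ck_derivable (Ck_S 1)))).
have -> : partial j (fun y : 'rV[R]_n => nsq y + d) x = 2 * x 0 j.
  rewrite partialD; [|exact: (Ck_derivable (Ck_nsq 1))|exact: derivable_cst].
  by rewrite partial_cst addr0 partial_nsq.
have -> : (nsq x + d) `^ (alpha / 2 - 1) = psi x.
  rewrite powRD; last by apply/implyP => _; rewrite gt_eqF.
  by rewrite powR_inv1 // ltW.
by field.
Qed.

Let phi_ge0 x : 0 <= phi x. Proof. exact: powR_ge0. Qed.

Let psi_ge0 x : 0 <= psi x. Proof. by rewrite divr_ge0 // ltW. Qed.

Let enorm_pow x : (nsq x) `^ (alpha / 2) = enorm x `^ alpha.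
Proof.
rewrite nsqE -powR_mulrn ?enorm_ge0 // -powRrM; congr (_ `^ _).
by field.
Qed.

(** In the ball nsq x + d <= 2, while the power of nsq x + d is at least that of nsq x. The lower
    bound is independent of d. *)
Let psi_lower x : B x -> enorm x `^ alpha / 2 <= psi x.
Proof.
move=> xB; have x1 := (unit_ballE x).1 xB.
apply: ler_pM => //; first exact: powR_ge0.
  rewrite -enorm_pow; apply: ge0_ler_powR; rewrite ?nnegrE ?nsq_ge0 ?(ltW (S_gt0 x)) //.
    by rewrite divr_ge0.
  by rewrite lerDl ltW.
by rewrite lef_pV2 ?posrE //; move: (nsq x) x1 => s; have := d1; lra.
Qed.

(** The weight 1, whose gradient vanishes, isolates the volume term of the Lagrangian. *)
Let iD u : (forall i, Lp_ball p (component u i)) ->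
  (forall i j, Lp_ball p (fun x => weak_jacobian u x i j)) ->
  mu.-integrable B (EFin \o D u).
Proof.
move=> up Ap; have := lag_integrable (Ck_cst 1 (1 : R)) up Ap.
congr (mu.-integrable B (EFin \o _)); apply/funext => x.
have -> : grad (cst 1) x = 0 *: x.
  by apply/rowP => j; rewrite !mxE partial_cst mul0r.
by rewrite lag_split mul1r mul0r addr0.
Qed.

(** The weight |x|^2 has gradient 2 x: its Lagrangian minus |x|^2 times the volume term is twice the
    flux term. *)
Lemma integrable_flux_term u : (forall i, Lp_ball p (component u i)) ->
  (forall i j, Lp_ball p (fun x => weak_jacobian u x i j)) ->
  mu.-integrable B (EFin \o t u).
Proof.
move=> up Ap; have h := lag_integrable (Ck_nsq 1) up Ap.
have h1 : mu.-integrable B (EFin \o (fun x => nsq x * D u x)).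
  apply: (integrable_bounded_mul (M := 1) _ _ (iD up Ap)).
    by apply: measurable_funTS; apply: continuous_measurable_rV; exact: (Ck_continuous (Ck_nsq 0)).
  by move=> x /unit_ballE xB; rewrite ger0_norm ?nsq_ge0 // ltW.
have := integrableZl mball 2^-1 (integrableB mball h h1).
congr (mu.-integrable B _); apply/funext => x /=; congr EFin.
have -> : grad (@nsq R n) x = 2 *: x.
  by apply/rowP => j; rewrite !mxE partial_nsq.
by rewrite lag_split [X in _ * X]addrAC subrr add0r mulrA mulVf ?mul1r.
Qed.

Definition deficit_of u x : R := deficit q Kq (enorm x) (g u x) (t u x).

Let Lp_inv := @Lp_inv_enorm R m q qm.

Definition excess u x : R := g u x ^+ p - (enorm x)^-1 ^+ p.

Lemma integrable_excess u : (forall i j, Lp_ball p (fun x => weak_jacobian u x i j)) ->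
  mu.-integrable B (EFin \o excess u).
Proof.
move=> Ap; have h1 := Lp_ball_integrable (Lp_scaled_gradient Ap); have h2 := Lp_ball_integrable Lp_inv.
have := integrableB mball h1 h2; congr (mu.-integrable B _); apply/funext => x /=; congr EFin.
by rewrite !ger0_norm ?scaled_gradient_ge0 // invr_ge0 enorm_ge0.
Qed.

Let m_enormX (k : nat) : measurable_fun B (fun x => enorm x ^+ k).
Proof. by apply: measurable_funTS; apply: measurable_funX; exact: measurable_enorm. Qed.

Let enormX_le1 (k : nat) x : B x -> `|enorm x ^+ k| <= 1.
Proof.
move=> xB; rewrite normrX ger0_norm ?enorm_ge0 //.
exact: (exprn_ile1 _ (enorm_ge0 x) (ltW xB)).
Qed.

Lemma integrable_deficit u : (forall i, Lp_ball p (component u i)) ->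
  (forall i j, Lp_ball p (fun x => weak_jacobian u x i j)) ->
  mu.-integrable B (EFin \o deficit_of u).
Proof.
move=> up Ap.
have h2 : mu.-integrable B (EFin \o (fun x => (enorm x)^-1 ^+ p)).
  have := Lp_ball_integrable Lp_inv; congr (mu.-integrable B _); apply/funext => x /=; congr EFin.
  by rewrite ger0_norm // invr_ge0 enorm_ge0.
have i1 := integrableZl mball Kq (integrable_bounded_mul (m_enormX 2) (enormX_le1 2) h2).
have i2 := integrable_flux_term up Ap.
have i3 := integrableZl mball (Kq * (q%:R / p%:R))
  (integrable_bounded_mul (m_enormX 2) (enormX_le1 2) (integrable_excess Ap)).
have := integrableD mball (integrableB mball i1 i2) i3.
congr (mu.-integrable B _); apply/funext => x /=; congr EFin.
rewrite /deficit_of /deficit /excess.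
have -> : Kq * enorm x * (enorm x)^-1 ^+ q = Kq * (enorm x ^+ 2 * (enorm x)^-1 ^+ p).
  have [e0|e0] := eqVneq (enorm x) 0; first by rewrite e0 !(mulr0, mul0r, expr0n).
  by rewrite [(enorm x)^-1 ^+ p]exprS; move: (enorm x) e0 ((enorm x)^-1 ^+ q) => r r0 y; field.
by move: (g u x ^+ p) ((enorm x)^-1 ^+ p) (enorm x ^+ 2) => y z r2; ring.
Qed.

(** The Lagrangians of u and of [radial] have the same integral, so integrating [lagrangian_gap]
    leaves only the deficit on the left. *)
Lemma weighted_gap u : admissible p u ->
  alpha * \int[mu]_(x in B) (enorm x `^ alpha / 2 * deficit_of u x) <=
  \int[mu]_(x in B) ((Kp * phi x + alpha * (Kq * (q%:R / p%:R)) * (psi x * nsq x)) * excess u x).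
Proof.
move=> /admissible_facts[up Ap ua uae].
have [rp rA ra _] := admissible_facts (@radial_admissible R m q qm).
have Eu := lag_limit Ck_phi up Ap ua; have Er := lag_limit Ck_phi rp rA ra.
have Iu := lag_integrable Ck_phi up Ap; have Ir := lag_integrable Ck_phi rp rA.
have md : measurable_fun B (fun x => enorm x `^ alpha / 2).
  by apply: measurable_funM; [exact: measurable_funTS (measurable_powR_enorm alpha)|exact: measurable_cst].
have Is : mu.-integrable B (EFin \o (fun x => enorm x `^ alpha / 2 * deficit_of u x)).
  apply: (integrable_bounded_mul (M := 1) md _ (integrable_deficit up Ap)) => x xB.
  rewrite normrM -[leRHS]mul1r; apply: ler_pM => //; first exact: powR_enorm_le1.
  by rewrite ger0_norm // invf_le1 // ler1n.
have IW : mu.-integrable B (EFin \o (fun x =>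
    (Kp * phi x + alpha * (Kq * (q%:R / p%:R)) * (psi x * nsq x)) * excess u x)).
  have c : continuous (fun x => Kp * phi x + alpha * (Kq * (q%:R / p%:R)) * (psi x * nsq x)).
    apply: (@Ck_continuous _ _ 0); apply: CkD.
      by apply: CkM; [exact: Ck_cst|exact: (CkW Ck_phi)].
    apply: CkM; first exact: Ck_cst.
    by apply: CkM; [exact: (CkW Ck_psi)|exact: Ck_nsq].
  have [M M0 HM] := continuous_ball_bounded c.
  apply: (integrable_bounded_mul (M := M) _ _ (integrable_excess Ap)).
    by apply: measurable_funTS; exact: continuous_measurable_rV.
  by move=> x xB; apply: HM; exact: ltW xB.
have Z : \int[mu]_(x in B) (lag q (phi x) (grad phi x) (u x) (weak_jacobian u x) -
    lag q (phi x) (grad phi x) (radial x) (weak_jacobian (@radial R n) x)) = 0.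
  by rewrite (RintegralB mball Iu Ir) Eu Er subrr.
rewrite -(RintegralZl _ mball Is).
have IZ := integrableB mball Iu Ir; have IsZ := integrableZl mball alpha Is.
rewrite -[leLHS]add0r -[X in X + _]Z -(RintegralD mball IZ IsZ).
apply: (ae_le_Rintegral (integrableD mball IZ IsZ) IW).
have H2 := radial_values.
apply: filterS2 uae H2 => x hu hr xB; have [u1 uA] := hu xB; have [x0 _ rD rt] := hr xB.
have [bD bt] := term_bounds x0 u1 uA.
rewrite grad_phi !lag_split rD rt [alpha * (_ * deficit_of _ _)]mulrA nsqE.
exact: (lagrangian_gap (enorm_gt0 x0) (scaled_gradient_ge0 u x) (ltW Kq_gt0)
  (phi_ge0 x) (psi_lower xB) (psi_ge0 x) al0 bD bt).
Qed.

End weight.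

(** The regularization parameter tends to 0 in [weighted_gap]. Both phi and psi |x|^2 tend to
    |x|^alpha away from the origin, so the two weights merge into one constant times |x|^alpha; the
    left side does not depend on the parameter. *)
Lemma weighted_excess_ge (alpha : R) u : 0 <= alpha -> admissible p u ->
  mu.-integrable B (EFin \o (fun x => enorm x `^ alpha / 2 * deficit_of u x)) /\
  alpha * \int[mu]_(x in B) (enorm x `^ alpha / 2 * deficit_of u x) <=
  (Kp + alpha * (Kq * (q%:R / p%:R))) * \int[mu]_(x in B) (enorm x `^ alpha * excess u x).
Proof.
move=> al0 ua; have [up Ap _ _] := admissible_facts ua.
have Ih := integrable_excess Ap.
split.
  have md : measurable_fun B (fun x => enorm x `^ alpha / 2).
    by apply: measurable_funM; [exact: measurable_funTS (measurable_powR_enorm alpha)|exact: measurable_cst].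
  apply: (integrable_bounded_mul (M := 1) md _ (integrable_deficit up Ap)) => x xB.
  rewrite normrM -[leRHS]mul1r; apply: ler_pM => //; first exact: powR_enorm_le1.
  by rewrite ger0_norm // invf_le1 // ler1n.
pose c : R := alpha * (Kq * (q%:R / p%:R)).
have c0 : 0 <= c by rewrite !mulr_ge0 ?invr_ge0 ?ler0n.
pose d (k : nat) : R := k.+1%:R^-1.
have d0 k : 0 < d k by rewrite invr_gt0.
have d1 k : d k <= 1 by rewrite invf_le1 // ler1n.
pose W k x := Kp * weight alpha (d k) x + c * (weight' alpha (d k) x * nsq x).
have S0 k x : 0 < nsq x + d k by rewrite ltr_wpDl // nsq_ge0.
pose M : R := 2 `^ (alpha / 2).
have phiM k x : B x -> weight alpha (d k) x <= M.
  move=> xB; have x1 := (unit_ballE x).1 xB.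
  apply: ge0_ler_powR; rewrite ?nnegrE ?(ltW (S0 k x)) //; first by rewrite divr_ge0.
  by have := d1 k; move: (nsq x) (d k) x1 => s e; lra.
have phi0 k x : 0 <= weight alpha (d k) x by exact: powR_ge0.
(* Division by nsq x + d is harmless after multiplication by nsq x, which yields a bound uniform in
   k. *)
have psi_le k x : weight' alpha (d k) x * nsq x <= weight alpha (d k) x.
  rewrite /weight' -mulrA; apply: (ler_piMr (phi0 k x)).
  by rewrite mulrC ler_pdivrMr // mul1r lerDl ltW.
have psi0 k x : 0 <= weight' alpha (d k) x * nsq x.
  by apply: mulr_ge0; [apply: divr_ge0 => //; exact: ltW|exact: nsq_ge0].
have Wb k x : B x -> `|W k x| <= (Kp + c) * M.
  move=> xB; rewrite ger0_norm; last by rewrite addr_ge0 // mulr_ge0.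
  rewrite mulrDl; apply: lerD; apply: ler_wpM2l => //; first exact: phiM.
  exact: le_trans (psi_le k x) (phiM k x xB).
have CkS k l : Ck l (fun x : 'rV[R]_n => nsq x + d k).
  by apply: CkD; [exact: Ck_nsq|exact: Ck_cst].
have Wc k : continuous (W k).
  apply: (@Ck_continuous _ _ 0); apply: CkD.
    by apply: CkM; [exact: Ck_cst|apply: Ck_powR; [exact: S0|exact: CkS]].
  apply: CkM; first exact: Ck_cst.
  apply: CkM; last exact: Ck_nsq.
  apply: CkM; first by apply: Ck_powR; [exact: S0|exact: CkS].
  have -> : (fun x : 'rV[R]_n => (nsq x + d k)^-1) = (fun x => (nsq x + d k) `^ (-1)).
    by apply/funext => x; rewrite powR_inv1 // ltW.
  by apply: Ck_powR; [exact: S0|exact: CkS].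
have mh : measurable_fun B (excess u) by apply/measurable_EFinP; exact: (integrableP _ _ _ Ih).1.
have mW k : measurable_fun B (fun x => W k x * excess u x).
  by apply: measurable_funM => //; apply: measurable_funTS; exact: continuous_measurable_rV.
have mr : measurable_fun B (fun x => (Kp + c) * (enorm x `^ alpha * excess u x)).
  apply: measurable_funM => //; apply: measurable_funM => //.
  exact: measurable_funTS (measurable_powR_enorm alpha).
have KM : 0 <= (Kp + c) * M by rewrite mulr_ge0 ?addr_ge0 ?powR_ge0.
have cW : {ae mu, forall x, B x -> W k x * excess u x @[k --> \oo] --> (Kp + c) * (enorm x `^ alpha * excess u x)}.
  apply: filterS ae_neq0 => x h xB; have r0 := enorm_gt0 (h xB).
  have s0 : 0 < nsq x by rewrite nsqE exprn_gt0.
  have Sc : nsq x + d k @[k --> \oo] --> nsq x.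
    rewrite -[X in _ --> X]addr0; apply: cvgD; [exact: cvg_cst|exact: cvg_harmonic].
  have pc : weight alpha (d k) x @[k --> \oo] --> enorm x `^ alpha.
    have -> : enorm x `^ alpha = nsq x `^ (alpha / 2).
      by rewrite nsqE -powR_mulrn ?enorm_ge0 // -powRrM; congr (_ `^ _); field.
    have pc0 : {for nsq x, continuous (fun t : R => t `^ (alpha / 2))}.
      apply/differentiable_continuous/derivable1_diffP.
      by have [] := @is_derive1_powR R (alpha / 2) (nsq x) s0.
    exact: (cvg_comp _ _ Sc pc0).
  rewrite mulrA; apply: cvgM; last exact: cvg_cst.
  rewrite mulrDl; apply: cvgD; first by apply: cvgM => //; exact: cvg_cst.
  apply: cvgM; first exact: cvg_cst.
  have -> : enorm x `^ alpha = enorm x `^ alpha * (nsq x)^-1 * nsq x by rewrite mulfVK // gt_eqF.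
  apply: cvgM; last exact: cvg_cst.
  by apply: cvgM => //; apply: cvgV => //; rewrite gt_eqF.
have hb (k : nat) x : B x -> `|W k x * excess u x| <= (Kp + c) * M * `|excess u x|.
  by move=> xB; rewrite normrM ler_wpM2r // Wb.
have ib : mu.-integrable B (EFin \o (fun x => (Kp + c) * M * `|excess u x|)).
  exact: (integrableZl mball ((Kp + c) * M) (integrable_abse Ih)).
have [_ C] := Rintegral_dominated mW mr cW ib hb.
have Ih' : mu.-integrable B (EFin \o (fun x => enorm x `^ alpha * excess u x)).
  apply: (integrable_bounded_mul _ (fun x xB => powR_enorm_le1 al0 xB) Ih).
  exact: measurable_funTS (measurable_powR_enorm alpha).
rewrite -(RintegralZl _ mball Ih') -(cvg_lim (@norm_hausdorff _ _) C).
apply: limr_ge; first by apply/cvg_ex; eexists; exact: C.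
near=> k; exact: weighted_gap.
Unshelve. all: by end_near. Qed.

Lemma deficit_of_ge0 u : admissible p u -> {ae mu, forall x, B x -> 0 <= deficit_of u x}.
Proof.
move=> ua; have [_ _ _ uae] := admissible_facts ua; have H := ae_neq0 (R := R) (m := m).
apply: filterS2 uae H => x hu x0 xB; have [u1 uA] := hu xB.
have [_ bt] := term_bounds (x0 xB) u1 uA.
exact: (deficit_ge0 (enorm_gt0 (x0 xB)) (scaled_gradient_ge0 u x) (ltW Kq_gt0) bt).
Qed.

Lemma energy_excess (alpha : R) u : 0 <= alpha -> admissible p u ->
  energy p alpha u = (energy p alpha (@radial R n) +
    (Num.sqrt m%:R ^+ p * \int[mu]_(x in B) (enorm x `^ alpha * excess u x))%:E)%E.
Proof.
move=> al0 ua; have [up Ap _ _] := admissible_facts ua.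
have [rp rA _ _] := admissible_facts (@radial_admissible R m q qm).
have [Iu ->] := energyE al0 Ap; have [Ir ->] := energyE al0 rA.
rewrite -EFinD -mulrDr; congr (_ * _)%:E.
have Ie : mu.-integrable B (EFin \o (fun x => enorm x `^ alpha * excess u x)).
  apply: (integrable_bounded_mul _ (fun x xB => powR_enorm_le1 al0 xB) (integrable_excess Ap)).
  exact: measurable_funTS (measurable_powR_enorm alpha).
rewrite -(RintegralD mball Ir Ie); congr fine; apply: ae_eq_integral.
- exact: mball.
- exact: (integrableP _ _ _ Iu).1.
- exact: (integrableP _ _ _ (integrableD mball Ir Ie)).1.
- have H := radial_values; apply: filterS H => x h xB; have [_ E _ _] := h xB.
  by rewrite /= E /excess -mulrDr addrCA subrr addr0.
Qed.

Lemma excess_ge0 (alpha : R) u : 0 <= alpha -> admissible p u ->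
  0 <= \int[mu]_(x in B) (enorm x `^ alpha * excess u x).
Proof.
move=> al0 ua; have [Is h] := weighted_excess_ge al0 ua.
have c0 : 0 < Kp + alpha * (Kq * (q%:R / p%:R)).
  by rewrite ltr_wpDr // !mulr_ge0 ?invr_ge0 ?ler0n.
rewrite -(pmulr_rge0 _ c0); apply: le_trans h; apply: mulr_ge0 => //.
apply: Rintegral_ae_ge0 => //; apply: filterS (deficit_of_ge0 ua) => x hx xB.
by apply: mulr_ge0; [rewrite divr_ge0 ?powR_ge0|exact: hx].
Qed.

(** Equal energies make the weighted excess integrate to 0. As alpha > 0, the integral of the
    nonnegative weighted deficit is then at most 0, so the deficit vanishes almost everywhere. *)
Lemma energy_equality (alpha : R) u : 0 < alpha -> admissible p u ->
  energy p alpha (@radial R n) = energy p alpha u ->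
  {ae mu, forall x, B x -> t u x = Kq * enorm x * g u x ^+ q /\ ((0 < q)%N -> g u x = (enorm x)^-1)}.
Proof.
move=> al0 ua E; have al1 := ltW al0.
have [Is h] := weighted_excess_ge al1 ua.
have [rp rA _ _] := admissible_facts (@radial_admissible R m q qm).
have [_ Er] := energyE al1 rA.
have Z : \int[mu]_(x in B) (enorm x `^ alpha * excess u x) = 0.
  have := energy_excess al1 ua; rewrite -E Er -EFinD => -[] /eqP.
  rewrite addrC -subr_eq subrr eq_sym mulf_eq0 => /orP[|/eqP //].
  by rewrite expf_eq0 /= gt_eqF.
rewrite Z mulr0 in h.
have s0 : {ae mu, forall x, B x -> 0 <= enorm x `^ alpha / 2 * deficit_of u x}.
  apply: filterS (deficit_of_ge0 ua) => x hx xB.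
  by apply: mulr_ge0; [rewrite divr_ge0 ?powR_ge0|exact: hx].
have h' : \int[mu]_(x in B) (enorm x `^ alpha / 2 * deficit_of u x) <= 0.
  by rewrite -(pmulr_rle0 _ al0).
have H := Rintegral_ae_eq0 Is s0 h'.
have [_ _ _ uae] := admissible_facts ua; have H0 := ae_neq0 (R := R) (m := m).
have H2 : {ae mu, forall x, B x -> x != 0 /\ (enorm (u x) = 1 /\ u x *m weak_jacobian u x = 0)}.
  by apply: filterS2 uae H0 => x h1 h2 xB; split; [exact: h2|exact: h1].
apply: filterS2 H H2 => x hx h2 xB; have [x0 [u1 uA]] := h2 xB.
have r0 := enorm_gt0 x0; have [_ bt] := term_bounds x0 u1 uA.
have w0 : 0 < enorm x `^ alpha / 2 := divr_gt0 (powR_gt0 alpha r0) (@ltr0Sn R 1).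
have /eqP := hx xB; rewrite mulf_eq0 (gt_eqF w0) => /eqP d0; exact: (deficit_eq0 r0 (scaled_gradient_ge0 u x) Kq_gt0 bt d0).
Qed.

End exponent.

Lemma flux_term_eq u x : x != 0 -> enorm (u x) = 1 -> flux_term 0 u x = enorm x -> u x = radial x.
Proof.
move=> x0 u1; rewrite flux_radial // mdisc1 eqxx => E.
apply: (unit_vectors_eq u1 (enorm_radial x0)).
by apply: (mulfI (lt0r_neq0 (enorm_gt0 x0))); rewrite E mulr1.
Qed.

(** Once g = 1 / |x|, both terms of the Lagrangian with p = 1 and weight |x|^2 are pointwise at most
    those of [radial]. Their integrals agree, hence so do the flux terms almost everywhere, that is
    u . x = |x|. *)
Lemma gradient_rigidity q u : (q < m)%N -> admissible q.+1 u ->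
  {ae mu, forall x, B x -> scaled_gradient u x = (enorm x)^-1} ->
  {ae mu, forall x, B x -> u x = radial x}.
Proof.
have alg (a b c d : R) : a <= b -> c <= d -> b + 2 * d - (a + 2 * c) = 0 -> c = d by move=> ? ? ?; lra.
move=> qm ua gE; have [up Ap uap uae] := admissible_facts ua.
have u1p i := Lp_ball1 (up i); have A1p i j := Lp_ball1 (Ap i j).
have ua1 := approximable1 up Ap uap.
have [rp rA ra _] := admissible_facts (@radial_admissible R m 0 m0).
have Eu := lag_limit (q := 0) (Ck_nsq 1) u1p A1p ua1.
have Er := lag_limit (q := 0) (Ck_nsq 1) rp rA ra.
have Iu := lag_integrable (q := 0) (Ck_nsq 1) u1p A1p.
have Ir := lag_integrable (q := 0) (Ck_nsq 1) rp rA.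
have gn x : grad (@nsq R n) x = 2 *: x by apply/rowP => j; rewrite !mxE partial_nsq.
have H0 := radial_values 0.
have P : {ae mu, forall x, B x -> [/\ x != 0, enorm (u x) = 1,
    volume_term 0 u x <= volume_term 0 (@radial R n) x,
    flux_term 0 u x <= flux_term 0 (@radial R n) x & flux_term 0 (@radial R n) x = enorm x]}.
  have H1 : {ae mu, forall x, B x -> scaled_gradient u x = (enorm x)^-1 /\
      (enorm (u x) = 1 /\ u x *m weak_jacobian u x = 0)}.
    by apply: filterS2 gE uae => x h1 h2 xB; split; [exact: h1|exact: h2].
  apply: filterS2 H1 H0 => x h1 h2 xB; have [ge [e1 eA]] := h1 xB; have [x0 _ rD rt] := h2 xB.
  have [bD bt] := term_bounds 0 x0 e1 eA; rewrite ge in bD bt.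
  split => //; first by rewrite rD.
    by rewrite rt.
  by rewrite rt expr0 mulr1 ffactn0 mul1r.
have J := integrableB mball Ir Iu.
have N : {ae mu, forall x, B x -> 0 <= lag 0 (nsq x) (grad (@nsq R n) x) (radial x) (weak_jacobian (@radial R n) x) -
    lag 0 (nsq x) (grad (@nsq R n) x) (u x) (weak_jacobian u x)}.
  apply: filterS P => x h xB; have [x0 _ hD ht _] := h xB.
  by rewrite subr_ge0 gn !lag_split; apply: lerD; apply: ler_wpM2l => //; exact: nsq_ge0.
have Z : \int[mu]_(x in B) (lag 0 (nsq x) (grad (@nsq R n) x) (radial x) (weak_jacobian (@radial R n) x) -
    lag 0 (nsq x) (grad (@nsq R n) x) (u x) (weak_jacobian u x)) <= 0.
  by rewrite (RintegralB mball Ir Iu) Eu Er subrr.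
have H := Rintegral_ae_eq0 J N Z.
apply: filterS2 H P => x hx hP xB; have [x0 e1 hD ht hr] := hP xB.
apply: (flux_term_eq x0 e1); have := hx xB; rewrite gn !lag_split hr.
have h1 : nsq x * volume_term 0 u x <= nsq x * volume_term 0 (@radial R n) x.
  by apply: ler_wpM2l => //; exact: nsq_ge0.
by rewrite hr in ht; exact: alg h1 ht.
Qed.

(** For p = 1 the deficit carries no information on g, but g^0 = 1 turns its equality case directly
    into u . x = |x|. For larger p it gives g = 1 / |x|, and the gradient alone determines the
    map. *)
Lemma equality_rigidity q (alpha : R) u : (q < m)%N -> 0 < alpha -> admissible q.+1 u ->
  energy q.+1 alpha (@radial R n) = energy q.+1 alpha u ->
  {ae mu, forall x, B x -> u x = radial x}.
Proof.
case: q => [|q] qm al0 ua E; have H := energy_equality qm al0 ua E; last first.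
  apply: (gradient_rigidity qm ua).
  by apply: filterS H => x h xB; have [_ ->] := h xB.
have [_ _ _ uae] := admissible_facts ua; have H0 := ae_neq0 (R := R) (m := m).
have H2 : {ae mu, forall x, B x -> x != 0 /\ enorm (u x) = 1}.
  by apply: filterS2 uae H0 => x h1 h2 xB; split; [exact: h2|have [] := h1 xB].
apply: filterS2 H H2 => x h1 h2 xB; have [x0 u1] := h2 xB; have [tE _] := h1 xB.
apply: (flux_term_eq x0 u1); apply: (etrans tE).
by rewrite expr0 mulr1 ffactn0 mul1r.
Qed.

End positive_dimension.

(** The energy is defined through a chosen representative of the weak derivatives, so the invariance
    rests on their uniqueness almost everywhere. *)
Lemma energy_ae q (alpha : R) u v : 0 <= alpha -> (0 < m)%N ->
  admissible q.+1 u -> admissible q.+1 v ->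
  {ae mu, forall x, B x -> u x = v x} -> energy q.+1 alpha u = energy q.+1 alpha v.
Proof.
move=> al0 m0 ua va uv.
have [up Ap _ _] := admissible_facts ua; have [vp Av _ _] := admissible_facts va.
have [Iu ->] := energyE m0 al0 Ap; have [Iv ->] := energyE m0 al0 Av.
have W i j : {ae mu, forall x, B x -> weak_partial j (component u i) x = weak_partial j (component v i) x}.
  have [_ Wu] := sobolev_weak_partial j (ua.1.1 i).
  have [_ Wv] := sobolev_weak_partial j (va.1.1 i).
  have lv : locally_integrable_ball (component v i) by case: Wv.
  have uvi : {ae mu, forall x, B x -> component u i x = component v i x}.
    by apply: filterS uv => x h xB; rewrite /component h.
  exact: (weak_partial_unique (is_weak_partial_ae lv uvi Wu) Wv).
have W1 (i : 'I_n) : {ae mu, forall x, forall j : 'I_n, B x ->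
    weak_partial j (component u i) x = weak_partial j (component v i) x}.
  exact: (@filter_forall _ _ (fun (j : 'I_n) (x : 'rV[R]_n) => B x ->
    weak_partial j (component u i) x = weak_partial j (component v i) x) (almost_everywhere mu) _ (W i)).
have W2 : {ae mu, forall x, forall i j : 'I_n, B x ->
    weak_partial j (component u i) x = weak_partial j (component v i) x}.
  exact: (@filter_forall _ _ (fun (i : 'I_n) (x : 'rV[R]_n) => forall j, B x ->
    weak_partial j (component u i) x = weak_partial j (component v i) x) (almost_everywhere mu) _ W1).
have E : {ae mu, forall x, B x -> scaled_gradient u x = scaled_gradient v x}.
  apply: filterS W2 => x h xB; apply: (congr1 (fun s : R => Num.sqrt s / Num.sqrt m%:R)).
  by apply: eq_bigr => i _; apply: eq_bigr => j _; rewrite (h i j xB).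
apply: (congr1 (fun s : \bar R => (Num.sqrt m%:R ^+ q.+1 * fine s)%:E)); apply: ae_eq_integral.
- exact: mball.
- exact: (integrableP _ _ _ Iu).1.
- exact: (integrableP _ _ _ Iv).1.
- by apply: filterS E => x h xB; rewrite /= (h xB).
Qed.

End minimality.

Theorem theorem0p2 (R : realType) (n p : nat) (alpha : R)
    (n_ge3 : (3 <= n)%N) (p_range : (1 <= p <= n.-1)%N)
    (alpha_ge0 : 0 <= alpha) :
  [/\ admissible p (@radial R n),
      forall u : 'rV[R]_n -> 'rV[R]_n, admissible p u ->
        (energy p alpha (@radial R n) <= energy p alpha u)%E
    & 0 < alpha ->
      forall u : 'rV[R]_n -> 'rV[R]_n, admissible p u ->
        (energy p alpha (@radial R n) = energy p alpha u <->
         {ae lebesgue_rV, forall x, unit_ball x -> u x = radial x})].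
Proof.
case: n n_ge3 p_range => [//|m] n_ge3; case: p => [//|q] /= qm.
have m0 : (0 < m)%N by apply: leq_trans qm.
have ra := @radial_admissible R m q qm.
split; [exact: ra|move=> u ua|move=> alpha_gt0 u ua].
  rewrite (energy_excess m0 qm alpha_ge0 ua) leeDl // lee_fin.
  exact: (mulr_ge0 (exprn_ge0 _ (sqrtr_ge0 _)) (excess_ge0 m0 qm alpha_ge0 ua)).
split; first exact: (equality_rigidity m0 qm alpha_gt0 ua).
by move=> uE; apply/esym; exact: (energy_ae alpha_ge0 m0 ua ra uE).
Qed.
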